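(* Let $U$ be a real Banach space with dual $U^\ast$ and closed unit ball $B_U$, let $\nu$ be a $\sigma$-finite measure on $\mathcal{B}(U)$ and let $h:\mathbb{R}\to\mathbb{R}$ be a truncation function. Then the following are equivalent: (a) $\nu$ is a Lévy measure; (b) there exists an infinitely divisible cylindrical probability measure $\mu$ on $\mathcal{Z}(U)$ with cylindrical characteristics $(d_\nu,0,\nu)_h$ which extends to a Radon measure on $\mathcal{B}(U)$, where $$d_\nu:U^\ast\to\mathbb{R},\qquad d_\nu(a):=\int_U\big(h(\langle u,a\rangle)-\langle u,a\rangle\mathbf{1}_{B_U}(u)\big)\,\nu(du).$$ In this situation, the Radon probability measure with characteristic function $$a\mapsto\exp\Big(\int_U\big(e^{i\langle u,a\rangle}-1-i\langle u,a\rangle\mathbf{1}_{B_U}(u)\big)\,\nu(du)\Big),\qquad a\in U^\ast,$$ corresponding to the Lévy measure $\nu$, coincides with the Radon extension of $\mu$.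
   Context: $\langle u,a\rangle$ is the dual pairing of $u\in U$, $a\in U^\ast$; $B_U=\{u\in U:\|u\|\le1\}$. A $\sigma$-finite measure $\nu$ on the Borel $\sigma$-algebra $\mathcal{B}(U)$ is called a Lévy measure if (i) $\int_U(\langle u,a\rangle^2\wedge1)\,\nu(du)<\infty$ for all $a\in U^\ast$, and (ii) there exists a Radon probability measure on $\mathcal{B}(U)$ with characteristic function $a\mapsto\exp\big(\int_U(e^{i\langle u,a\rangle}-1-i\langle u,a\rangle\mathbf{1}_{B_U}(u))\,\nu(du)\big)$, $a\in U^\ast$. For $a_1,\dots,a_n\in U^\ast$ let $\pi_{a_1,\dots,a_n}:U\to\mathbb{R}^n$, $\pi_{a_1,\dots,a_n}(u)=(\langle u,a_1\rangle,\dots,\langle u,a_n\rangle)$. For $\Gamma\subseteq U^\ast$, $\mathcal{Z}(U,\Gamma)$ is the algebra of cylindrical sets $\pi_{a_1,\dots,a_n}^{-1}(B)$ with $n\in\mathbb{N}$, $a_1,\dots,a_n\in\Gamma$, $B\in\mathcal{B}(\mathbb{R}^n)$; $\mathcal{C}(U,\Gamma)$ is the $\sigma$-algebra it generates; $\mathcal{Z}(U):=\mathcal{Z}(U,U^\ast)$. A cylindrical measure is a function $\mu:\mathcal{Z}(U)\to[0,\infty]$ whose restriction to $\mathcal{C}(U,\Gamma)$ is a measure for every finite $\Gamma\subseteq U^\ast$; it is a cylindrical probability measure if $\mu(U)=1$. The characteristic function is $\varphi_\mu(a)=\int_U e^{i\langle u,a\rangle}\mu(du)$, $a\in U^\ast$.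 The convolution of cylindrical probability measures is defined by convolving all image measures under the maps $\pi_{a_1,\dots,a_n}$; $\mu$ is infinitely divisible if for each $k\in\mathbb{N}$ there is a cylindrical probability measure $\mu_k$ with $\mu=(\mu_k)^{\ast k}$. A truncation function is a bounded measurable $h:\mathbb{R}\to\mathbb{R}$ with $h(s)=s$ for all $s$ in a neighbourhood of $0$. Put $\psi_h(t):=e^{it}-1-ih(t)$. Cylindrical characteristics: an infinitely divisible cylindrical probability measure $\mu$ has cylindrical characteristics $(p,q,\nu)_h$ if $p:U^\ast\to\mathbb{R}$ is a function, $q:U^\ast\to\mathbb{R}$ is a non-negative quadratic form, $\nu$ is a cylindrical measure (here: the restriction of the given measure to $\mathcal{Z}(U)$) such that $\nu\circ\pi_{a_1,\dots,a_n}^{-1}$ is, disregarding any mass at the origin, the Lévy measure of $\mu\circ\pi_{a_1,\dots,a_n}^{-1}$ for all $a_1,\dots,a_n\in U^\ast$, $n\in\mathbb{N}$, and $$\varphi_\mu(a)=\exp\Big(ip(a)-\tfrac12q(a)+\int_U\psi_h(\langle u,a\rangle)\,\nu(du)\Big)\quad\text{for all }a\in U^\ast,$$ where the exponent is the distinguished logarithm of $\varphi_\mu$ (the unique $\Psi:U^\ast\to\mathbb{C}$ with $\exp\Psi=\varphi_\mu$, $\Psi(0)=0$ and $t\mapsto\Psi(ta)$ continuous on $\mathbb{R}$ for every $a$). Condition (b) includes that the integral defining $d_\nu(a)$ exists for every $a\in U^\ast$. *)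

(* Defs.v *)
From HB Require Import structures.
From mathcomp Require Import all_boot all_order all_algebra.
From mathcomp Require Import complex.
From mathcomp Require Import all_classical all_reals all_analysis.

Set Implicit Arguments.
Unset Strict Implicit.
Unset Printing Implicit Defensive.

Import Order.TTheory GRing.Theory Num.Theory.
Import numFieldNormedType.Exports.

Local Open Scope classical_set_scope.
Local Open Scope ring_scope.

Definition borel (T : ptopologicalType) := g_sigma_algebraType (@open T).

Section complex_valued.
Context {R : realType}.

Definition cexp (z : R[i]) : R[i] :=
  ((expR (complex.Re z) * cos (complex.Im z)) +i*
   (expR (complex.Re z) * sin (complex.Im z)))%C.

Definition expi (t : R) : R[i] := cexp ('i%C * t%:C%C).

Context d (T : measurableType d).
Implicit Types (m : set T -> \bar R) (f : T -> R[i]).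

Definition cintegrable m f : Prop :=
  m.-integrable setT (fun x => (complex.Re (f x))%:E) /\
  m.-integrable setT (fun x => (complex.Im (f x))%:E).

Definition cintegral m f : R[i] :=
  (fine (\int[m]_x (complex.Re (f x))%:E)%E +i*
   fine (\int[m]_x (complex.Im (f x))%:E)%E)%C.

(* Unlike the axioms of the library structure, positivity is only asked on
   measurable sets, so that it makes sense for a set function whose values
   elsewhere are irrelevant. *)
Definition is_measure m : Prop :=
  [/\ m set0 = 0%E,
      forall A, measurable A -> (0 <= m A)%E &
      semi_sigma_additive m].

End complex_valued.

Section dual.
Context {R : realType} (U : normedModType R).

Definition dual_pred : {pred U -> R^o} :=
  fun f => `[< linear f /\ continuous f >].

Record cdual := Dual {
  dual_fun :> U -> R^o ;
  _ : dual_fun \in dual_pred }.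

HB.instance Definition _ := [isSub for dual_fun].
HB.instance Definition _ := [Choice of cdual by <:].

Lemma dual_predP (f : U -> R^o) :
  reflect (linear f /\ continuous f) (f \in dual_pred).
Proof. exact: asboolP. Qed.

Lemma dual_submod_closed : submod_closed dual_pred.
Proof.
split=> [|c f g /dual_predP[lf cf] /dual_predP[lg cg]]; apply/dual_predP.
  split; last exact: cst_continuous.
  by move=> k u v; rewrite /GRing.zero /= scaler0 addr0.
split=> [k u v|u].
  rewrite !fctE /= lf lg !scalerDr !scalerA (mulrC c k).
  by rewrite addrACA.
by apply: cvgD; [apply: cvgZl_tmp; exact: cf | exact: cg].
Qed.

HB.instance Definition _ :=
  GRing.isSubmodClosed.Build R (U -> R^o) dual_pred dual_submod_closed.
HB.instance Definition _ := [SubChoice_isSubLmodule of cdual by <:].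

End dual.

Section euclidean.
Context {R : realType} {n : nat}.
Implicit Types (x y : 'rV[R]_n) (m lam : set (borel 'rV[R]_n) -> \bar R).

Definition dot x y : R := \sum_i x ord0 i * y ord0 i.

Definition convolution m1 m2 : set (borel 'rV[R]_n) -> \bar R :=
  fun B =>
    (m1 \x m2)%E [set z : 'rV[R]_n * 'rV[R]_n | B (z.1 + z.2)].

(* the k-fold convolution, for k > 0 *)
Definition convolution_pow m (k : nat) : set (borel 'rV[R]_n) -> \bar R :=
  iter k.-1 (convolution m) m.

(* [lam] is the Levy measure in the Levy-Khintchine representation of the
   infinitely divisible probability measure [m] on R^n; the unit ball here is
   the Euclidean one, whereas the library norm on ['rV[R]_n] is the sup norm *)
Definition levy_measure_of m lam : Prop :=
  [/\ is_measure lam,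
      lam [set 0] = 0%E,
      (\int[lam]_y (Order.min (dot y y) 1)%:E < +oo)%E &
      exists (b : 'rV[R]_n) (Q : 'M[R]_n),
        [/\ Q^T = Q, forall x, 0 <= dot (x *m Q) x &
            forall x,
              cintegral m (fun y => expi (dot y x)) =
              cexp ('i%C * (dot b x)%:C%C - (dot (x *m Q) x / 2)%:C%C
                + cintegral lam (fun y =>
                    expi (dot y x) - 1
                    - 'i%C * (dot y x * (dot y y <= 1)%R%:R)%:C%C))]].

End euclidean.

Section radon.
Context {R : realType} (T : ptopologicalType).

Definition radon (M : {measure set (borel T) -> \bar R}) : Prop :=
  (forall x : T, exists2 V : set T, open_nbhs x V & (M V < +oo)%E) /\
  (forall B : set (borel T), measurable B ->
     M B = ereal_sup [set M K | K in [set K : set T | compact K /\ K `<=` B]]).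

End radon.

Section cylindrical.
Context {R : realType} {U : normedModType R}.
Implicit Types (a : cdual U) (G : set (cdual U)).

Definition cyl_proj (n : nat) (a : 'I_n -> cdual U) (u : U) : 'rV[R]_n :=
  \row_i a i u.

Definition cyl_sets G : set (set U) :=
  [set A | exists (n : nat) (a : 'I_n -> cdual U) (B : set (borel 'rV[R]_n)),
     [/\ forall i, G (a i), measurable B & A = cyl_proj a @^-1` B]].

(* U with the sigma-algebra C(U, G) *)
Definition cyl_type G := g_sigma_algebraType (cyl_sets G).

(* A set function on the cylindrical sets Z(U) = [cyl_sets setT] is encoded by
   a total function, which is only ever evaluated on elements of Z(U); any
   Borel measure thus also denotes its restriction to Z(U). *)
Implicit Types mu nu : set U -> \bar R.

Definition on_cyl mu G : set (cyl_type G) -> \bar R := mu.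

Definition cyl_measure mu : Prop :=
  forall G, finite_set G -> is_measure (on_cyl mu (G := G)).

Definition cyl_probability mu : Prop := cyl_measure mu /\ mu setT = 1%E.

Definition cyl_charfun mu a : R[i] :=
  cintegral (on_cyl mu (G := [set a])) (fun u => expi (a u)).

Definition cyl_image mu (n : nat) (a : 'I_n -> cdual U) :
    set (borel 'rV[R]_n) -> \bar R :=
  fun B => mu (cyl_proj a @^-1` B).

Definition is_cyl_convolution_pow mu muk (k : nat) : Prop :=
  forall (n : nat) (a : 'I_n -> cdual U) (B : set (borel 'rV[R]_n)),
    measurable B -> cyl_image mu a B = convolution_pow (cyl_image muk a) k B.

Definition infinitely_divisible mu : Prop :=
  forall k : nat, (0 < k)%N ->
    exists2 muk, cyl_probability muk & is_cyl_convolution_pow mu muk k.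

Definition quadratic_form (q : cdual U -> R) : Prop :=
  exists b : cdual U -> cdual U -> R,
    [/\ forall a a', b a a' = b a' a,
        forall c a1 a2 a', b (c *: a1 + a2) a' = c * b a1 a' + b a2 a' &
        forall a, q a = b a a].

Definition distinguished_log (phi Psi : cdual U -> R[i]) : Prop :=
  [/\ forall a, cexp (Psi a) = phi a,
      Psi 0 = 0 &
      forall a, continuous (fun t : R => complex.Re (Psi (t *: a))) /\
                continuous (fun t : R => complex.Im (Psi (t *: a)))].

Definition truncation (h : R -> R) : Prop :=
  [/\ measurable_fun setT h,
      exists C : R, forall s, `|h s| <= C &
      \forall s \near (0 : R), h s = s].

Definition psi (h : R -> R) (t : R) : R[i] :=
  expi t - 1 - 'i%C * (h t)%:C%C.

Definition cyl_characteristics (h : R -> R) mu (p q : cdual U -> R) nu : Prop :=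
  [/\ quadratic_form q /\ (forall a, 0 <= q a),
      cyl_measure nu,
      forall (n : nat) (a : 'I_n -> cdual U),
        levy_measure_of (cyl_image mu a)
          (fun B => cyl_image nu a (B `\` [set 0])),
      forall a,
        cintegrable (on_cyl nu (G := [set a])) (fun u => psi h (a u)) &
      distinguished_log (cyl_charfun mu) (fun a =>
        'i%C * (p a)%:C%C - (q a / 2)%:C%C
        + cintegral (on_cyl nu (G := [set a])) (fun u => psi h (a u)))].

Definition radon_extension mu (M : {measure set (borel U) -> \bar R}) : Prop :=
  radon M /\ forall A, cyl_sets setT A -> M A = mu A.

End cylindrical.

Section levy.
Context {R : realType} {U : normedModType R}.
Variable nu : {measure set (borel U) -> \bar R}.
Implicit Types (a : cdual U) (h : R -> R).

Definition unit_ball : set U := [set u | `|u| <= 1].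

Definition charfun (P : {measure set (borel U) -> \bar R}) a : R[i] :=
  cintegral P (fun u => expi (a u)).

Definition levy_integrand a (u : U) : R[i] :=
  expi (a u) - 1 - 'i%C * (a u * \1_unit_ball u)%:C%C.

Definition radon_levy_law (P : probability (borel U) R) : Prop :=
  radon P /\
  forall a, cintegrable nu (levy_integrand a) /\
            charfun P a = cexp (cintegral nu (levy_integrand a)).

Definition levy_measure : Prop :=
  (forall a, (\int[nu]_u (Order.min (a u ^+ 2) 1)%:E < +oo)%E) /\
  exists P : probability (borel U) R, radon_levy_law P.

Definition drift_integrand h a (u : U) : R :=
  h (a u) - a u * \1_unit_ball u.

Definition drift_exists h : Prop :=
  forall a, nu.-integrable setT (fun u => (drift_integrand h a u)%:E).

Definition drift h a : R := fine (\int[nu]_u (drift_integrand h a u)%:E)%E.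

End levy.

(* Main.v *)
(* Writing [Psi a] for the integral of [expi (a u) - 1 - 'i a(u) 1_B(u)] against
   [nu], one has ['i drift a + \int psi_h (a u) nu(du) = Psi a], so that either
   condition provides a Radon probability with characteristic function
   [exp Psi]. What is left is that such a law P is infinitely divisible as a
   cylindrical measure.

   On R^n, [exp (Psi / k)] is the pointwise limit of characteristic functions of
   translated compound laws built from [nu] restricted to sets of finite measure
   exhausting U, and it is continuous at 0, so by Levy's continuity theorem it is
   the characteristic function of a law. These laws are carried by the ranges of
   the projections [cyl_proj a] and are consistent, hence they define a
   cylindrical probability, whose k-th convolution power is P by uniqueness of
   characteristic functions.

   Uniqueness: indicators of half-spaces are iterated bounded limits of
   trigonometric polynomials, and by Hahn-Banach and compactness the finite
   Boolean combinations of half-spaces separate disjoint compact sets. For the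
   continuity theorem, the limit of the joint laws of the countably many events
   [q < y_i], with q rational, along an ultrafilter is realised on [0, 1[ by
   nested intervals, and tightness allows one to read off the coordinates as
   Dedekind cuts. *)

Require Import Defs.
From HB Require Import structures.
From mathcomp Require Import all_boot all_order all_algebra.
From mathcomp Require Import complex.
From mathcomp Require Import all_classical all_reals all_analysis.
From mathcomp Require Import measurable_realfun ring lra.
Import Order.TTheory GRing.Theory Num.Theory.
Import numFieldNormedType.Exports.
Local Open Scope classical_set_scope.
Local Open Scope ring_scope.

Set Implicit Arguments.
Unset Strict Implicit.
Unset Printing Implicit Defensive.

(** * Trigonometric functions and half-spaces *)

(** Sine is the pivot of the integrability questions. A value [a u] may be small while [u] lies
    outside the unit ball, so [h (a u) - a u 1_B(u)] is not of order [min((a u)^2, 1)]. However,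
    [h - sin] is of that order, and [sin (a u) - a u 1_B(u)] is the imaginary part of the Levy
    integrand. This splitting gives the existence of the drift, the continuity of the exponent along
    lines, and the location parameters of the finite-dimensional projections.

    The Borel sigma-algebra of U can be strictly larger than the one generated by the functionals.
    Equality of characteristic functions therefore identifies two Borel laws only together with
    inner regularity, which is why compact sets enter the uniqueness proof.

    An ultrafilter takes the place of the diagonal extraction in Helly's selection theorem: the
    probabilities of all events converge along it at once.

    Cylindrical measures are total set functions that mean something only on cylinders. Integrals
    against them are thus compared through the values on measurable sets alone. *)

Section bounded_functions.
Context d (T : measurableType d) (R : realType).
Implicit Types (m : {finite_measure set T -> \bar R}) (f g : T -> R).

Definition mbounded f :=
  measurable_fun setT f /\ exists C, forall x, `|f x| <= C.

Lemma mbounded_integrable m f : mbounded f -> m.-integrable setT (EFin \o f).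
Proof.
move=> [mf [C fC]]; apply: measurable_bounded_integrable => //.
  exact: fin_num_fun_lty.
exists C; split; first exact: num_real.
by move=> M CM x _; rewrite /= (le_trans (fC x))// ltW.
Qed.

Lemma cvg_mbounded (u : nat -> T -> R) f C :
  (forall n, measurable_fun setT (u n)) -> (forall n x, `|u n x| <= C) ->
  (forall x, u ^~ x @ \oo --> f x) -> mbounded f.
Proof.
move=> mu uC uf; split.
  by apply: (measurable_fun_cvg mu) => // x _; exact: uf.
exists C => x.
have h : `|u n x| @[n --> \oo] --> `|f x| by apply: cvg_norm; exact: uf.
rewrite -(cvg_lim _ h)//; apply: limr_le; first by apply/cvg_ex; eexists; exact: h.
exact: nearW.
Qed.

Lemma Rintegral_bounded_cvg m (u : nat -> T -> R) f C :
  (forall n, measurable_fun setT (u n)) -> (forall n x, `|u n x| <= C) ->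
  (forall x, u ^~ x @ \oo --> f x) ->
  (\int[m]_x u n x @[n --> \oo] --> \int[m]_x f x)%R.
Proof.
move=> mu uC uf; have bf := cvg_mbounded mu uC uf.
have [|||||_ _ h] := @dominated_convergence _ _ _ m setT measurableT
  (fun n => EFin \o u n) (EFin \o f) (EFin \o cst C).
- by move=> n; exact/measurable_EFinP.
- by apply/measurable_EFinP; exact: bf.1.
- by apply: aeW => x _; apply: cvg_EFin; [exact: nearW|exact: uf].
- exact: finite_measure_integrable_cst.
- by apply: aeW => x n _; rewrite /= lee_fin.
apply: fine_cvg; rewrite fineK//.
by apply: integrable_fin_num => //; exact: mbounded_integrable.
Qed.

End bounded_functions.

Section trig_class.
Context d (T : measurableType d) (R : realType) (F : set (T -> R)).

(** The phase [c] yields sines as well as cosines, so real functions suffice. Limits of sequences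
    form a constructor because they have to be iterated: sign functions are limits of limits of
    trigonometric polynomials. *)
Inductive trig_class : (T -> R) -> Prop :=
| trig_cos f c : F f -> trig_class (fun x => cos (f x + c))
| trig_add g1 g2 : trig_class g1 -> trig_class g2 ->
    trig_class (fun x => g1 x + g2 x)
| trig_scale k g : trig_class g -> trig_class (fun x => k * g x)
| trig_lim (u : nat -> T -> R) g C : (forall n, trig_class (u n)) ->
    (forall n x, `|u n x| <= C) -> (forall x, u ^~ x @ \oo --> g x) ->
    trig_class g.

Hypothesis mF : forall f, F f -> measurable_fun setT f.
Hypothesis F0 : F (cst 0).
Hypothesis FZD : forall k f g, F f -> F g -> F (fun x => k * f x + g x).

Lemma trig_mbounded g : trig_class g -> mbounded g.
Proof.
elim=> {g}[f c Ff|g1 g2 _ [m1 [C1 b1]] _ [m2 [C2 b2]]|k g _ [m [C b]]|].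
- split; last by exists 1 => x; exact: cos_max.
  apply: (measurableT_comp (continuous_measurable_fun (@continuous_cos R))).
  by apply: measurable_funD => //; exact: mF.
- split; first exact: measurable_funD.
  by exists (C1 + C2) => x; rewrite (le_trans (ler_normD _ _))// lerD.
- split; first exact: measurable_funM.
  by exists (`|k| * C) => x; rewrite normrM ler_wpM2l.
- move=> u g C _ IH uC ug; apply: (cvg_mbounded _ uC ug) => n.
  by have [] := IH n.
Qed.

Lemma trig_cst k : trig_class (cst k).
Proof.
rewrite (_ : cst k = fun x : T => k * cos (cst 0 x + 0)).
  by apply: trig_scale; apply: trig_cos.
by apply/funext => x /=; rewrite addr0 cos0 mulr1.
Qed.

Lemma trig_ext g g' : trig_class g -> g =1 g' -> trig_class g'.
Proof. by move=> tg /funext <-. Qed.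

(** For two generators this is the product-to-sum formula. The induction treats one factor at a
    time, and a limit in one factor stays a bounded limit because the other factor is bounded. *)
Lemma trig_mul g1 g2 : trig_class g1 -> trig_class g2 ->
  trig_class (fun x => g1 x * g2 x).
Proof.
move=> t1; elim: t1 g2 => {g1}[f c Ff g2|g1 g1' _ IH1 _ IH2 g2 t2|k g _ IH g2 t2|u g C _ IH uC ug g2 t2].
- elim=> {g2}[f' c' Ff'|g1 g1' _ IH1 _ IH2|k g _ IH|u g C _ IH uC ug].
  + have E x : 2^-1 * cos ((1 * f x + f' x) + (c + c')) +
        2^-1 * cos ((-1 * f' x + f x) + (c - c')) = cos (f x + c) * cos (f' x + c').
      rewrite (_ : 1 * f x + f' x + (c + c') = (f x + c) + (f' x + c')); last by ring.
      rewrite (_ : -1 * f' x + f x + (c - c') = (f x + c) - (f' x + c')); last by ring.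
      by rewrite cosD cosB; field.
    by apply: (trig_ext _ E); apply: trig_add; apply: trig_scale; apply: trig_cos; exact: FZD.
  + by apply: (trig_ext (trig_add IH1 IH2)) => x; rewrite mulrDr.
  + by apply: (trig_ext (trig_scale k IH)) => x; rewrite mulrCA.
  + apply: (trig_lim IH (C := C)) => [n x|x].
      rewrite normrM -[leRHS]mul1r ler_pM//; exact: cos_max.
    by apply: cvgMr; exact: ug.
- by apply: (trig_ext (trig_add (IH1 _ t2) (IH2 _ t2))) => x; rewrite mulrDl.
- by apply: (trig_ext (trig_scale k (IH _ t2))) => x; rewrite mulrA.
- have [_ [C' b]] := trig_mbounded t2.
  apply: (trig_lim (fun n => IH n _ t2) (C := C * C')) => [n x|x].
    by rewrite normrM ler_pM.
  by apply: cvgMl; exact: ug.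
Qed.

Lemma trig_Rintegral (m1 m2 : {finite_measure set T -> \bar R}) :
  (forall f c, F f -> (\int[m1]_x cos (f x + c) = \int[m2]_x cos (f x + c))%R) ->
  forall g, trig_class g -> (\int[m1]_x g x = \int[m2]_x g x)%R.
Proof.
move=> m12 g; elim=> {g}[//|g1 g2 t1 IH1 t2 IH2|k g t IH|u g C t IH uC ug].
- have [b1 b2] := (trig_mbounded t1, trig_mbounded t2).
  by rewrite !RintegralD// ?IH1 ?IH2//; exact: mbounded_integrable.
- have b := trig_mbounded t.
  by rewrite !RintegralZl// ?IH//; exact: mbounded_integrable.
- have mu n := (trig_mbounded (t n)).1.
  have h1 := Rintegral_bounded_cvg (m := m1) mu uC ug.
  have := Rintegral_bounded_cvg (m := m2) mu uC ug.
  under eq_cvg do rewrite -IH.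
  by move/cvg_lim => <- //; apply/esym/cvg_lim.
Qed.

Lemma trig_measure (m1 m2 : {finite_measure set T -> \bar R}) A :
  (forall f c, F f -> (\int[m1]_x cos (f x + c) = \int[m2]_x cos (f x + c))%R) ->
  measurable A -> trig_class (\1_A) -> m1 A = m2 A.
Proof.
move=> m12 mA tA; have E := trig_Rintegral m12 tA.
have h (m : {finite_measure set T -> \bar R}) : (m A = (\int[m]_x \1_A x)%:E)%R.
  by rewrite /Rintegral integral_indic// setIT fineK//; exact: fin_num_measure.
by rewrite !h E.
Qed.

(* A polynomial whose iterates converge to the sign function on [-1, 1]. *)
Definition smooth_sign (x : R) := x * (3 - x ^+ 2) / 2.

Lemma smooth_signN x n : iter n smooth_sign (- x) = - iter n smooth_sign x.
Proof.
by elim: n => //= n ->; rewrite /smooth_sign; field.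
Qed.

(** One step multiplies the distance to 1 by [(1 - y) * (2 + y) / 2 = 1 - y / 2 - y ^+ 2 / 2]. As
    the iterates never fall below [x], this factor is at most [1 - x / 2]. *)
Lemma smooth_sign_bound x n : 0 <= x <= 1 ->
  x <= iter n smooth_sign x <= 1 /\ 1 - iter n smooth_sign x <= (1 - x / 2) ^+ n.
Proof.
move=> /andP[x0 x1]; elim: n => [|n [/andP[]]] /=.
  by rewrite lexx x1 expr0 lerBlDr lerDl.
set y := iter n _ _ => xy y1 yn.
have y0 : 0 <= y := le_trans x0 xy.
have E : 1 - smooth_sign y = (1 - y) * ((1 - y) * (2 + y) / 2).
  by rewrite /smooth_sign; field.
have h : 0 <= (1 - y) * (2 + y) / 2 <= 1 - x / 2 by nra.
split.
  rewrite -(subr_ge0 _ 1) E mulr_ge0 ?subr_ge0//; last by case/andP: h.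
  rewrite andbT (le_trans xy)// /smooth_sign; nra.
by rewrite E exprSr ler_pM// ?subr_ge0//; case/andP: h.
Qed.

Lemma smooth_sign_norm x n : `|x| <= 1 -> `|iter n smooth_sign x| <= 1.
Proof.
wlog x0 : x / 0 <= x.
  move=> h; have [/h//|/ltW x0] := leP 0 x.
  rewrite -[X in X <= 1 -> _]normrN -[X in _ -> X <= 1]normrN -smooth_signN; apply: h.
  by rewrite oppr_ge0.
rewrite ger0_norm// => x1.
have /= [/andP[xy y1] _] := @smooth_sign_bound x n (introT andP (conj x0 x1)).
by rewrite ger0_norm// (le_trans x0).
Qed.

Lemma smooth_sign_cvg x : `|x| <= 1 ->
  iter n smooth_sign x @[n --> \oo] --> Num.sg x.
Proof.
have cvg_pos y : 0 < y -> `|y| <= 1 -> iter n smooth_sign y @[n --> \oo] --> (1 : R).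
  move=> y0; rewrite gtr0_norm// => y1.
  have b n := @smooth_sign_bound y n (introT andP (conj (ltW y0) y1)).
  apply: (@squeeze_cvgr _ _ _ _ (fun n => 1 - (1 - y / 2) ^+ n) (cst 1)).
  - by apply: nearW => n; have [/andP[_ ->]] := b n; rewrite lerBlDl -lerBlDr => ->.
  - rewrite -[X in _ --> X]subr0; apply: cvgB; first exact: cvg_cst.
    by apply: cvg_expr; rewrite ger0_norm; lra.
  - exact: cvg_cst.
have [x0|x0|->] := ltgtP x 0 => x1; last first.
- rewrite sgr0 (_ : (fun n => _) = cst 0); first exact: cvg_cst.
  by apply/funext => n /=; elim: n => //= n ->; rewrite /smooth_sign !mul0r.
- by rewrite gtr0_sg//; exact: cvg_pos.
- rewrite ltr0_sg//; rewrite (_ : (fun n => _) = (fun n => - iter n smooth_sign (- x))); last first.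
    by apply/funext => n; rewrite smooth_signN opprK.
  by apply: cvgN; apply: cvg_pos; rewrite ?oppr_gt0// normrN.
Qed.

(* Iterating [smooth_sign] on [sin (l * (f - c))] gives [sg (sin (l * (f - c)))],
   which is eventually [sg (f - c)] as [l] tends to 0. *)
Lemma trig_halfspace f c : F f -> trig_class (\1_[set x | c < f x]).
Proof.
move=> Ff.
have tsin l : trig_class (fun x => sin (l * (f x - c))).
  apply: (trig_ext (trig_cos (- l * c - pi / 2) (FZD l Ff F0))) => x /=.
  rewrite -cosBpihalf; congr cos; lra.
have tsm l n : trig_class (fun x => iter n smooth_sign (sin (l * (f x - c)))).
  elim: n => [|n IH] /=; first exact: tsin.
  have t2 := trig_mul IH IH.
  apply: (trig_ext (trig_add (trig_scale (3 / 2) IH)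
    (trig_scale (- 2^-1) (trig_mul t2 IH)))) => x.
  by rewrite /smooth_sign; field.
have tsg l : trig_class (fun x => Num.sg (sin (l * (f x - c)))).
  apply: (trig_lim (tsm l) (C := 1)) => [n x|x].
    by apply: smooth_sign_norm; exact: sin_max.
  by apply: smooth_sign_cvg; exact: sin_max.
have tsgc : trig_class (fun x => Num.sg (f x - c)).
  apply: (trig_lim (fun n => tsg (n.+1%:R^-1)) (C := 1)) => [n x|x].
    by rewrite normr_sg; case: (_ == _).
  apply: cvg_near_cst; near=> n.
  have n0 : 0 < n.+1%:R :> R by [].
  have np : `|n.+1%:R^-1 * (f x - c)| < pi.
    rewrite normrM mulrC [X in _ * X]gtr0_norm ?invr_gt0// ltr_pdivrMr// mulrC.
    rewrite -ltr_pdivrMr ?pi_gt0// (@lt_le_trans _ _ n%:R) ?ler_nat//.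
    by near: n; exact: nbhs_infty_gtr.
  have [h|h|h] := ltgtP (f x - c) 0.
  - rewrite [RHS]ltr0_sg// -[X in sin X]opprK sinN sgrN gtr0_sg// sin_gt0_pi//.
    rewrite oppr_gt0 pmulr_rlt0 ?invr_gt0// h/=.
    by move: np; rewrite ltr_norml => /andP[]; rewrite ltrNl.
  - rewrite [RHS]gtr0_sg// gtr0_sg// sin_gt0_pi//.
    rewrite pmulr_rgt0 ?invr_gt0// h/=.
    by move: np; rewrite ltr_norml => /andP[].
  - by rewrite h mulr0 sin0 sgr0.
(* With [s] the sign, [(s ^+ 2 + s) / 2] is 1 for [s = 1] and 0 for [s = 0] and [s = -1], so the
   boundary of the half-space is left out. *)
have t2 := trig_mul tsgc tsgc.
apply: (trig_ext (trig_scale 2^-1 (trig_add t2 tsgc))) => x.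
rewrite indicE; have [/set_mem/= h|] := boolP (x \in _).
  by rewrite gtr0_sg ?subr_gt0//; field.
rewrite notin_setE/= => /negP; rewrite -leNgt le_eqVlt => /predU1P[->|h].
  by rewrite subrr sgr0; field.
by rewrite ltr0_sg ?subr_lt0//; field.
Unshelve. all: by end_near.
Qed.

End trig_class.

(** * Half-spaces and the Borel sigma-algebra of R^n *)

Section dot.
Context (R : realType) (n : nat).
Implicit Types x y z : 'rV[R]_n.

Lemma dotC x y : dot x y = dot y x.
Proof. by apply: eq_bigr => i _; rewrite mulrC. Qed.

Lemma dotDl x y z : dot (x + y) z = dot x z + dot y z.
Proof. by rewrite -big_split; apply: eq_bigr => i _; rewrite mxE mulrDl. Qed.

Lemma dotZl k x y : dot (k *: x) y = k * dot x y.
Proof. by rewrite mulr_sumr; apply: eq_bigr => i _; rewrite mxE mulrA. Qed.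

Lemma dot_delta y i : dot y (delta_mx ord0 i) = y ord0 i.
Proof.
rewrite /dot (bigD1 i)//= mxE !eqxx mulr1 big1 ?addr0// => j ji.
by rewrite mxE eqxx (negbTE ji) mulr0.
Qed.

Lemma dotNr x y : dot x (- y) = - dot x y.
Proof. by rewrite dotC -scaleN1r dotZl mulN1r dotC. Qed.

Lemma dot0l y : dot 0 y = 0.
Proof. by rewrite -(scale0r 0) dotZl mul0r. Qed.

(** Lists of normals and levels make this visibly a pi-system: concatenation is intersection, and
    the empty list is the whole space. The indicator of a member is a product of indicators of
    half-spaces. *)
Definition halfspaces : set (set 'rV[R]_n) :=
  [set A | exists s : seq ('rV[R]_n * R),
     A = [set y | all (fun p => p.2 < dot y p.1) s]].

Let box (lu : {ffun 'I_n -> rat} * {ffun 'I_n -> rat}) : set 'rV[R]_n :=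
  [set y | forall i, ratr (lu.1 i) < y ord0 i < ratr (lu.2 i)].

Lemma halfspaces_box lu : halfspaces (box lu).
Proof.
exists (flatten [seq [:: (delta_mx ord0 i, ratr (lu.1 i));
   (- delta_mx ord0 i, - ratr (lu.2 i))] | i <- enum 'I_n]).
apply/seteqP; split=> y /= h.
  apply/allP => p /flatten_mapP[i _]; have /andP[h1 h2] := h i.
  by rewrite !inE => /predU1P[|/eqP] -> /=; rewrite ?dotNr dot_delta// ltrN2.
move=> i; move/allP : h => h; apply/andP; split.
  rewrite -dot_delta; apply: (h (delta_mx ord0 i, ratr (lu.1 i))).
  by apply/flatten_mapP; exists i; rewrite ?mem_enum// !inE eqxx.
rewrite -ltrN2 -dot_delta -dotNr.
apply: (h (- delta_mx ord0 i, - ratr (lu.2 i))).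
by apply/flatten_mapP; exists i; rewrite ?mem_enum// !inE eqxx orbT.
Qed.

(** An open set is the union of the rational boxes that it contains, and there are countably many of
    them. Numbers that encode no box contribute [set0]. *)
Lemma open_sub_halfspaces (A : set 'rV[R]_n) : open A -> <<s halfspaces >> A.
Proof.
move=> oA.
pose F k := if unpickle k is Some lu then
  if `[< box lu `<=` A >] then box lu else set0 else set0.
have -> : A = \bigcup_k F k.
  apply/seteqP; split=> [y Ay|y [k _]]; last first.
    rewrite /F; case: unpickle => // lu; case: ifPn => // /asboolP; exact.
  have [e /= e0 eA] : exists2 e : R, 0 < e & ball y e `<=` A.
    by apply/nbhs_ballP; exact: open_nbhs_nbhs.
  have /choice[l hl] : forall i, exists q : rat, y ord0 i - e < ratr q < y ord0 i.
    move=> i; have [|q] := @rat_in_itvoo R (y ord0 i - e) (y ord0 i); first by lra.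
    by rewrite in_itv/=; exists q.
  have /choice[u hu] : forall i, exists q : rat, y ord0 i < ratr q < y ord0 i + e.
    move=> i; have [|q] := @rat_in_itvoo R (y ord0 i) (y ord0 i + e); first by lra.
    by rewrite in_itv/=; exists q.
  pose lu := (finfun l, finfun u).
  exists (pickle lu) => //; rewrite /F pickleK ifT.
    by move=> i /=; rewrite !ffunE; have /andP[_ ->] := hl i; have /andP[-> _] := hu i.
  apply/asboolP => z bz; apply: eA; split=> // i j; rewrite (ord1 i).
  have := bz j; rewrite /= !ffunE => /andP[z1 z2]; have := hl j; have := hu j.
  move=> /andP[_ u2] /andP[l1 _]; rewrite /ball/= ltr_distlC; apply/andP; split; lra.
apply: sigma_algebra_bigcup => k; rewrite /F.
case: unpickle => [lu|]; last exact: sigma_algebra0.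
case: ifPn => _; last exact: sigma_algebra0.
by apply: sub_sigma_algebra; exact: halfspaces_box.
Qed.

Lemma continuous_dot x : continuous (fun y : 'rV[R]_n => dot y x : R).
Proof.
apply: continuous_big => [|i _ y]; first exact: add_continuous.
exact: (cvgM (@coord_continuous R 1 n ord0 i y) (cvg_cst _)).
Qed.

End dot.

Lemma continuous_borel_measurable (R : realType) (T : ptopologicalType) (f : T -> R) :
  continuous f -> measurable_fun setT (f : borel T -> R).
Proof.
move=> cf; apply: (measurability _ (RGenOpens.measurableE R)) => // _ [_ [a [b ->] <-]].
rewrite setTI; apply: sub_sigma_algebra.
by move/continuousP : cf; apply; exact: interval_open.
Qed.

Section borel_rV.
Context (R : realType) (n : nat).

Lemma measurable_dot x : measurable_fun setT (fun y : borel 'rV[R]_n => dot y x).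
Proof. by apply: continuous_borel_measurable; exact: continuous_dot. Qed.

Lemma measurable_coord i : measurable_fun setT (fun y : borel 'rV[R]_n => (y : 'rV[R]_n) ord0 i).
Proof. by apply: continuous_borel_measurable; exact: coord_continuous. Qed.

Lemma halfspaces_measurable (A : set (borel 'rV[R]_n)) : halfspaces A -> measurable A.
Proof.
move=> [s ->]; elim: s => [|[x c] s IH] /=.
  by rewrite (_ : [set _ | _] = setT)//; apply/seteqP.
rewrite (_ : [set _ | _] = [set y | c < dot y x] `&` [set y : 'rV[R]_n | all (fun p => p.2 < dot y p.1) s]).
  apply: measurableI => //; have := measurable_dot x measurableT (measurable_itv `]c, +oo[).
  rewrite setTI; congr measurable; apply/seteqP; split => y /=; rewrite in_itv/= ?andbT//.
by apply/seteqP; split=> y /= => [/andP[]//|[-> ->]].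
Qed.

Lemma borel_halfspaces : (measurable : set (set (borel 'rV[R]_n))) = <<s @halfspaces R n >>.
Proof.
apply/seteqP; split; apply: smallest_sub.
- exact: smallest_sigma_algebra.
- exact: open_sub_halfspaces.
- exact: sigma_algebra_measurable.
- exact: halfspaces_measurable.
Qed.

Lemma measurable_rV d (T : measurableType d) (f : T -> borel 'rV[R]_n) :
  (forall i, measurable_fun setT (fun t => (f t : 'rV[R]_n) ord0 i)) -> measurable_fun setT f.
Proof.
move=> mf; apply: (measurability _ borel_halfspaces) => // _ [_ [s ->] <-].
rewrite setTI.
have md x : measurable_fun setT (fun t => dot (f t : 'rV[R]_n) x).
  by apply: measurable_sum => i; apply: measurable_funM.
elim: s => [|[x c] s IH] /=.
  by rewrite (_ : _ @^-1` _ = setT)//; apply/seteqP.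
rewrite (_ : _ @^-1` _ = [set t | c < dot (f t : 'rV[R]_n) x] `&` f @^-1` [set y : 'rV[R]_n | all (fun p => p.2 < dot y p.1) s]).
  apply: measurableI => //; have := md x measurableT _ (measurable_itv `]c, +oo[).
  rewrite setTI; congr measurable; apply/seteqP; split => y /=; rewrite in_itv/= ?andbT//.
by apply/seteqP; split=> y /= => [/andP[]//|[-> ->]].
Qed.

(** The phase [c] merges the real and imaginary parts of the characteristic function into one family
    of real integrals. Equality on the pi-system [halfspaces] then spreads to the sigma-algebra it
    generates. *)
Lemma rV_measure_unique (m1 m2 : {finite_measure set (borel 'rV[R]_n) -> \bar R}) :
  (forall x c, (\int[m1]_y cos (dot y x + c) = \int[m2]_y cos (dot y x + c))%R) ->
  forall B, measurable B -> m1 B = m2 B.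
Proof.
move=> m12 B; rewrite borel_halfspaces.
pose F := [set g : borel 'rV[R]_n -> R | exists x, g = fun y => dot y x].
have mF f : F f -> measurable_fun setT f by move=> [x ->]; exact: measurable_dot.
have F0 : F (cst 0) by exists 0; apply/funext => y; rewrite dotC dot0l.
have FZD k f g : F f -> F g -> F (fun y => k * f y + g y).
  move=> [x ->] [z ->]; exists (k *: x + z); apply/funext => y.
  by rewrite [RHS]dotC dotDl dotZl (dotC x) (dotC z).
have m12F f c : F f -> (\int[m1]_x cos (f x + c) = \int[m2]_x cos (f x + c))%R.
  by move=> [x ->].
apply: (@g_sigma_algebra_measure_unique _ _ _ _ halfspaces_measurable (fun=> setT)).
- by move=> _; exists [::]; apply/seteqP.
- by rewrite bigcup_const//; exists 0%N.
- move=> _ _ [s1 ->] [s2 ->]; exists (s1 ++ s2); apply/seteqP; split=> y /=; rewrite all_cat.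
    by move=> [-> ->].
  by move/andP.
- move=> A hA; apply: (trig_measure mF (m1 := m1) (m2 := m2)) => //.
    exact: halfspaces_measurable.
  have [s ->] := hA; elim: s => [|[x c] s IH].
    by apply: (trig_ext (trig_cst F0 1)) => y; rewrite indicE mem_set.
  have tx : trig_class F (\1_[set y | c < dot y x]) by apply: trig_halfspace => //; exists x.
  apply: (trig_ext (trig_mul mF FZD tx IH)) => y.
  rewrite !indicE -natrM mulnb; congr (_%:R : R); congr nat_of_bool.
  apply/idP/idP => [/andP[/set_mem/= a /set_mem/= b]|/set_mem/= /andP[a b]].
    by apply/mem_set; rewrite /= a.
  by rewrite !mem_set.
- by move=> _; exact: fin_num_fun_lty.
Qed.

End borel_rV.

(** * Uniqueness of Radon measures *)

Section hahn_banach.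
Context (R : realType) (U : normedModType R).

(* Partial functionals are represented by their graphs. *)
Let dominated_graph (G : set (U * R)) :=
  (forall k x r y s, G (x, r) -> G (y, s) -> G (k *: x + y, k * r + s)) /\
  (forall x r, G (x, r) -> r <= `|x|).

Let graph_span G (x0 : U) (c : R) : set (U * R) :=
  [set p | exists x r t, [/\ G (x, r), p.1 = x + t *: x0 & p.2 = r + t * c]].

(** By homogeneity only the coefficients 1 and -1 of [x0] matter. They require [c] to lie above
    every [r - |x - x0|] and below every [|y + x0| - s]; the supremum of the former works by the
    triangle inequality. *)
Let graph_extend G x0 : dominated_graph G -> G (0, 0) ->
  exists c, dominated_graph (graph_span G x0 c).
Proof.
move=> [GL GN] G0.
have key x r y s : G (x, r) -> G (y, s) -> r - `|x - x0| <= `|y + x0| - s.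
  move=> gx gy; have := GN _ _ (GL 1 _ _ _ _ gx gy); rewrite scale1r mul1r => h.
  have : `|x + y| <= `|x - x0| + `|y + x0|.
    by rewrite (le_trans _ (ler_normD _ _))// addrACA addNr addr0.
  lra.
pose A := [set z : R | exists x r, G (x, r) /\ z = r - `|x - x0|].
have A0 : A !=set0 by exists (0 - `|0 - x0|), 0, 0.
have supA : has_sup A.
  split=> //; exists (`|0 + x0| - 0) => _ [x [r [gx ->]]]; exact: key.
have lo x r : G (x, r) -> r - `|x - x0| <= sup A.
  by move=> gx; apply: ub_le_sup; [exact: supA.2|exists x, r].
have up y s : G (y, s) -> sup A <= `|y + x0| - s.
  by move=> gy; apply: ge_sup => // _ [x [r [gx ->]]]; exact: key.
have GZ k x r : G (x, r) -> G (k *: x, k * r).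
  by move=> gx; have := GL k _ _ _ _ gx G0; rewrite !addr0.
exists (sup A); split=> [k x r y s|x r].
  move=> [x1 [r1 [t1 [g1 /= -> ->]]]] [x2 [r2 [t2 [g2 /= -> ->]]]].
  exists (k *: x1 + x2), (k * r1 + r2), (k * t1 + t2); split=> /=.
  - exact: GL.
  - by rewrite scalerDr scalerDl scalerA addrACA.
  - ring.
move=> [x1 [r1 [t [g1 /= -> ->]]]].
have [->|t0] := eqVneq t 0; first by rewrite scale0r mul0r !addr0; exact: GN.
have [tp|tn] : 0 < t \/ t < 0 by apply/orP; rewrite orbC -neq_lt.
- have := up _ _ (GZ t^-1 _ _ g1); rewrite lerBrDl => h.
  have -> : x1 + t *: x0 = t *: (t^-1 *: x1 + x0).
    by rewrite scalerDr scalerA divff// scale1r.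
  rewrite normrZ gtr0_norm//.
  have -> : r1 + t * sup A = t * (t^-1 * r1 + sup A) by field.
  by rewrite ler_pM2l.
- pose u := - t; have up0 : 0 < u by rewrite oppr_gt0.
  have := lo _ _ (GZ u^-1 _ _ g1); rewrite lerBlDr -lerBlDl => h.
  have -> : x1 + t *: x0 = u *: (u^-1 *: x1 - x0).
    by rewrite scalerBr scalerA divff ?gt_eqF// scale1r scaleNr opprK.
  rewrite normrZ gtr0_norm//.
  have -> : r1 + t * sup A = u * (u^-1 * r1 - sup A) by rewrite /u; field.
  by rewrite ler_pM2l.
Qed.

Lemma cdual_separates (u0 : U) : u0 != 0 -> exists a : cdual U, a u0 != 0.
Proof.
move=> u0N0.
pose G0 := [set p : U * R | exists t, p = (t *: u0, t * `|u0|)].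
have dG0 : dominated_graph G0.
  split=> [k x r y s [t [-> ->]] [t' [-> ->]]|x r [t [-> ->]]].
    by exists (k * t + t'); rewrite scalerDl scalerA mulrDl mulrA.
  by rewrite normrZ ler_wpM2r// ler_norm.
(* Uniting with [G0], instead of asking [G] to contain it, makes the property hold for the empty
   set, which is the union of the empty chain in Zorn's lemma. *)
pose P G := dominated_graph (G `|` G0).
have [G [[GL GN] Gmax]] : exists G, P G /\ forall G', G `<` G' -> ~ P G'.
  apply: Zorn_bigcup => C CP totC; split=> [k x r y s|x r]; last first.
    by move=> [[X CX Xx]|G0x]; [apply: (CP _ CX).2; left|exact: dG0.2].
  have sub X : C X -> (X `|` G0) `<=` (\bigcup_(X in C) X `|` G0).
    by move=> CX p [Xp|]; [left; exists X|right].
  move=> [[X CX Xx]|gx] [[Y CY Yy]|gy].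
  - have [XY|YX] := totC _ _ CX CY.
      by apply/(sub _ CY)/(CP _ CY).1; left => //; exact: XY.
    by apply/(sub _ CX)/(CP _ CX).1; left => //; exact: YX.
  - by apply/(sub _ CX)/(CP _ CX).1; [left|right].
  - by apply/(sub _ CY)/(CP _ CY).1; [right|left].
  - by right; exact: dG0.1.
pose H := G `|` G0.
have H00 : H (0, 0) by right; exists 0; rewrite scale0r mul0r.
(* Single-valuedness is not built into [dominated_graph]; it follows from the norm bound at the
   point [(0, r - s)]. *)
have Hfun x r s : H (x, r) -> H (x, s) -> r = s.
  move=> hr hs; apply/eqP; rewrite eq_le; apply/andP; split.
    by have := GN _ _ (GL (-1) _ _ _ _ hs hr); rewrite scaleN1r addNr normr0; lra.
  by have := GN _ _ (GL (-1) _ _ _ _ hr hs); rewrite scaleN1r addNr normr0; lra.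
have Htot x0 : exists r, H (x0, r).
  apply: contrapT => nx0.
  have [c dc] := graph_extend x0 (conj GL GN) H00.
  have HK : H `<=` graph_span H x0 c.
    by move=> [x r] hx; exists x, r, 0; split=> //=; rewrite ?scale0r ?mul0r addr0.
  apply: (Gmax (graph_span H x0 c)).
    split=> [p Gp|GK]; first by apply: HK; left.
    apply: nx0; exists c; left; apply: GK; exists 0, 0, 1.
    by split=> //=; rewrite ?scale1r ?mul1r add0r.
  rewrite /P (_ : _ `|` _ = graph_span H x0 c)//.
  by apply/setUidPl => p G0p; apply: HK; right.
have [f Hf] := choice Htot.
have flin : linear (f : U -> R^o).
  by move=> k x y; apply: (Hfun (k *: x + y)); [exact: Hf|exact: (GL k _ _ _ _ (Hf x) (Hf y))].
have fle x : `|f x| <= `|x|.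
  rewrite ler_norml; apply/andP; split; last exact: (GN _ _ (Hf x)).
  rewrite lerNl -normrN; apply: GN.
  by have := GL (-1) _ _ _ _ (Hf x) H00; rewrite scaleN1r mulN1r !addr0.
have fcont : continuous (f : U -> R^o).
  move=> x; apply/cvgrPdist_lt => e e0; near=> y.
  have -> : f x - f y = f (x - y).
    by rewrite addrC [x - y]addrC -[- y]scaleN1r flin scaleN1r.
  rewrite (le_lt_trans (fle _))//; near: y.
have fP : (f : U -> R^o) \in @dual_pred R U by apply/dual_predP.
have fu0 : f u0 = `|u0|.
  by apply: (Hfun u0); [exact: Hf|right; exists 1; rewrite scale1r mul1r].
by exists (Dual fP); rewrite /= fu0 normr_eq0.
Unshelve. all: by end_near.
Qed.

End hahn_banach.

(** * Separation of compact sets and uniqueness of Radon measures *)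

Section radon_unique.
Context (R : realType) (U : normedModType R).

Lemma cdual_linear (a : cdual U) : linear (a : U -> R^o).
Proof. by case: a => f /=; move=> /dual_predP[]. Qed.

Lemma cdual_continuous (a : cdual U) : continuous (a : U -> R^o).
Proof. by case: a => f /=; move=> /dual_predP[]. Qed.

Lemma measurable_cdual (a : cdual U) : measurable_fun setT (a : borel U -> R).
Proof. by apply: continuous_borel_measurable; exact: cdual_continuous. Qed.

Let F := [set g : borel U -> R | exists a : cdual U, g = a].

Let mF f : F f -> measurable_fun setT f.
Proof. by move=> [a ->]; exact: measurable_cdual. Qed.

Let F0 : F (cst 0).
Proof. by exists 0. Qed.

Let FZD k f g : F f -> F g -> F (fun y => k * f y + g y).
Proof. by move=> [a ->] [b ->]; exists (k *: a + b). Qed.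

Let trigU (A B : set U) : trig_class F \1_A -> trig_class F \1_B ->
  trig_class F \1_(A `|` B).
Proof.
move=> tA tB.
apply: (trig_ext (trig_add (trig_add tA tB) (trig_scale (-1) (trig_mul mF FZD tA tB)))).
move=> x; rewrite !indicE in_setU.
by case: (x \in A); case: (x \in B) => /=; ring.
Qed.

Let trigI (A B : set U) : trig_class F \1_A -> trig_class F \1_B ->
  trig_class F \1_(A `&` B).
Proof.
move=> tA tB; apply: (trig_ext (trig_mul mF FZD tA tB)) => x.
by rewrite !indicE in_setI -natrM mulnb.
Qed.

Let good A := trig_class F \1_A /\ open (A : set U).

Let goodU A B : good A -> good B -> good (A `|` B).
Proof. by move=> [tA oA] [tB oB]; split; [exact: trigU|exact: openU]. Qed.

Let goodI A B : good A -> good B -> good (A `&` B).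
Proof. by move=> [tA oA] [tB oB]; split; [exact: trigI|exact: openI]. Qed.

Let good_halfspace (a : cdual U) c : good [set x | c < a x].
Proof.
split; first by apply: trig_halfspace => //; exists a.
have /continuousP/(_ `]c, +oo[%classic) := @cdual_continuous a.
rewrite (_ : _ @^-1` _ = [set x | c < a x]); first by apply; exact: interval_open.
by apply/seteqP; split=> x /=; rewrite in_itv/= andbT.
Qed.

(** Both sides carry an open set whose indicator is in the class. Complements of open sets would not
    do: the compactness argument takes finite unions on one side and finite intersections on the
    other. *)
Let separated (K C : set U) := exists A B,
  [/\ good A, good B, K `<=` A, C `<=` B & A `&` B = set0].

Let separatedC K C : separated K C -> separated C K.
Proof. by move=> [A [B [? ? ? ?]]]; rewrite setIC => ?; exists B, A. Qed.

Let separated_points x y : x != y -> separated [set x] [set y].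
Proof.
rewrite -subr_eq0 => /cdual_separates[a0 axy].
have [a axy'] : exists a : cdual U, a y < a x.
  have aB (a : cdual U) : a (x - y) = a x - a y.
    by rewrite addrC -scaleN1r cdual_linear scaleN1r addrC.
  have [] : 0 < a0 (x - y) \/ a0 (x - y) < 0 by apply/orP; rewrite orbC -neq_lt.
    by rewrite aB subr_gt0; exists a0.
  by rewrite aB subr_lt0 => h; exists (- a0) => /=; rewrite ltrN2.
pose c := (a x + a y) / 2.
exists [set z | c < a z], [set z | - c < (- a) z]; split.
- exact: good_halfspace.
- exact: good_halfspace.
- by move=> _ ->; rewrite /= /c; lra.
- by move=> _ ->; rewrite /= ltrN2 /c; lra.
- apply/seteqP; split=> z //= [h1]; rewrite ltrN2 => h2.
  by have := lt_trans h1 h2; rewrite ltxx.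
Qed.

(** The standard Hausdorff argument: finitely many [B x] cover [C], and the intersection of the
    corresponding [A x] still contains [K]. It is applied twice, first to a point and a compact set,
    then to two compact sets. *)
Let separated_compact K C : compact C ->
  (forall x, C x -> separated K [set x]) -> separated K C.
Proof.
move=> cC KC.
have /choice[A hA] : forall x, exists A : set U, C x -> exists B,
    [/\ good A, good B, K `<=` A, B x & A `&` B = set0].
  move=> x; have [Cx|nCx] := pselect (C x); last by exists set0.
  by have [A [B [gA gB KA /(_ x erefl) Bx AB]]] := KC x Cx; exists A => _; exists B.
have /choice[B hB] : forall x, exists B : set U, C x ->
    [/\ good (A x), good B, K `<=` A x, B x & A x `&` B = set0].
  move=> x; have [Cx|nCx] := pselect (C x); last by exists set0.
  by have [B hB] := hA x Cx; exists B.
move: cC; rewrite compact_cover => /(_ U C B)[x Cx|x Cx|D DC CD].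
- by have [_ [_ ?]] := hB x Cx.
- by exists x => //; have [] := hB x Cx.
have [s sC {}CD] : exists2 s : seq U, (forall x, x \in s -> C x) &
    C `<=` \bigcup_(x in [set` s]) B x.
  exists (finmap.enum_fset D) => [x xs|c /CD[x Dx Bxc]]; last by exists x.
  by apply/set_mem; exact: DC.
suff [A' [B' [gA' gB' KA' BB' AB']]] : exists A' B',
    [/\ good A', good B', K `<=` A', \bigcup_(x in [set` s]) B x `<=` B' & A' `&` B' = set0].
  by exists A', B'; split => //; exact: subset_trans CD BB'.
elim: s sC {D DC CD} => [_|x s IH sC].
  exists setT, set0; split=> //; last by rewrite setI0.
  - by split; [apply: (trig_ext (trig_cst F0 1)) => y; rewrite indicE mem_set|exact: openT].
  - by split; [apply: (trig_ext (trig_cst F0 0)) => y; rewrite indicE memNset|exact: open0].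
  - by move=> c [].
have [|A' [B' [gA' gB' KA' BB' AB']]] := IH.
  by move=> y ys; apply: sC; rewrite inE ys orbT.
have [gA gB KA _ AB] := hB x (sC _ (mem_head _ _)).
exists (A x `&` A'), (B x `|` B'); split; [exact: goodI|exact: goodU| | |].
- by rewrite subsetI.
- move=> c [y /=]; rewrite inE => /predU1P[-> Bxc|ys Byc]; first by left.
  by right; apply: BB'; exists y.
- apply/seteqP; split=> y // [[Ay A'y] [By|B'y]].
    by rewrite -AB; split.
  by rewrite -AB'; split.
Qed.

Lemma separate_compacts (K C : set U) : compact K -> compact C -> K `&` C = set0 ->
  exists A, [/\ trig_class F \1_A, open A, K `<=` A & A `&` C = set0].
Proof.
move=> cK cC KC.
have [A [B [[tA oA] _ KA CB AB]]] : separated K C.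
  apply: separated_compact => // y Cy; apply/separatedC/separated_compact => // x Kx.
  apply: separated_points; apply: contraPneq KC => yx; rewrite yx in Cy.
  by apply/eqP/set0P; exists x.
exists A; split=> //; apply/seteqP; split=> x // [Ax Cx].
by rewrite -AB; split=> //; exact: CB.
Qed.

(** Take a compact [C] outside [K] that carries the [m2]-mass of the complement up to [e], and a set
    [A] of the class that contains [K] and misses [C]. Then [m1 K <= m1 A = m2 A <= m2 setT - m2 C <
    m2 K + e]. *)
Let radon_compact_le (m1 m2 : {finite_measure set (borel U) -> \bar R}) (K : set U) :
  (forall (a : cdual U) c, (\int[m1]_u cos (a u + c) = \int[m2]_u cos (a u + c))%R) ->
  radon m2 -> compact K -> (m1 K <= m2 K)%E.
Proof.
move=> m12 [_ rad] cK.
have m12F f c : F f -> (\int[m1]_x cos (f x + c) = \int[m2]_x cos (f x + c))%R.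
  by move=> [a ->].
have mopen (A : set (borel U)) : open (A : set U) -> measurable A.
  by move=> oA; exact: sub_sigma_algebra.
have mC (C : set (borel U)) : compact (C : set U) -> measurable C.
  move=> cC; have oC : open (~` (C : set U)).
    by apply: closed_openC; exact: (compact_closed (@norm_hausdorff _ U) cC).
  by rewrite -[C]setCK; apply: measurableC; exact: mopen.
have m12T : m1 setT = m2 setT.
  apply: (trig_measure mF m12F measurableT).
  by apply: (trig_ext (trig_cst F0 1)) => y; rewrite indicE mem_set.
have mKC := measurableC (mC _ cK).
apply/lee_addgt0Pr => e e0.
have fK : ereal_sup [set m2 C | C in [set C : set U | compact C /\ C `<=` ~` K]] \is a fin_num.
  by rewrite -rad//; exact: fin_num_measure.
have [_ [C [cC CK] <-]] := ub_ereal_sup_adherent e0 fK.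
rewrite -rad// => h.
have KC : K `&` C = set0 by apply/seteqP; split=> x // [Kx /CK].
have [A [tA oA KA AC]] := separate_compacts cK cC KC.
have mA := mopen _ oA.
have -> : (m2 K = m2 setT - m2 (~` K))%E.
  have -> : m2 setT = (m2 K + m2 (~` K))%E.
    by rewrite -measureU ?setUv ?setICr//; exact: mC.
  by rewrite addeK// fin_num_measure.
have le1 : (m1 K <= m2 A)%E.
  by rewrite -(trig_measure mF m12F mA tA); apply: le_measure; rewrite ?inE//; exact: mC.
apply: (le_trans le1).
have : (m2 A + m2 C <= m2 setT)%E.
  rewrite -measureU//; last exact: mC.
  by apply: le_measure; rewrite ?inE//; apply: measurableU => //; exact: mC.
have a := fin_num_measure m2 _ mA; have b := fin_num_measure m2 _ (mC _ cC).
have c := fin_num_measure m2 _ mKC; have d := fin_num_measure m2 _ measurableT.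
have {}h : ((fine (m2 (~` K)))%:E - e%:E < m2 C)%E by rewrite fineK//; exact: h.
move: h; rewrite -(fineK a) -(fineK b) -(fineK c) -(fineK d).
rewrite -!EFinB -!EFinD !lee_fin lte_fin; lra.
Qed.

(** Inner regularity reduces all Borel sets to compact ones, including those outside the
    sigma-algebra generated by the functionals. *)
Lemma radon_unique (m1 m2 : {finite_measure set (borel U) -> \bar R}) :
  (forall (a : cdual U) c, (\int[m1]_u cos (a u + c) = \int[m2]_u cos (a u + c))%R) ->
  radon m1 -> radon m2 -> forall B, measurable B -> m1 B = m2 B.
Proof.
move=> m12 r1 r2 B mB; rewrite r1.2// r2.2//; congr ereal_sup.
apply/eq_imagel => K [cK _]; apply/eqP; rewrite eq_le; apply/andP; split.
  exact: radon_compact_le.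
by apply: radon_compact_le => // a c; rewrite m12.
Qed.

End radon_unique.

(** * Characteristic functions and convolutions *)

Section set_functions.
Context d (T : measurableType d) (R : realType).
Implicit Types m : set T -> \bar R.
Local Open Scope ereal_scope.

Import HBNNSimple.

Let eq_integral_sub m1 m2 (f : T -> \bar R) :
  (forall A, measurable A -> m1 A = m2 A) ->
  [set sintegral m1 h | h in [set h : {nnsfun T >-> R} |
     (forall x, (h x)%:E <= f x)]] `<=`
  [set sintegral m2 h | h in [set h : {nnsfun T >-> R} |
     (forall x, (h x)%:E <= f x)]].
Proof.
move=> m12 _ [h hf <-]; exists h => //; apply: eq_fsbigr => r _.
by rewrite m12.
Qed.

(** The integral is a difference of suprema of sums over simple functions, and these sums evaluate
    the set function on measurable sets only. Hence no measure structure is involved, and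
    cylindrical set functions are covered. *)
Lemma eq_set_function_integral m1 m2 (f : T -> \bar R) :
  (forall A, measurable A -> m1 A = m2 A) -> \int[m1]_x f x = \int[m2]_x f x.
Proof.
move=> m12; rewrite /integral.
congr (ereal_sup _ - ereal_sup _); apply/seteqP;
  by split; apply: eq_integral_sub => // A mA; rewrite m12.
Qed.

Section as_probability.
Variables (M : {measure set T -> \bar R}) (M1 : M setT = 1).
(** The dummy [let] makes the term depend on [M1], so that the probability instance attached to it
    can find the proof that the total mass is 1. *)
Definition as_probability := (fun A => let _ := M1 in M A) : set T -> \bar R.
HB.instance Definition _ := Measure.on as_probability.
HB.instance Definition _ := Measure_isProbability.Build _ _ _ as_probability M1.
End as_probability.

Lemma measure_probability (M : {measure set T -> \bar R}) : M setT = 1 ->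
  exists P : probability T R, forall A, P A = M A.
Proof. by move=> M1; exists (as_probability M1). Qed.

Lemma measure_is_measure (M : {measure set T -> \bar R}) : is_measure M.
Proof. by split=> //; exact: measure_semi_sigma_additive. Qed.

End set_functions.

Section complex_exponential.
Context {R : realType}.
Implicit Types (z w : R[i]) (t : R).

Lemma ReD z w : complex.Re (z + w) = complex.Re z + complex.Re w.
Proof. by case: z; case: w. Qed.

Lemma ImD z w : complex.Im (z + w) = complex.Im z + complex.Im w.
Proof. by case: z; case: w. Qed.

Lemma ReM z w : complex.Re (z * w) =
  complex.Re z * complex.Re w - complex.Im z * complex.Im w.
Proof. by case: z; case: w. Qed.

Lemma ImM z w : complex.Im (z * w) =
  complex.Re z * complex.Im w + complex.Im z * complex.Re w.
Proof. by case: z => a b; case: w => c e /=; rewrite [b * c]mulrC. Qed.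

Lemma complex_eq z w : complex.Re z = complex.Re w -> complex.Im z = complex.Im w -> z = w.
Proof. by case: z; case: w => ? ? ? ? /= -> ->. Qed.

Lemma cexpD z w : cexp (z + w) = cexp z * cexp w.
Proof.
rewrite /cexp ReD ImD expRD cosD sinD.
by apply: complex_eq; rewrite /=; ring.
Qed.

Lemma cexp0 : cexp 0 = 1 :> R[i].
Proof. by rewrite /cexp/= expR0 cos0 sin0 !mul1r. Qed.

Lemma cexpMn z n : cexp (z *+ n) = cexp z ^+ n.
Proof. by elim: n => [|n IH]; rewrite ?mulr0n ?expr0 ?cexp0// mulrS exprS cexpD IH. Qed.

Lemma expiE t : expi t = (cos t +i* sin t)%C.
Proof.
by rewrite /expi /cexp /= !mul0r mul1r sub0r oppr0 add0r expR0 !mul1r.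
Qed.

End complex_exponential.

Section characteristic_integrals.
Context d (T : measurableType d) (R : realType).
Implicit Types (m : {finite_measure set T -> \bar R}) (g : T -> R).

Lemma mbounded_cos g : measurable_fun setT g -> mbounded (cos \o g).
Proof.
move=> mg; split; last by exists 1 => x; exact: cos_max.
exact: (measurableT_comp (continuous_measurable_fun (@continuous_cos R))).
Qed.

Lemma mbounded_sin g : measurable_fun setT g -> mbounded (sin \o g).
Proof.
move=> mg; split; last by exists 1 => x; exact: sin_max.
exact: (measurableT_comp (continuous_measurable_fun (@continuous_sin R))).
Qed.

Lemma cintegral_expi (m : {measure set T -> \bar R}) g : cintegral m (fun x => expi (g x)) =
  ((\int[m]_x cos (g x))%R +i* (\int[m]_x sin (g x))%R)%C.
Proof.
rewrite /cintegral /Rintegral.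
by congr (fine _ +i* fine _)%C; apply: eq_integral => x _; rewrite expiE.
Qed.

Lemma Rintegral_cosD m g c : measurable_fun setT g ->
  (\int[m]_x cos (g x + c))%R =
  complex.Re (cintegral m (fun x => expi (g x))) * cos c -
  complex.Im (cintegral m (fun x => expi (g x))) * sin c.
Proof.
move=> mg; rewrite cintegral_expi/=.
have [ic si] := (mbounded_integrable m (mbounded_cos mg), mbounded_integrable m (mbounded_sin mg)).
under eq_Rintegral do rewrite cosD.
rewrite RintegralB//; last 2 first.
- exact: (integrableZr measurableT (cos c) ic).
- exact: (integrableZr measurableT (sin c) si).
by rewrite !RintegralZr.
Qed.

End characteristic_integrals.

Section image_measure.
Context d1 d2 (X : measurableType d1) (Y : measurableType d2) (R : realType).
Variables (phi : X -> Y) (mphi : measurable_fun setT phi).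

Lemma image_measure (m : {measure set X -> \bar R}) :
  exists m' : {measure set Y -> \bar R}, forall B, m' B = m (phi @^-1` B).
Proof.
pose M : {measure set Y -> \bar R} := pushforward m phi.
by exists (M mphi).
Qed.

Lemma image_probability (P : probability X R) :
  exists P' : probability Y R, forall B, P' B = P (phi @^-1` B).
Proof.
have [m' Em'] := image_measure P.
have m'1 : m' setT = 1%E by rewrite Em' preimage_setT; exact: (@probability_setT _ _ _ P).
by have [P' EP'] := measure_probability m'1; exists P' => B; rewrite EP'.
Qed.

End image_measure.

Section image_integral.
Context d1 d2 (X : measurableType d1) (Y : measurableType d2) (R : realType).
Variables (phi : X -> Y) (m : {measure set X -> \bar R}) (m' : set Y -> \bar R).
Hypothesis mphi : measurable_fun setT phi.
Hypothesis mm' : forall B, measurable B -> m' B = m (phi @^-1` B).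
Local Open Scope ereal_scope.

Let mphi_mixin := isMeasurableFun.Build _ _ _ _ _ mphi.
Let mphi_pack : {mfun X >-> Y} := HB.pack phi mphi_mixin.

(** Here [m'] is a bare set function that agrees with the image on measurable sets. With [phi] the
    identity from the Borel to a cylindrical sigma-algebra, this moves integrals from [on_cyl] to a
    Borel measure. *)
Lemma image_integral (g : Y -> \bar R) : measurable_fun setT g ->
  \int[m']_y g y = \int[m]_x g (phi x).
Proof.
move=> mg; rewrite (eq_set_function_integral (m2 := pushforward m mphi_pack))//.
rewrite [LHS]integralE [RHS]integralE.
rewrite (ge0_integral_pushforward mphi)//; last exact: measurable_funepos.
rewrite (ge0_integral_pushforward mphi)//; last exact: measurable_funeneg.
congr (_ - _); apply: eq_integral => x _.
  by rewrite -[RHS]/((g \o phi)^\+ x) (funepos_comp g phi).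
by rewrite -[RHS]/((g \o phi)^\- x) (funeneg_comp g phi).
Qed.

Lemma image_integrable (g : Y -> \bar R) : measurable_fun setT g ->
  m.-integrable setT (g \o phi) <-> m'.-integrable setT g.
Proof.
move=> mg; have E : \int[m']_y `|g y| = \int[m]_x `|g (phi x)|.
  by apply: image_integral; exact: measurableT_comp.
split=> /integrableP[_ h]; apply/integrableP; split=> //.
- by rewrite E.
- exact: measurableT_comp.
- by rewrite -E.
Qed.

Lemma image_cintegral (g : Y -> R[i]) :
  measurable_fun setT (fun y => complex.Re (g y)) ->
  measurable_fun setT (fun y => complex.Im (g y)) ->
  cintegral m' g = cintegral m (g \o phi).
Proof.
move=> mr mi; rewrite /cintegral.
by congr (fine _ +i* fine _)%C; apply: image_integral; exact/measurable_EFinP.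
Qed.

Lemma image_cintegrable (g : Y -> R[i]) :
  measurable_fun setT (fun y => complex.Re (g y)) ->
  measurable_fun setT (fun y => complex.Im (g y)) ->
  cintegrable m (g \o phi) <-> cintegrable m' g.
Proof.
move=> /measurable_EFinP mr /measurable_EFinP mi.
by split=> -[/(image_integrable mr) ? /(image_integrable mi) ?].
Qed.

Lemma image_expi (g : Y -> R) : measurable_fun setT g ->
  cintegral m' (fun y => expi (g y)) = cintegral m (fun x => expi (g (phi x))).
Proof.
move=> mg; apply: image_cintegral.
- rewrite (_ : (fun _ => _) = cos \o g); first exact: (mbounded_cos mg).1.
  by apply/funext => y; rewrite expiE.
- rewrite (_ : (fun _ => _) = sin \o g); first exact: (mbounded_sin mg).1.
  by apply/funext => y; rewrite expiE.
Qed.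

End image_integral.

Section product_Rintegral.
Context d1 d2 (X : measurableType d1) (Y : measurableType d2) (R : realType).
Variables (P1 : probability X R) (P2 : probability Y R).

Lemma product_Rintegral (f : X -> R) (g : Y -> R) : mbounded f -> mbounded g ->
  (P1 \x P2)%E.-integrable setT (EFin \o (fun z : X * Y => f z.1 * g z.2)) /\
  (\int[(P1 \x P2)%E]_z (f z.1 * g z.2) =
   (\int[P1]_x f x) * (\int[P2]_y g y))%R.
Proof.
move=> bf bg; have [[mf [Cf hf]] [mg [Cg hg]]] := (bf, bg).
have bfg : mbounded (fun z : X * Y => f z.1 * g z.2).
  split; last by exists (Cf * Cg) => z; rewrite normrM ler_pM.
  by apply: measurable_funM; [apply: (measurableT_comp mf); exact: measurable_fst|
    apply: (measurableT_comp mg); exact: measurable_snd].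
pose P12 : probability (X * Y)%type R := (P1 \x P2)%E.
have ifg := mbounded_integrable P12 bfg.
split; first exact: ifg.
have [i1 i2] := (mbounded_integrable P1 bf, mbounded_integrable P2 bg).
rewrite [LHS]/Rintegral -integral12_prod_meas1//=.
rewrite -RintegralZr//; congr fine; apply: eq_integral => x _.
rewrite /fubini_F/= -RintegralZl// fineK//.
by apply: integrable_fin_num => //; apply: (integrableZl _ _ i2).
Qed.

End product_Rintegral.

Section convolution.
Context (R : realType) (n : nat).
Local Notation V := (borel 'rV[R]_n).
Implicit Types (P : probability V R) (m : set V -> \bar R).

Definition cf m x : R[i] := cintegral m (fun y => expi (dot y x)).

Lemma cf_unique P1 P2 : (forall x, cf P1 x = cf P2 x) ->
  forall B, measurable B -> P1 B = P2 B.
Proof.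
move=> P12 B mB; apply: rV_measure_unique => // x c.
by rewrite !Rintegral_cosD; [rewrite -!/(cf _ x) P12|exact: measurable_dot..].
Qed.

Let measurable_add : measurable_fun setT (fun z : V * V => (z.1 : 'rV[R]_n) + z.2 : V).
Proof.
apply: measurable_rV => i.
rewrite (_ : (fun _ => _) = (fun z : V * V => (z.1 : 'rV[R]_n) ord0 i + (z.2 : 'rV[R]_n) ord0 i)).
  apply: measurable_funD.
    by apply: (measurableT_comp (measurable_coord i)); exact: measurable_fst.
  by apply: (measurableT_comp (measurable_coord i)); exact: measurable_snd.
by apply/funext => z; rewrite mxE.
Qed.

Lemma eq_convolution (m1 m2 m1' m2' : set V -> \bar R) :
  (forall B, measurable B -> m1 B = m1' B) ->
  (forall B, measurable B -> m2 B = m2' B) ->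
  forall B, measurable B -> convolution m1 m2 B = convolution m1' m2' B.
Proof.
move=> h1 h2 B mB.
pose A : set (V * V) := [set z : V * V | B ((z.1 : 'rV[R]_n) + z.2)].
have mA : measurable A by have := measurable_add measurableT mB; rewrite setTI.
have E : (m2 \o xsection A) = (m2' \o xsection A).
  by apply/funext => x; exact: (h2 _ (measurable_xsection x mA)).
(* For bare set functions too, the product unfolds to the integral of the sections, and these are
   measurable. *)
change ((\int[m1]_x (m2 \o xsection A) x)%E = (\int[m1']_x (m2' \o xsection A) x)%E).
by rewrite E; exact: (eq_set_function_integral _ h1).
Qed.

Lemma convolution_probability P1 P2 : exists P : probability V R,
  (forall B, measurable B -> P B = convolution P1 P2 B) /\
  (forall x, cf P x = cf P1 x * cf P2 x).
Proof.
have [P PQ] := image_probability measurable_add (P1 \x P2)%E.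
exists P; split=> [B _|x]; first by rewrite PQ.
have -> : cf P x = cintegral (P1 \x P2)%E (fun z : V * V => expi (dot ((z.1 : 'rV[R]_n) + z.2) x)).
  by apply: (image_expi measurable_add) => [B _|]; [rewrite PQ|exact: measurable_dot].
rewrite /cf.
rewrite !cintegral_expi.
have m1 := measurable_dot x.
have [bc1 bs1] := (mbounded_cos m1, mbounded_sin m1).
have [i1 E1] := product_Rintegral P1 P2 bc1 bc1.
have [i2 E2] := product_Rintegral P1 P2 bs1 bs1.
have [i3 E3] := product_Rintegral P1 P2 bs1 bc1.
have [i4 E4] := product_Rintegral P1 P2 bc1 bs1.
apply: complex_eq; rewrite ?ReM ?ImM /=.
- rewrite -E1 -E2 -RintegralB//; try exact: mbounded_integrable.
  by apply: eq_Rintegral => z _; rewrite /= dotDl cosD.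
- rewrite -E3 -E4 addrC -RintegralD//; try exact: mbounded_integrable.
  by apply: eq_Rintegral => z _; rewrite /= dotDl sinD.
Qed.

Lemma convolution_pow_probability P k : (0 < k)%N -> exists Q : probability V R,
  (forall B, measurable B -> Q B = convolution_pow P k B) /\
  (forall x, cf Q x = cf P x ^+ k).
Proof.
case: k => // k _; elim: k => [|k [Q [QP cQ]]]; first by exists P.
have [Q' [QP' cQ']] := convolution_probability P Q.
exists Q'; split=> [B mB|x]; last by rewrite cQ' cQ -exprS.
by rewrite QP'//; exact: eq_convolution.
Qed.

Lemma eq_convolution_pow (m1 m2 : set V -> \bar R) k :
  (forall B, measurable B -> m1 B = m2 B) ->
  forall B, measurable B -> convolution_pow m1 k B = convolution_pow m2 k B.
Proof.
move=> h; case: k => [|k]; first exact: h.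
by elim: k => [|k IH]; [exact: h|move=> B mB; exact: eq_convolution].
Qed.

End convolution.

(** * Levy's continuity theorem *)

(** Compactness of [[- C, C]] gives a cluster point, and an ultrafilter converges to each of its
    cluster points. *)
Lemma ultra_bounded_cvg (R : realType) (G : set_system nat) (u : nat -> R) (C : R) :
  UltraFilter G -> (forall n, `|u n| <= C) -> exists l : R, u @ G --> l.
Proof.
move=> UG uC.
have cC : compact (`[- C, C]%classic : set R) by exact: segment_compact.
have [|p [_ clp]] := cC (u @ G) _.
  by apply: (@filterE _ G) => n /=; rewrite in_itv/= -ler_norml.
exists p => B nB; have [//|GnB] := in_ultra_setVsetC (u @^-1` B) UG.
by have [x [/= nBx]] := clp (~` B) B GnB nB.
Qed.

Lemma unit_lebesgue (R : realType) : exists L : probability (measurableTypeR R) R,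
  forall A, L A = lebesgue_measure (A `&` `[0, 1[%classic).
Proof.
pose M := mrestr (@lebesgue_measure R) (measurable_itv `[0, 1[).
have M1 : M setT = 1%E.
  by rewrite /M /mrestr setTI lebesgue_measure_itv/= lte_fin ltr01 oppr0 adde0.
by have [L LM] := measure_probability M1; exists L => A; rewrite LM.
Qed.

Lemma Rintegral_sum d (T : measurableType d) (R : realType)
    (m : {finite_measure set T -> \bar R}) (I : Type) (r : seq I) (F : I -> T -> R) :
  (forall i, mbounded (F i)) ->
  mbounded (fun x => \sum_(i <- r) F i x) /\
  (\int[m]_x (\sum_(i <- r) F i x) = \sum_(i <- r) \int[m]_x F i x)%R.
Proof.
move=> bF; elim: r => [|i r [[mIH [C CIH]] IH]].
  split.
    split; first by apply: measurable_sum => i; have [] := bF i.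
    by exists 0 => x; rewrite big_nil normr0.
  rewrite big_nil; under eq_Rintegral do rewrite big_nil.
  by rewrite Rintegral_cst// mul0r.
have [[mi [D Di]] bi] := (bF i, bF i).
split.
  split; first by apply: measurable_sum => j; have [] := bF j.
  by exists (D + C) => x; rewrite big_cons (le_trans (ler_normD _ _))// lerD.
rewrite big_cons -IH -RintegralD//; try exact: mbounded_integrable.
  by apply: eq_Rintegral => x _; rewrite big_cons.
by apply: mbounded_integrable; split=> //; exists C.
Qed.

(** * Realising a limit of joint laws on the unit interval *)

Section bits.
Context d (T : measurableType d) (R : realType).
Variables (P : nat -> probability T R) (C : nat -> set T).
Variables (G : set_system nat) (UG : UltraFilter G).
Hypothesis mC : forall k, measurable (C k).

Let code (l : nat) (y : T) : seq bool := mkseq (fun k => y \in C k) l.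

Let cell (s : seq bool) : set T := [set y | code (size s) y = s].

Let codeS l y : code l.+1 y = rcons (code l y) (y \in C l).
Proof. by rewrite /code /mkseq -addn1 iotaD map_cat /= cats1. Qed.

Let cell_rcons s b : cell (rcons s b) = cell s `&` [set y | (y \in C (size s)) = b].
Proof.
rewrite /cell; apply/seteqP; split=> y /=; rewrite size_rcons codeS.
  by move/eqP; rewrite eqseq_rcons => /andP[/eqP -> /eqP ->].
by move=> [-> ->].
Qed.

Let mbit k b : measurable [set y | (y \in C k) = b].
Proof.
case: b.
  by rewrite (_ : [set _ | _] = C k)//; apply/seteqP; split=> y /=; [exact: set_mem|exact: mem_set].
rewrite (_ : [set _ | _] = ~` C k); first exact: measurableC.
by apply/seteqP; split=> y /= h; [move/mem_set; rewrite h|exact: memNset].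
Qed.

Let mcell s : measurable (cell s).
Proof.
elim/last_ind: s => [|s b IH]; first by rewrite (_ : cell _ = setT)//; apply/seteqP.
by rewrite cell_rcons; apply: measurableI.
Qed.

Let pj j s : R := fine (P j (cell s)).

Let pj_ge0 j s : 0 <= pj j s. Proof. exact: fine_ge0. Qed.

Let pjE j s : (P j (cell s) = (pj j s)%:E)%E.
Proof. by rewrite fineK// fin_num_measure. Qed.

Let pj_rcons j s : pj j s = pj j (rcons s false) + pj j (rcons s true).
Proof.
apply: EFin_inj; rewrite EFinD -!pjE -measureU//; last first.
  rewrite !cell_rcons; apply/seteqP; split=> y //= [[_ +] [_ +]].
  by move=> -> .
congr (P j _); rewrite !cell_rcons -setIUr -[LHS]setIT; congr (_ `&` _).
by apply/seteqP; split=> y //= _; case: (y \in _); [right|left].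
Qed.

Let pj_le1 j s : pj j s <= 1.
Proof. by rewrite -lee_fin -pjE probability_le1. Qed.

Let p_ex s : exists l : R, pj ^~ s @ G --> l.
Proof.
by apply: (@ultra_bounded_cvg _ _ _ 1) => n; rewrite ger0_norm.
Qed.

Let p s : R := sval (cid (p_ex s)).

Let p_cvg s : pj ^~ s @ G --> p s.
Proof. exact: svalP (cid (p_ex s)). Qed.

Let PG : ProperFilter G := ultra_proper.

Let p_rcons s : p s = p (rcons s false) + p (rcons s true).
Proof.
have h := cvgD (@p_cvg (rcons s false)) (@p_cvg (rcons s true)).
apply: (cvg_unique (@Rhausdorff R) (@p_cvg s)).
have E : pj ^~ s = pj ^~ (rcons s false) + pj ^~ (rcons s true).
  by apply/funext => j; exact: pj_rcons.
by rewrite /= E; exact: h.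
Qed.

Let p_ge0 s : 0 <= p s.
Proof.
rewrite -(cvg_lim (@Rhausdorff R) (@p_cvg s)).
by apply: limr_ge; [apply/cvg_ex; exists (p s); exact: p_cvg|exact: nearW].
Qed.

Let p_nil : p [::] = 1.
Proof.
apply: (cvg_unique (@Rhausdorff R) (@p_cvg [::])).
rewrite /= (_ : pj ^~ [::] = cst 1); first exact: cvg_cst.
apply/funext => j; apply: EFin_inj; rewrite -pjE.
by rewrite (_ : cell _ = setT) ?probability_setT//; apply/seteqP.
Qed.

(* Nested intervals [left s, left s + p s[ of length [p s] split [0, 1[ as the
   cells of words split [T]. *)
Let step (ac : seq bool * R) b : seq bool * R :=
  (rcons ac.1 b, if b then ac.2 + p (rcons ac.1 false) else ac.2).
Let left s : R := (foldl step ([::], 0) s).2.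

Let step1 s : (foldl step ([::], 0) s).1 = s.
Proof. by elim/last_ind: s => // s b IH; rewrite foldl_rcons /= IH. Qed.

Let left_rcons s b : left (rcons s b) = if b then left s + p (rcons s false) else left s.
Proof. by rewrite /left foldl_rcons /step/= step1. Qed.

(** Binary search down the tree of nested intervals: for [u] in [0, 1[ this is the word of length
    [l] whose interval contains [u]. Intervals of length [p s = 0] are half-open, hence empty and
    never reached. *)
Let word := fix word (u : R) l : seq bool := if l is l'.+1 then
  let s := word u l' in rcons s (left s + p (rcons s false) <= u) else [::].

Let size_word u l : size (word u l) = l.
Proof. by elim: l => //= l IH; rewrite size_rcons IH. Qed.

Let word_cell u l s : size s = l -> 0 <= u < 1 ->
  (word u l = s) <-> (left s <= u < left s + p s).
Proof.
elim: l s => [|l IH] s.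
  by move=> /size0nil -> h; rewrite /left/= add0r p_nil h.
case/lastP: s => // s b; rewrite size_rcons => -[sl] u01.
have IHs := IH _ sl u01; have pE := p_rcons s; rewrite /= left_rcons.
have p0 := p_ge0 (rcons s false); have p1 := p_ge0 (rcons s true).
split=> [/eqP|h].
  rewrite eqseq_rcons => /andP[/eqP ws /eqP].
  have /andP[h1 h2] := IHs.1 ws; rewrite ws; case: b => [h3|/negbT].
    by apply/andP; split; lra.
  by rewrite -ltNge => h3; apply/andP; split; lra.
have ws : word u l = s.
  by apply/IHs; case: b h => /andP[h1 h2]; apply/andP; split; lra.
rewrite ws; congr rcons; case: b h => /andP[h1 h2]; first by rewrite h1.
by apply/negbTE; rewrite -ltNge.
Qed.

Let bit k u := left (word u k) + p (rcons (word u k) false) <= u.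

Let wordE u l : word u l = mkseq (bit ^~ u) l.
Proof.
elim: l => //= l IH.
by rewrite [RHS]/mkseq -addn1 iotaD map_cat /= cats1 -/(mkseq _ l) -IH.
Qed.

Variable L : probability (measurableTypeR R) R.
Hypothesis LE : forall A, L A = lebesgue_measure (A `&` `[0, 1[%classic).

Let left_bounds s : 0 <= left s /\ left s + p s <= 1.
Proof.
elim/last_ind: s => [|s b [h1 h2]]; first by rewrite /left/= p_nil add0r.
have pE := p_rcons s; have p0 := p_ge0 (rcons s false); have p1 := p_ge0 (rcons s true).
by rewrite left_rcons; case: b; split; lra.
Qed.

Let mword s : measurable ([set u | word u (size s) = s] : set (measurableTypeR R)).
Proof.
elim/last_ind: s => [|s b IH]; first by rewrite (_ : [set _ | _] = setT)//; apply/seteqP.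
pose c := left s + p (rcons s false).
have -> : [set u | word u (size (rcons s b)) = rcons s b] =
    [set u | word u (size s) = s] `&` (if b then `[c, +oo[%classic else `]-oo, c[%classic).
  apply/seteqP; split=> u; rewrite size_rcons /=.
    move=> /eqP; rewrite eqseq_rcons => /andP[/eqP ws /eqP].
    rewrite ws -/c; case: b => [h|/negbT]; first by rewrite /= in_itv/= h.
    by rewrite -ltNge => h; rewrite /= in_itv/=.
  move=> [ws]; rewrite ws -/c; case: b; rewrite /= in_itv/= ?andbT => h.
    by rewrite h.
  by rewrite leNgt h.
by apply: measurableI => //; case: (b); exact: measurable_itv.
Qed.

Let word_measure s : L [set u | word u (size s) = s] = (p s)%:E.
Proof.
rewrite LE (_ : _ `&` _ = `[left s, left s + p s[%classic); last first.
  have [l0 l1] := left_bounds s.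
  apply/seteqP; split=> u /=; rewrite !in_itv/=.
    by move=> [ws u01]; exact: (word_cell erefl u01).1.
  move=> h; have u01 : 0 <= u < 1 by case/andP: h => h1 h2; apply/andP; split; lra.
  by split=> //; exact: (word_cell erefl u01).2.
rewrite lebesgue_measure_itv/= lte_fin ltrDl; have [ps|ps] := ltP 0 (p s).
  by rewrite -EFinB addrC addKr.
by congr (_%:E); apply/eqP; rewrite eq_le p_ge0.
Qed.

(** A function of the first [l] bits is a combination of indicators over the finitely many words of
    length [l]. Its convergence is thus that of finitely many cell probabilities. *)
Lemma bits_cvg (F : (nat -> bool) -> R) l :
  (forall b b', (forall k, (k < l)%N -> b k = b' k) -> F b = F b') ->
  [/\ mbounded (fun u : measurableTypeR R => F (bit ^~ u)),
    mbounded (fun y => F (fun k => y \in C k)) &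
    (\int[P j]_y F (fun k => y \in C k) @[j --> G] --> \int[L]_u F (bit ^~ u))%R].
Proof.
move=> Fl; pose g (s : seq bool) := F (nth false s).
have gE (b : nat -> bool) : F b = g (mkseq b l).
  by apply: Fl => k kl; rewrite nth_mkseq.
have sumE (w : seq bool) : size w = l ->
    g w = \sum_(s : l.-tuple bool) g s * (w == s)%:R.
  move=> sw; rewrite (bigD1 (Tuple (introT eqP sw)))//= eqxx mulr1 big1 ?addr0// => s.
  by rewrite -val_eqE/= eq_sym => /negbTE ->; rewrite mulr0.
pose fL (s : l.-tuple bool) (u : measurableTypeR R) : R := g s * \1_[set u | word u (size s) = s] u.
pose fP (s : l.-tuple bool) y : R := g s * \1_(cell s) y.
have FLE u : F (bit ^~ u) = \sum_(s : l.-tuple bool) fL s u.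
  rewrite gE -wordE sumE ?size_word//; apply: eq_bigr => s _.
  rewrite /fL indicE; congr (_ * _%:R); congr nat_of_bool.
  by rewrite size_tuple; apply/eqP/idP => [h|/set_mem//]; exact/mem_set.
have FPE y : F (fun k => y \in C k) = \sum_(s : l.-tuple bool) fP s y.
  rewrite gE sumE ?size_mkseq//; apply: eq_bigr => s _.
  rewrite /fP indicE; congr (_ * _%:R); congr nat_of_bool.
  by apply/eqP/idP => [h|/set_mem]; [apply/mem_set|]; rewrite /cell/= size_tuple.
have bf (d' : measure_display) (X : measurableType d') (A : set X) c : measurable A ->
    mbounded (fun x => c * \1_A x : R).
  move=> mA; split; first by apply: measurable_funM => //; exact: measurable_indic.
  exists `|c| => x; rewrite normrM indicE; case: (_ \in _) => /=.
    by rewrite normr1 mulr1.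
  by rewrite normr0 mulr0.
have bfL s : mbounded (fL s) by exact: bf.
have bfP s : mbounded (fP s) by exact: bf.
have EFL : (fun u : measurableTypeR R => F (bit ^~ u)) = (fun u => \sum_(s : l.-tuple bool) fL s u).
  by apply/funext => u; exact: FLE.
have EFP : (fun y => F (fun k => y \in C k)) = (fun y => \sum_(s : l.-tuple bool) fP s y).
  by apply/funext => y; exact: FPE.
have int1 d' (X : measurableType d') (Q : probability X R) (A : set X) c : measurable A ->
    (\int[Q]_x (c * \1_A x) = c * fine (Q A))%R.
  move=> mA; rewrite RintegralZl//; last first.
    by apply: mbounded_integrable; have := bf _ X A 1 mA; under eq_fun do rewrite mul1r.
  by rewrite /Rintegral integral_indic// setIT.
split.
- by rewrite EFL; have [] := Rintegral_sum L (index_enum _) bfL.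
- by rewrite EFP; have [] := Rintegral_sum (P 0%N) (index_enum _) bfP.
- rewrite EFL (Rintegral_sum L (index_enum _) bfL).2.
  under eq_fun do rewrite EFP (Rintegral_sum (P _) (index_enum _) bfP).2.
  apply: cvg_big => [|s _]; first exact: add_continuous.
  rewrite int1// word_measure/=; under eq_fun do rewrite int1//.
  by apply: cvgM; [exact: cvg_cst|exact: p_cvg].
Qed.

End bits.

(* Skorokhod-type realisation of a limit of joint laws: [bit k] stands for the
   event [C k], but lives on a space that carries the limit law. *)
Lemma ultralimit_bits d (T : measurableType d) (R : realType)
    (P : nat -> probability T R) (C : nat -> set T) (G : set_system nat) :
  UltraFilter G -> (forall k, measurable (C k)) ->
  exists (L : probability (measurableTypeR R) R) (bit : nat -> R -> bool),
  forall (F : (nat -> bool) -> R) l,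
  (forall b b', (forall k, (k < l)%N -> b k = b' k) -> F b = F b') ->
  [/\ mbounded (fun u : measurableTypeR R => F (bit ^~ u)),
    mbounded (fun y => F (fun k => y \in C k)) &
    (\int[P j]_y F (fun k => y \in C k) @[j --> G] --> \int[L]_u F (bit ^~ u))%R].
Proof.
move=> UG mC; have [L LE] := unit_lebesgue R.
exists L; eexists => F l Fl; exact: (bits_cvg P UG mC LE Fl).
Qed.

(** * Elementary inequalities for sine, cosine and the exponential *)

Section real_inequalities.
Context {R : realType}.
Implicit Types s t x : R.

Lemma mean_value (f df : R -> R) s t : (forall x, is_derive x 1 f (df x)) ->
  exists2 c, `|c - s| <= `|t - s| & f t - f s = df c * (t - s).
Proof.
move=> fdf.
have cf (a b : R) : {within `[a, b], continuous f}.
  apply: continuous_subspaceT => x.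
  by apply/differentiable_continuous/derivable1_diffP; have [] := fdf x.
have [st|ts] := leP s t.
  have [c + E] := @MVT_segment R f df s t st (fun x _ => fdf x) (cf s t).
  rewrite in_itv/= => /andP[sc ct]; exists c => //.
  by rewrite !ger0_norm ?subr_ge0// lerB.
have [c + E] := @MVT_segment R f df t s (ltW ts) (fun x _ => fdf x) (cf t s).
rewrite in_itv/= => /andP[tc cs]; exists c; last by lra.
by rewrite !ler0_norm ?subr_le0 ?(ltW ts)//; lra.
Qed.

Lemma mean_value_le (f df : R -> R) K s t : (forall x, is_derive x 1 f (df x)) ->
  (forall x, `|df x| <= K) -> `|f s - f t| <= K * `|s - t|.
Proof.
move=> fdf dfK; have [c _ ->] := mean_value t s fdf.
by rewrite normrM ler_wpM2r.
Qed.

Lemma cos_lipschitz s t : `|cos s - cos t| <= `|s - t|.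
Proof.
rewrite -[leRHS]mul1r; apply: (@mean_value_le cos (fun x => - sin x)) => // x.
by rewrite normrN sin_max.
Qed.

Lemma sin_lipschitz s t : `|sin s - sin t| <= `|s - t|.
Proof.
by rewrite -[leRHS]mul1r; apply: (@mean_value_le sin cos) => // x; exact: cos_max.
Qed.

Lemma norm_sin_le t : `|sin t| <= `|t|.
Proof. by have := sin_lipschitz t 0; rewrite sin0 !subr0. Qed.

(** One mean value step followed by the Lipschitz bound on the derivative. The factor 1/2 lost
    against the Taylor bound is harmless, as only the order of magnitude is used. *)
Lemma cos_sub1_le t : `|cos t - 1| <= t ^+ 2.
Proof.
have [c] := @mean_value cos (fun x => - sin x) 0 t _.
rewrite cos0 !subr0 => ct ->; rewrite normrM normrN -real_normK ?num_real// expr2.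
by rewrite ler_wpM2r// (le_trans (norm_sin_le _)).
Qed.

Lemma sin_sub_le t : `|sin t - t| <= t ^+ 2.
Proof.
have [c] := @mean_value (fun x => sin x - x) (fun x => cos x - 1) 0 t _.
rewrite sin0 !subr0 => ct ->; rewrite normrM -[leRHS]real_normK ?num_real// expr2.
rewrite ler_wpM2r// (le_trans _ ct)//.
by have := cos_lipschitz c 0; rewrite cos0 subr0.
Qed.

Lemma expR_sub1_le x : `|x| <= 2^-1 -> `|expR x - 1| <= 2 * `|x|.
Proof.
move=> x1; have [c] := @mean_value expR expR 0 x _.
rewrite expR0 !subr0 => cx ->; rewrite normrM ler_wpM2r// gtr0_norm ?expR_gt0//.
have c1 : c <= 2^-1 by rewrite (le_trans (ler_norm _))// (le_trans cx).
(* The constant 2: for [c <= 1/2], [expR (- c) >= 1 - c >= 1/2]. *)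
rewrite -[c]opprK expRN -[leRHS]invrK lef_pV2 ?posrE ?expR_gt0 ?invr_gt0//.
by have := expR_ge1Dx (- c); lra.
Qed.

Lemma expR_sub1_sub_le x : `|x| <= 2^-1 -> `|expR x - 1 - x| <= 2 * x ^+ 2.
Proof.
move=> x1; have [c] := @mean_value (fun x => expR x - x) (fun x => expR x - 1) 0 x _.
rewrite expR0 !subr0 => cx; rewrite addrAC => ->.
rewrite normrM -(real_normK (num_real x)) expr2 mulrA ler_wpM2r//.
rewrite (le_trans (expR_sub1_le _))//; first exact: le_trans cx x1.
by rewrite ler_pM2l.
Qed.

End real_inequalities.

Section grid.
Context {R : realType}.

(** The number of thresholds [a + m h] below [Y], times the mesh, is [Y - a] up to one mesh. The two
    one-sided conditions leave the bit of a threshold equal to [Y] free, as is unavoidable for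
    limits of laws. *)
Lemma grid_count (a h Y : R) (b : nat -> bool) M : 0 < h ->
  a <= Y <= a + M%:R * h ->
  (forall m, a + m%:R * h < Y -> b m) -> (forall m, b m -> a + m%:R * h <= Y) ->
  `|a + h * \sum_(m < M) (b m)%:R - Y| <= h.
Proof.
move=> h0 /andP[aY YM] b1 b2.
have lo N : Num.min (Y - a) (N%:R * h) <= h * \sum_(m < N) (b m)%:R.
  elim: N => [|N IH]; first by rewrite big_ord0 mul0r mulr0 ge_min lexx orbT.
  rewrite big_ord_recr/= mulrDr.
  have [YN|NY] := leP Y (a + N%:R * h).
    rewrite ge_min; apply/orP; left.
    rewrite min_l in IH; last by lra.
    by rewrite (le_trans IH)// lerDl mulr_ge0// ltW.
  rewrite b1// mulr1 ge_min; apply/orP; right.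
  rewrite min_r in IH; last by lra.
  by rewrite -addn1 natrD mulrDl mul1r lerD2r.
have up N : h * \sum_(m < N) (b m)%:R <= Y - a + h.
  elim: N => [|N IH]; first by rewrite big_ord0 mulr0; lra.
  rewrite big_ord_recr/= mulrDr; case bN : (b N); last by rewrite mulr0 addr0.
  have := b2 _ bN => aN; rewrite mulr1 lerD2r.
  have : h * \sum_(m < N) (b m)%:R <= N%:R * h.
    rewrite mulrC ler_pM2r// -[leRHS]mulr1 -[N in leRHS]card_ord -sum1_card natr_sum mulr_suml.
    by apply: ler_sum => i _; rewrite mul1r lern1 leq_b1.
  by move=> h1; rewrite (le_trans h1)//; lra.
have := lo M; rewrite min_l; last by lra.
by move=> h1; have := up M; rewrite ler_norml => h2; apply/andP; split; lra.
Qed.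

End grid.

(** * The continuity theorem for tight sequences *)

Section levy_continuity.
Context (R : realType) (n : nat).
Local Notation V := (borel 'rV[R]_n).
Variables (P : nat -> probability V R) (phi : 'rV[R]_n -> R[i]).
Hypothesis cvg_Re : forall x, complex.Re (cf (P j) x) @[j --> \oo] --> complex.Re (phi x).
Hypothesis cvg_Im : forall x, complex.Im (cf (P j) x) @[j --> \oo] --> complex.Im (phi x).
Hypothesis tight : forall i (e : R), 0 < e -> exists r : R,
  \forall j \near \oo, (P j [set y : V | (r < `|(y : 'rV[R]_n) ord0 i|)%R] <= e%:E)%E.

(* Countably many events that determine a point of R^n, its coordinates being
   recovered as Dedekind cuts. *)
Let C (k : nat) : set V := if unpickle k is Some (i, q)
  then [set y : V | ratr q < (y : 'rV[R]_n) ord0 i] else set0.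

Let code (y : V) k := y \in C k.

Let key (i : 'I_n) (q : rat) : nat := pickle (i, q).

Let codeE y i q : code y (key i q) = (ratr q < (y : 'rV[R]_n) ord0 i).
Proof. by rewrite /code /C /key pickleK; apply/idP/idP => [/set_mem|?]; rewrite ?inE. Qed.

Let mC k : measurable (C k).
Proof.
rewrite /C; case: unpickle => // -[i q].
rewrite (_ : [set _ | _] = (fun y : V => (y : 'rV[R]_n) ord0 i) @^-1` `]ratr q, +oo[%classic).
  by rewrite -[X in measurable X]setTI; apply: measurable_coord.
by apply/seteqP; split=> y /=; rewrite in_itv/= andbT.
Qed.

(** For [m < k * 2 * k.+1] these thresholds subdivide [-k, k] with mesh [1 / k.+1]; window and
    precision grow together with [k]. *)
Let thr k m : rat := - k%:R + m%:R / k.+1%:R.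

Let ratr_thr k m : ratr (thr k m) = - k%:R + m%:R * k.+1%:R^-1 :> R.
Proof. by rewrite /thr rmorphD rmorphN rmorphM fmorphV/= !rmorph_nat. Qed.

(** A point read off from finitely many bits by counting thresholds. Convergence of joint laws
    therefore applies to every function of it, with no regularity required. *)
Let grid k (b : nat -> bool) : 'rV[R]_n :=
  \row_i (- k%:R + k.+1%:R^-1 * \sum_(m < k * 2 * k.+1) (b (key i (thr k m)))%:R).

Let grid_approx k (b : nat -> bool) i (Y : R) : `|Y| <= k%:R ->
  (forall q, ratr q < Y -> b (key i q)) -> (forall q, b (key i q) -> ratr q <= Y) ->
  `|grid k b ord0 i - Y| <= k.+1%:R^-1.
Proof.
move=> Yk b1 b2; rewrite mxE; apply: (grid_count (b := fun m => b (key i (thr k m)))).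
- by rewrite invr_gt0.
- move: Yk; rewrite ler_norml natrM natrM mulfK ?pnatr_eq0// => /andP[? ?].
  by apply/andP; split; lra.
- by move=> m; rewrite -ratr_thr => /b1.
- by move=> m /b2; rewrite ratr_thr.
Qed.

Let depth k : nat := \max_(i < n) \max_(m < k * 2 * k.+1) (key i (thr k m)).+1.

Let grid_dep k b b' : (forall l, (l < depth k)%N -> b l = b' l) -> grid k b = grid k b'.
Proof.
move=> bb'; apply/rowP => i; rewrite !mxE; congr (_ + _ * _); apply: eq_bigr => m _.
rewrite bb'// /depth (leq_trans _ (leq_bigmax i))//.
exact: (leq_trans _ (leq_bigmax m)).
Qed.

Let norm1 (x : 'rV[R]_n) := \sum_i `|x ord0 i|.

Let dot_lipschitz (y z x : 'rV[R]_n) h :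
  (forall i, `|y ord0 i - z ord0 i| <= h) -> `|dot y x - dot z x| <= h * norm1 x.
Proof.
move=> yz; rewrite /dot /norm1 -sumrB mulr_sumr (le_trans (ler_norm_sum _ _ _))//.
by apply: ler_sum => i _; rewrite -mulrBl normrM ler_wpM2r.
Qed.

Section limit.
Variables (G : set_system nat) (UG : UltraFilter G) (Goo : \oo `<=` G).
Variables (L : probability (measurableTypeR R) R) (bit : nat -> R -> bool).
Hypothesis bitP : forall (F : (nat -> bool) -> R) l,
  (forall b b', (forall k, (k < l)%N -> b k = b' k) -> F b = F b') ->
  [/\ mbounded (fun u : measurableTypeR R => F (bit ^~ u)),
    mbounded (fun y => F (code y)) &
    (\int[P j]_y F (code y) @[j --> G] --> \int[L]_u F (bit ^~ u))%R].

Let PG : ProperFilter G := ultra_proper.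

Let test (f : R -> R) := [/\ continuous f, forall t, `|f t| <= 1 &
  forall s t, `|f s - f t| <= `|s - t|].

Let test_mbounded f x : test f -> mbounded (fun y : V => f (dot y x)).
Proof.
move=> [cf f1 _]; split; last by exists 1.
by apply: (measurableT_comp (continuous_measurable_fun cf)); exact: measurable_dot.
Qed.

Let bad (r : R) i : set V := [set y | r < `|(y : 'rV[R]_n) ord0 i|].

Let mbad r i : measurable (bad r i).
Proof.
rewrite (_ : bad r i = (fun y : V => `|(y : 'rV[R]_n) ord0 i|) @^-1` `]r, +oo[%classic).
  rewrite -[X in measurable X]setTI; apply: (measurableT_comp _ (measurable_coord i)) => //.
by apply/seteqP; split=> y /=; rewrite in_itv/= andbT.
Qed.

(** Inside the window the grid point is within [1 / k.+1] of [y] in each coordinate, and [f] is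
    1-Lipschitz. Outside, some coordinate is bad and the trivial bound 2 applies. *)
Let grid_error f x k y : test f ->
  `|f (dot (grid k (code y)) x) - f (dot y x)| <=
  norm1 x / k.+1%:R + \sum_(i < n) 2 * \1_(bad k%:R i) y.
Proof.
move=> [_ f1 flip].
have w0 : 0 <= norm1 x / k.+1%:R by rewrite divr_ge0// sumr_ge0.
have [yk|] := pselect (forall i, `|(y : 'rV[R]_n) ord0 i| <= k%:R).
  rewrite (le_trans (flip _ _))//.
  rewrite -[leLHS]addr0 lerD//; last by apply: sumr_ge0 => i _; rewrite mulr_ge0.
  rewrite mulrC; apply: dot_lipschitz => i.
  apply: grid_approx; first exact: yk.
    by move=> q; rewrite codeE.
  by move=> q; rewrite codeE => /ltW.
move/existsNP => [i /negP]; rewrite -ltNge => yi.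
rewrite (le_trans (ler_normB _ _))// -[leLHS]add0r lerD//.
rewrite (bigD1 i)//= indicE mem_set// mulr1.
rewrite -[leLHS]addr0 lerD//; last by apply: sumr_ge0 => j _; rewrite mulr_ge0.
by rewrite (le_trans (lerD (f1 _) (f1 _)))//; lra.
Qed.

Let grid_test f x k : test f ->
  [/\ mbounded (fun u : measurableTypeR R => f (dot (grid k (bit ^~ u)) x)),
    mbounded (fun y => f (dot (grid k (code y)) x)) &
    (\int[P j]_y f (dot (grid k (code y)) x) @[j --> G] -->
      \int[L]_u f (dot (grid k (bit ^~ u)) x))%R].
Proof.
move=> _; apply: (@bitP (fun b => f (dot (grid k b) x)) (depth k)) => b b' bb'.
by rewrite (grid_dep bb').
Qed.

Let grid_integral_error f x k j : test f ->
  `|(\int[P j]_y f (dot (grid k (code y)) x) - \int[P j]_y f (dot y x))%R| <=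
  norm1 x / k.+1%:R + \sum_(i < n) 2 * fine (P j (bad k%:R i)).
Proof.
move=> tf; have [_ b1 _] := grid_test x k tf; have b2 := test_mbounded x tf.
have [i1 i2] := (mbounded_integrable (P j) b1, mbounded_integrable (P j) b2).
rewrite -RintegralB//.
have bi i : mbounded (fun y : V => 2 * \1_(bad k%:R i) y : R).
  split; first by apply: measurable_funM => //; exact: measurable_indic.
  by exists 2 => y; rewrite ger0_norm ?mulr_ge0// indicE; case: (_ \in _); rewrite ?mulr1 ?mulr0.
have [bs Es] := Rintegral_sum (P j) (index_enum 'I_n) bi.
have bc : mbounded (fun y : V => norm1 x / k.+1%:R).
  by split=> //; exists `|norm1 x / k.+1%:R|.
rewrite (le_trans (le_normr_Rintegral _ _))//; first exact: (integrableB measurableT i1 i2).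
have -> : norm1 x / k.+1%:R + \sum_(i < n) 2 * fine (P j (bad k%:R i)) =
    (\int[P j]_y (norm1 x / k.+1%:R + \sum_(i < n) 2 * \1_(bad k%:R i) y))%R.
  rewrite RintegralD//; [|exact: mbounded_integrable..].
  rewrite Rintegral_cst// [X in fine X]probability_setT mulr1 Es; congr (_ + _); apply: eq_bigr => i _.
  rewrite RintegralZl//.
    by rewrite /Rintegral integral_indic// setIT.
  by apply: mbounded_integrable; split=> //; exists 1 => y; rewrite indicE; case: (_ \in _); rewrite ?normr1 ?normr0.
apply: le_Rintegral => //.
- exact: (integrable_norm (integrableB measurableT i1 i2)).
- by have := integrableD measurableT (mbounded_integrable (P j) bc) (mbounded_integrable (P j) bs).
- by move=> y _; exact: grid_error.
Qed.

(** An exchange of limits: for fixed [k] the integrals of the grid function converge along [G], and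
    by tightness the error against [f (dot y x)] is small for large [k], eventually in [j]. *)
Let grid_cvg f x (A : R) : test f ->
  (\int[P j]_y f (dot y x) @[j --> \oo] --> A)%R ->
  (\int[L]_u f (dot (grid k (bit ^~ u)) x) @[k --> \oo] --> A)%R.
Proof.
move=> tf fA; apply/cvgrPdist_le => e e0.
(* The [n] bad events, each weighted by 2, then cost at most [e / 2]. Dividing by [n.+1] covers
   dimension 0. *)
pose d := e / 4 / n.+1%:R.
have d0 : 0 < d by rewrite !divr_gt0.
have [r hr] := choice (fun i => tight i d0).
near=> k.
have kr i : r i <= k%:R.
  move: i; near: k; apply: filter_forall => i.
  by apply: filterS (nbhs_infty_gtr (r i)) => k /ltW.
have kx : norm1 x / k.+1%:R <= e / 2.
  rewrite ler_pdivrMr// mulrC -ler_pdivrMr; last by lra.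
  rewrite (@le_trans _ _ k%:R) ?ler_nat//; apply: ltW; near: k; exact: nbhs_infty_gtr.
have [_ _ bk] := grid_test x k tf.
have fAG : (\int[P j]_y f (dot y x) @[j --> G] --> A)%R by move=> B /fA/Goo.
have := cvg_norm (cvgB fAG bk) => h.
have : (`|\int[P j]_y f (dot y x) - \int[P j]_y f (dot (grid k (code y)) x)| @[j --> G] -->
  `|A - \int[L]_u f (dot (grid k (bit ^~ u)) x)|)%R by exact: h.
move/(cvg_lim (@Rhausdorff R)) <-.
apply: limr_le; first by apply/cvg_ex; eexists; exact: h.
apply: Goo; near=> j.
rewrite distrC (le_trans (grid_integral_error x k j tf))//.
rewrite [leRHS](splitr e) lerD//.
have -> : e / 2 = \sum_(i < n.+1) 2 * d.
  by rewrite sumr_const card_ord -mulr_natr /d; field; rewrite addrC natr1 pnatr_eq0.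
rewrite big_ord_recr/= -[leLHS]addr0 lerD//; last by rewrite mulr_ge0// ltW.
apply: ler_sum => i _; rewrite ler_pM2l//.
rewrite -lee_fin fineK ?fin_num_measure//.
move: i; near: j; apply: filter_forall => i; apply: filterS (hr i) => j.
apply: le_trans; apply: le_measure; [rewrite inE; exact: mbad..|].
by move=> y /= ky; exact: le_lt_trans (kr i) ky.
Unshelve. all: by end_near.
Qed.

Let bitI (F : (nat -> bool) -> bool) l :
  (forall b b', (forall k, (k < l)%N -> b k = b' k) -> F b = F b') ->
  [/\ measurable ([set u | F (bit ^~ u)] : set (measurableTypeR R)),
    measurable [set y | F (code y)] &
    (fine (P j [set y | F (code y)]) @[j --> G] --> fine (L [set u | F (bit ^~ u)]))].
Proof.
move=> Fl; have [|[mL _] [mP _] h] := @bitP (fun b => (F b)%:R) l.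
  by move=> b b' bb'; rewrite (Fl _ _ bb').
have mset d' (X : measurableType d') (g : X -> bool) :
    measurable_fun setT (fun x => (g x)%:R : R) -> measurable [set x | g x].
  move=> mg; rewrite (_ : [set x | g x] = (fun x => (g x)%:R : R) @^-1` [set 1]).
    by rewrite -[X in measurable X]setTI; exact: mg.
  apply/seteqP; split=> x /=; first by move=> ->.
  by case: (g x) => // /eqP; rewrite eq_sym oner_eq0.
have iE d' (X : measurableType d') (Q : probability X R) (g : X -> bool) :
    measurable_fun setT (fun x => (g x)%:R : R) ->
    (\int[Q]_x (g x)%:R = fine (Q [set x | g x]))%R.
  move=> mg; rewrite -[X in fine (Q X)]setIT /Rintegral -integral_indic//; last exact: mset.
  congr fine; apply: eq_integral => x _; rewrite indicE; congr (_%:R%:E); congr nat_of_bool.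
  by apply/idP/idP => [|/set_mem//]; move=> ?; apply/mem_set.
split; [exact: mset|exact: mset|].
move: h; rewrite iE//.
by under eq_fun do rewrite iE//.
Qed.

Let FL : Filter (almost_everywhere L) := ae_filter_ringOfSetsType L.

(* The finite joint laws of the bits make them almost surely the rational cuts of
   real numbers; tightness rules out the cuts at infinity. *)
Let bit_decreasing : {ae L, forall u, forall i q q', q < q' ->
  bit (key i q') u -> bit (key i q) u}.
Proof.
have h (t : 'I_n * rat * rat) : {ae L, forall u, t.1.2 < t.2 ->
    bit (key t.1.1 t.2) u -> bit (key t.1.1 t.1.2) u}.
  case: t => [[i q] q'] /=; have [qq'|qq'] := pselect (q < q'); last by apply: aeW => u /qq'.
  pose l := maxn (key i q) (key i q').
  have [|mL mP h] := @bitI (fun b => b (key i q') && ~~ b (key i q)) l.+1.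
    by move=> b b' bb'; rewrite !bb'// ltnS ?leq_maxl ?leq_maxr.
  exists [set u | bit (key i q') u && ~~ bit (key i q) u]; split=> //.
    have P0 j : fine (P j [set y | code y (key i q') && ~~ code y (key i q)]) = 0.
      rewrite (_ : [set _ | _] = set0) ?measure0//; apply/seteqP; split=> y //=.
      rewrite !codeE -leNgt => /andP[y1 y2]; have := lt_le_trans y1 y2.
      by rewrite ltr_rat ltNge (ltW qq').
    rewrite -[LHS]fineK ?fin_num_measure//; congr EFin.
    rewrite -(cvg_lim (@Rhausdorff R) h); under eq_fun do rewrite P0.
    exact: lim_cst.
  by move=> u /= /not_implyP[_ /not_implyP[-> /negP]].
have H : {ae L, forall u, forall k (t : 'I_n * rat * rat), unpickle k = Some t -> t.1.2 < t.2 ->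
    bit (key t.1.1 t.2) u -> bit (key t.1.1 t.1.2) u}.
  apply: ae_foralln => k.
  case: (unpickle k) => [t|]; last exact: aeW.
  by apply: (@filterS _ _ FL _ _ _ (h t)) => u hu _ [<-].
apply: (@filterS _ _ FL _ _ _ H) => u hu i q q' qq'.
by have := hu (pickle (i, q, q')) (i, q, q') (pickleK _) qq'.
Qed.

(** Bits equal to [c] at all [far c m] would describe the cut at plus infinity for [c = true] and at
    minus infinity for [c = false]. *)
Let far (c : bool) m : rat := if c then m.+1%:R else - m.+1%:R.

Let bit_tail i c : {ae L, forall u, exists m, bit (key i (far c m)) u != c}.
Proof.
pose B m := [set u : measurableTypeR R | bit (key i (far c m)) u == c].
have dep m (b b' : nat -> bool) : (forall k, (k < (key i (far c m)).+1)%N -> b k = b' k) ->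
    (b (key i (far c m)) == c) = (b' (key i (far c m)) == c) by move=> ->.
have bP m := bitI (dep m).
have mB m : measurable (B m) by have [] := bP m.
exists (\bigcap_m B m); split; first exact: bigcapT_measurable.
  apply/eqP; rewrite eq_le measure_ge0 andbT; apply/lee_addgt0Pr => e e0; rewrite add0e.
  have [r hr] := tight i e0; near (\oo : set_system nat) => m.
  have rm : r <= m%:R by apply: ltW; near: m; exact: nbhs_infty_gtr.
  rewrite (@le_trans _ _ (L (B m)))//.
    by apply: le_measure; rewrite ?inE//; [exact: bigcapT_measurable|exact: bigcap_inf].
  have [_ mP h] := bP m.
  rewrite -[leLHS]fineK ?fin_num_measure// lee_fin -[leLHS](cvg_lim (@Rhausdorff R) h).
  apply: limr_le; first by apply/cvg_ex; eexists; exact: h.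
  apply: Goo; apply: filterS hr => j; rewrite -lee_fin fineK ?fin_num_measure//.
  apply: le_trans; apply: le_measure; rewrite ?inE//; first exact: mbad.
  (* A false bit only gives the weak bound [y <= - (m + 1)]; the shift by one turns it into the
     strict inequality that [bad] asks for. *)
  move=> y /=; rewrite codeE /far; case: (c); rewrite /= ?eqb_id ?eqbF_neg ?rmorphN rmorph_nat -natr1 => yc.
    by rewrite (le_lt_trans rm)// (lt_le_trans _ (ler_norm _))//; lra.
  rewrite (le_lt_trans rm)// -normrN (lt_le_trans _ (ler_norm _))//.
  by move: yc; rewrite -leNgt; lra.
move=> u /= /forallNP h m _; rewrite /B/=; apply/negPn/negP => /h.
exact.
Unshelve. all: by end_near.
Qed.

(** The bit at a rational equal to [Y] is left open: passing to the limit preserves the monotonicity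
    of the bits but not their one-sided continuity. *)
Let is_cut u i Y := (forall q, ratr q < Y -> bit (key i q) u) /\
  (forall q, bit (key i q) u -> ratr q <= Y :> R).

Let cut_ae : {ae L, forall u, forall i, exists Y, is_cut u i Y}.
Proof.
have tails : {ae L, forall u, forall i c, exists m, bit (key i (far c m)) u != c}.
  have H : {ae L, forall u, forall k (t : 'I_n * bool), unpickle k = Some t ->
      exists m, bit (key t.1 (far t.2 m)) u != t.2}.
    apply: ae_foralln => k.
    case: (unpickle k) => [t|]; last exact: aeW.
    by apply: (@filterS _ _ FL _ _ _ (bit_tail t.1 t.2)) => u hu _ [<-].
  by apply: (@filterS _ _ FL _ _ _ H) => u hu i c; have := hu (pickle (i, c)) (i, c) (pickleK _).
apply: (@filterS2 _ _ FL _ _ _ _ bit_decreasing tails) => u dec tl i.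
pose S : set R := [set ratr q | q in [set q | bit (key i q) u]].
have supS : has_sup S.
  split.
    have [m] := tl i false; rewrite eqbF_neg negbK => b.
    by exists (ratr (far false m)), (far false m).
  have [m] := tl i true; rewrite eqb_id => b.
  exists (ratr (far true m)) => _ [q bq <-]; rewrite leNgt; apply/negP; rewrite ltr_rat => qm.
  by move: b; rewrite (dec _ _ _ qm bq).
exists (sup S); split=> q => [qS|bq]; last by apply: ub_le_sup; [exact: supS.2|exists q].
have d0 : 0 < sup S - ratr q by rewrite subr_gt0.
have [_ [q' bq' <-]] := sup_adherent d0 supS.
by rewrite opprB addrC subrK ltr_rat => qq'; exact: dec qq' bq'.
Qed.

Lemma limit_law : exists Q : probability V R, forall x, cf Q x = phi x.
Proof.
have [N [mN LN0 subN]] := cut_ae.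
(* Setting the grids to 0 on the null set makes them converge everywhere, so that the limit is a
   measurable function. *)
pose Z k u : V := \1_(~` N) u *: grid k (bit ^~ u).
have mZ k : measurable_fun setT (Z k : measurableTypeR R -> V).
  apply: measurable_rV => i; under eq_fun do rewrite mxE.
  apply: measurable_funM; first exact/measurable_indic/measurableC.
  have [|[? _] _ _] // := @bitP (fun b => grid k b ord0 i) (depth k).
  by move=> b b' bb'; rewrite (grid_dep bb').
have cZ u i : cvgn (fun k => (Z k u : 'rV[R]_n) ord0 i).
  have [Nu|Nu] := pselect (N u).
    apply/cvg_ex; exists 0; under eq_fun do rewrite mxE indicE memNset//= mul0r.
    exact: cvg_cst.
  have [Y [Y1 Y2]] : exists Y, is_cut u i Y.
    by apply: contrapT => nY; apply: Nu; apply: subN => /= h; exact/nY/h.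
  apply/cvg_ex; exists Y; under eq_fun do rewrite mxE indicE mem_set//= mul1r.
  apply/cvgrPdist_le => e e0; near=> k.
  rewrite distrC (le_trans (grid_approx _ Y1 Y2))//.
    by apply: ltW; near: k; exact: nbhs_infty_gtr.
  rewrite invf_ple ?posrE// (@le_trans _ _ k%:R) ?ler_nat//.
  by apply: ltW; near: k; exact: nbhs_infty_gtr.
pose Y u : V := \row_i limn (fun k => (Z k u : 'rV[R]_n) ord0 i).
have mY : measurable_fun setT (Y : measurableTypeR R -> V).
  apply: measurable_rV => i; under eq_fun do rewrite mxE.
  apply: (measurable_fun_cvg (h := fun k u => (Z k u : 'rV[R]_n) ord0 i)) => [k|u _].
    exact: (measurableT_comp (measurable_coord i) (mZ k)).
  exact: cZ.
have [Q QE] := image_probability mY L.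
exists Q => x.
have -> : cf Q x = cintegral L (fun u => expi (dot (Y u) x)).
  by apply: (image_expi mY) => [B _|]; [exact: QE|exact: measurable_dot].
(* The integrals of [f (dot (Z k u) x)] have both sides as limit: the left one by bounded
   convergence, and [A] by [grid_cvg], as [Z k] and the grid agree almost surely. *)
have key_lim f A : test f -> (\int[P j]_y f (dot y x) @[j --> \oo] --> A)%R ->
    (\int[L]_u f (dot (Y u) x) = A)%R.
  move=> tf fA; have [cf f1 _] := tf.
  have mf (W : measurableTypeR R -> V) : measurable_fun setT W ->
      measurable_fun setT (fun u => f (dot (W u) x)).
    by move=> mW; apply: (measurableT_comp (test_mbounded x tf).1).
  have h1 := @Rintegral_bounded_cvg _ _ _ L (fun k u => f (dot (Z k u) x))
    (fun u => f (dot (Y u) x)) 1 (fun k => mf _ (mZ k)) (fun k u => f1 _).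
  apply: (cvg_unique (@Rhausdorff R) (h1 _)) => [u|/=].
    apply: (continuous_cvg _ (cf _)); apply: cvg_big => [|i _]; first exact: add_continuous.
    by rewrite mxE; apply: cvgM; [exact: cZ|exact: cvg_cst].
  have := grid_cvg tf fA.
  have -> // : (fun k => \int[L]_u f (dot (grid k (bit ^~ u)) x))%R =
    (fun k => \int[L]_u f (dot (Z k u) x))%R.
  apply/funext => k; congr fine; have [[mg _] _ _] := grid_test x k tf.
  apply: ae_eq_integral => //; [exact/measurable_EFinP|apply/measurable_EFinP; exact: (mf _ (mZ k))|].
  exists N; split=> // u /= h; apply: contrapT => Nu; apply: h => _.
  by rewrite /Z indicE mem_set// scale1r.
apply: complex_eq; rewrite cintegral_expi/=.
- apply: (key_lim cos).
    by split; [exact: continuous_cos|exact: cos_max|exact: cos_lipschitz].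
  by have := @cvg_Re x; under eq_fun do rewrite /cf cintegral_expi/=.
- apply: (key_lim sin).
    by split; [exact: continuous_sin|exact: sin_max|exact: sin_lipschitz].
  by have := @cvg_Im x; under eq_fun do rewrite /cf cintegral_expi/=.
Unshelve. all: by end_near.
Qed.

End limit.

Lemma tight_levy_continuity : exists Q : probability V R, forall x, cf Q x = phi x.
Proof.
have [G [UG Goo]] := @ultraFilterLemma nat \oo _.
have [L [bit h]] := ultralimit_bits P UG mC.
exact: (limit_law UG Goo h).
Qed.

End levy_continuity.

Section Rintegral_fubini.
Context d1 d2 (X : measurableType d1) (Y : measurableType d2) (R : realType).
Variables (P1 : probability X R) (P2 : probability Y R) (g : X * Y -> R).
Hypothesis bg : mbounded g.

Let P12 : probability (X * Y)%type R := (P1 \x P2)%E.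

Let ig : P12.-integrable setT (EFin \o g). Proof. exact: mbounded_integrable. Qed.

Let b1 x : mbounded (fun y => g (x, y)).
Proof.
have [mg [C gC]] := bg; split; last by exists C.
exact: (measurableT_comp mg (pair1_measurable x)).
Qed.

Let b2 y : mbounded (fun x => g (x, y)).
Proof.
have [mg [C gC]] := bg; split; last by exists C.
exact: (measurableT_comp mg (pair2_measurable y)).
Qed.

Lemma measurable_Rintegral : measurable_fun setT (fun x => \int[P2]_y g (x, y))%R.
Proof.
apply/measurable_EFinP; have := measurable_fubini_F ig.
apply: eq_measurable_fun => x _; rewrite /fubini_F/= fineK//.
by apply: integrable_fin_num => //; exact: mbounded_integrable.
Qed.

Lemma Rintegral_fubini : (\int[P1]_x (\int[P2]_y g (x, y)) = \int[P2]_y (\int[P1]_x g (x, y)))%R.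
Proof.
have := Fubini ig.
under eq_integral => x _ do rewrite /= -(fineK (integrable_fin_num measurableT (mbounded_integrable P2 (b1 x)))).
under [in RHS]eq_integral => y _ do rewrite /= -(fineK (integrable_fin_num measurableT (mbounded_integrable P1 (b2 y)))).
by move=> E; rewrite /Rintegral E.
Qed.

End Rintegral_fubini.

Lemma Rintegral_norm_le d (T : measurableType d) (R : realType) (P : probability T R)
    (f : T -> R) C : mbounded f -> (forall x, `|f x| <= C) -> `|\int[P]_x f x|%R <= C.
Proof.
move=> bf fC; rewrite (le_trans (le_normr_Rintegral _ (mbounded_integrable P bf)))//.
have -> : C = (\int[P]_x C)%R.
  by rewrite Rintegral_cst// [X in fine X]probability_setT mulr1.
apply: le_Rintegral => //.
- exact: (integrable_norm (mbounded_integrable P bf)).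
- by apply: mbounded_integrable; split=> //; exists `|C|.
Qed.

(** * Tightness from continuity at zero *)

Section tightness.
Context (R : realType).
Variable L : probability (measurableTypeR R) R.
Hypothesis LE : forall A, L A = lebesgue_measure (A `&` `[0, 1[%classic).

(** A uniform variable on [0, 1[, cut off so as to be bounded on all of R. The kernel [c s] below is
    the average of [cos (s u)] over [0, 1], that is [sin s / s]. *)
Let v (u : R) : R := \1_(`[0, 1[%classic) u * u.

Let v01 u : 0 <= v u <= 1.
Proof.
rewrite /v indicE; have [/set_mem/=|] := boolP (u \in _); last by rewrite mul0r lexx ler01.
by rewrite in_itv/= mul1r => /andP[-> /ltW].
Qed.

Let mv : measurable_fun setT (v : measurableTypeR R -> R).
Proof. by apply: measurable_funM => //; exact: measurable_indic. Qed.

Let c (s : R) : R := (\int[L]_u cos (s * v u))%R.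

Let bcos s : mbounded (fun u : measurableTypeR R => cos (s * v u)).
Proof. by apply: mbounded_cos; exact: measurable_funM. Qed.

Let c_le1 s : `|c s| <= 1.
Proof. by apply: Rintegral_norm_le; [exact: bcos|move=> u; exact: cos_max]. Qed.

Let cE s : s != 0 -> c s = sin s / s.
Proof.
move=> s0; pose D : set (measurableTypeR R) := `[0, 1[%classic.
have mD : measurable D by exact: measurable_itv.
have LD0 : L (~` D) = 0 by rewrite LE setICl measure0.
rewrite /c /Rintegral.
rewrite (negligible_integral (measurableC mD) measurableT (mbounded_integrable L (bcos s)) LD0).
rewrite setTD setCK.
rewrite (eq_measure_integral (@lebesgue_measure R)) => [|A mA AD]; last first.
  by apply: (etrans (LE A)); congr (lebesgue_measure _); apply/setIidPl.
transitivity (fine (\int[@lebesgue_measure R]_(u in D) (cos (s * u))%:E)%E).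
  by congr fine; apply: eq_integral => u uD; rewrite /= /v indicE uD mul1r.
have mc : measurable_fun setT (fun u : R => cos (s * u)).
  by apply: (measurableT_comp (continuous_measurable_fun (@continuous_cos R))); exact: measurable_funM.
rewrite integral_itv_bndo_bndc; last by apply/measurable_EFinP; exact: measurable_funS mc.
have dF (x : R) : is_derive x 1 (fun u : R => sin (s * u) / s) (cos (s * x)).
  have h1 : is_derive x 1 (fun u : R => s * u) s.
    have := is_deriveZ s (is_derive_id x 1).
    by rewrite /GRing.scale/= mulr1.
  have h2 := is_deriveZ s^-1 (is_derive1_comp (is_derive_sin (s * x)) h1).
  have h3 := is_derive_eq h2 (_ : s^-1 *: (cos (s * x) * s) = cos (s * x)).
  rewrite (_ : (fun u => sin (s * u) / s) = s^-1 \*: (sin \o (fun u => s * u))).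
    by apply: h3; rewrite /GRing.scale/=; field.
  by apply/funext => u /=; rewrite /GRing.scale/= mulrC.
have cF : continuous (fun u : R => sin (s * u) / s).
  by move=> x; apply/differentiable_continuous/derivable1_diffP; have [] := dF x.
have ccos : continuous (fun u : R => cos (s * u)).
  move=> x; apply: continuous_comp; last exact: continuous_cos.
  by apply: cvgM; [exact: cvg_cst|exact: cvg_id].
rewrite (@continuous_FTC2 _ _ (fun u => sin (s * u) / s)) ?mulr1 ?mulr0 ?sin0 ?mul0r ?sube0//.
- exact: continuous_subspaceT.
- split=> [x _||]; first by have [] := dF x.
    by apply: cvg_at_right_filter; exact: cF.
  by apply: cvg_at_left_filter; exact: cF.
- by move=> x _; rewrite derive1E; have [_ ->] := dF x.
Qed.

Let c_le s : 2 <= `|s| -> c s <= 2^-1.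
Proof.
move=> s2; have s0 : s != 0 by rewrite -normr_gt0; lra.
rewrite cE// (le_trans (ler_norm _))// normrM normfV ler_pdivrMr ?normr_gt0//.
by rewrite (le_trans (sin_max _))//; lra.
Qed.

Variable n : nat.
Local Notation V := (borel 'rV[R]_n).
Variables (P : nat -> probability V R) (phi : 'rV[R]_n -> R).
Hypothesis cvg_phi : forall x, (\int[P j]_y cos (dot y x) @[j --> \oo] --> phi x)%R.

Lemma cf_tight i : phi (t *: delta_mx ord0 i) @[t --> (0 : R)] --> (1 : R) ->
  forall e, 0 < e -> exists r : R,
  \forall j \near \oo, (P j [set y : V | (r < `|(y : 'rV[R]_n) ord0 i|)%R] <= e%:E)%E.
Proof.
move=> /cvgrPdist_le cphi e e0.
(* Budget: the averages have a limit of at least [1 - e / 4], hence are eventually at least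
   [1 - e / 2], and the mass far out is at most twice the deficit. *)
have e4 : 0 < e / 4 by lra.
have /nbhs_ballP[d0 /= d00 d0P] := cphi _ e4.
pose d := d0 / 2; have d_gt0 : 0 < d by rewrite /d; lra.
have phid u : 1 - e / 4 <= phi ((d * v u) *: delta_mx ord0 i).
  have /andP[v0 v1] := v01 u; have dv0 : 0 <= d * v u by rewrite mulr_ge0// ltW.
  have : `|1 - phi ((d * v u) *: delta_mx ord0 i)| <= e / 4.
    apply: d0P; rewrite /ball/= sub0r normrN ger0_norm//.
    by rewrite (@le_lt_trans _ _ d)//; [rewrite ler_piMr// ltW|rewrite /d; lra].
  by rewrite ler_norml => /andP[_]; lra.
have dotE (y : V) t : dot y (t *: delta_mx ord0 i) = t * (y : 'rV[R]_n) ord0 i.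
  by rewrite dotC dotZl dotC dot_delta.
pose g (z : measurableTypeR R * V) : R := cos ((d * v z.1) * (z.2 : 'rV[R]_n) ord0 i).
have bg : mbounded g.
  apply: mbounded_cos; apply: measurable_funM.
    by apply: measurable_funM => //; apply: (measurableT_comp mv); exact: measurable_fst.
  by apply: (measurableT_comp (measurable_coord i)); exact: measurable_snd.
pose h j : R := (\int[L]_u \int[P j]_y g (u, y))%R.
(* In one order the double integral averages the characteristic functions, whose limit is known; in
   the other it integrates the kernel [c] against [P j]. *)
have hc j : h j = (\int[P j]_y c (d * (y : 'rV[R]_n) ord0 i))%R.
  transitivity (\int[P j]_y (\int[L]_u g (u, y)))%R; first exact: (Rintegral_fubini L (P j) bg).
  apply: eq_Rintegral => y _; apply: eq_Rintegral => u _.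
  by rewrite /g/=; congr cos; ring.
have mh j : measurable_fun setT (fun u : measurableTypeR R => \int[P j]_y g (u, y))%R.
  exact: (measurable_Rintegral L (P j) bg).
have h1 j (u : measurableTypeR R) : `|\int[P j]_y g (u, y)|%R <= 1.
  apply: Rintegral_norm_le => [|y]; last exact: cos_max.
  exact: (mbounded_cos (measurable_funM (measurable_cst (d * v u)) (measurable_coord i))).
have hl (u : measurableTypeR R) :
    (\int[P j]_y g (u, y) @[j --> \oo] --> phi ((d * v u) *: delta_mx ord0 i))%R.
  rewrite /g/=; under eq_fun do under eq_Rintegral do rewrite -dotE.
  exact: cvg_phi.
have bphi := cvg_mbounded mh h1 hl.
have hcvg : h j @[j --> \oo] --> (\int[L]_u phi ((d * v u) *: delta_mx ord0 i))%R.
  exact: (Rintegral_bounded_cvg mh h1 hl).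
have int_ge : 1 - e / 4 <= (\int[L]_u phi ((d * v u) *: delta_mx ord0 i))%R.
  have -> : 1 - e / 4 = (\int[L]_u (1 - e / 4))%R.
    by rewrite Rintegral_cst// [X in fine X]probability_setT mulr1.
  apply: le_Rintegral => //; first by apply: mbounded_integrable; split=> //; exists `|1 - e / 4|.
  exact: (mbounded_integrable L bphi).
(* [1 - c (d * s)] is nonnegative and at least 1/2 for [2 <= d * `|s|], so the
   mass far out is controlled by the average of [1 - phi] near 0. *)
have hlarge : \forall j \near \oo, 1 - e / 2 <= h j.
  have h0 : 0 < e / 4 by [].
  apply: filterS (cvgr_ge _ hcvg (1 - e / 2) _) => //; first by lra.
exists (2 / d); apply: filterS hlarge => j hj.
pose B := [set y : V | 2 / d < `|(y : 'rV[R]_n) ord0 i|].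
have mB : measurable B.
  rewrite (_ : B = (fun y : V => `|(y : 'rV[R]_n) ord0 i|) @^-1` `]2 / d, +oo[%classic).
    rewrite -[X in measurable X]setTI; apply: (measurableT_comp _ (measurable_coord i)) => //.
  by apply/seteqP; split=> y /=; rewrite in_itv/= andbT.
have bB : mbounded (fun y : V => 1 - 2^-1 * \1_B y : R).
  split; last first.
    exists 1 => y; rewrite indicE; case: (_ \in _); rewrite /= ?mulr1 ?mulr0 ?subr0 ?normr1//.
    by rewrite ger0_norm; lra.
  by apply: measurable_funB => //; apply: measurable_funM => //; exact: measurable_indic.
have bc : mbounded (fun y : V => c (d * (y : 'rV[R]_n) ord0 i)).
  split; last by exists 1.
  pose g' (z : V * measurableTypeR R) : R := cos ((d * (z.1 : 'rV[R]_n) ord0 i) * v z.2).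
  apply: (measurable_Rintegral (P j) L (g := g')); apply: mbounded_cos; apply: measurable_funM.
    by apply: measurable_funM => //; apply: (measurableT_comp (measurable_coord i)); exact: measurable_fst.
  by apply: (measurableT_comp mv); exact: measurable_snd.
have : h j <= (\int[P j]_y (1 - 2^-1 * \1_B y))%R.
  rewrite hc; apply: le_Rintegral => //.
  - exact: (mbounded_integrable (P j) bc).
  - exact: mbounded_integrable.
  - move=> y _; rewrite indicE; have [/set_mem By|_] := boolP (y \in B); last first.
      by rewrite mulr0 subr0 (le_trans (ler_norm _))// c_le1.
    rewrite mulr1; have : c (d * (y : 'rV[R]_n) ord0 i) <= 2^-1; last by lra.
    by apply: c_le; rewrite normrM gtr0_norm// mulrC -ler_pdivrMr// ltW.
have -> : (\int[P j]_y (1 - 2^-1 * \1_B y))%R = 1 - 2^-1 * fine (P j B).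
  have i1 : (P j).-integrable setT (EFin \o (\1_B : V -> R)).
    apply: mbounded_integrable; split; first exact: measurable_indic.
    by exists 1 => y; rewrite indicE; case: (_ \in _); rewrite ?normr1 ?normr0.
  have i2 : (P j).-integrable setT (EFin \o (fun y : V => 2^-1 * \1_B y)).
    exact: (integrableZl measurableT _ i1).
  rewrite RintegralB//; last by apply: mbounded_integrable; split=> //; exists `|1|.
  rewrite Rintegral_cst// [X in 1 * fine X]probability_setT mulr1 RintegralZl//.
  by rewrite /Rintegral integral_indic// setIT.
move=> hB; rewrite -[X in (X <= _)%E]fineK ?fin_num_measure// lee_fin.
by move: hj hB; rewrite -/B; lra.
Qed.

End tightness.

Section levy_continuity.
Context (R : realType) (n : nat).
Local Notation V := (borel 'rV[R]_n).
Variables (P : nat -> probability V R) (phi : 'rV[R]_n -> R[i]).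

(** Continuity at 0 is asked along the coordinate axes, since tightness is checked one coordinate at
    a time. *)
Theorem levy_continuity :
  (forall x, complex.Re (cf (P j) x) @[j --> \oo] --> complex.Re (phi x)) ->
  (forall x, complex.Im (cf (P j) x) @[j --> \oo] --> complex.Im (phi x)) ->
  (forall i, complex.Re (phi (t *: delta_mx ord0 i)) @[t --> (0 : R)] --> (1 : R)) ->
  exists Q : probability V R, forall x, cf Q x = phi x.
Proof.
move=> cRe cIm cphi; apply: (@tight_levy_continuity _ _ P) => // i e e0.
have [L LE] := unit_lebesgue R.
apply: (cf_tight LE (phi := fun x => complex.Re (phi x))) e0 => // x.
by have := @cRe x; under eq_fun do rewrite /cf cintegral_expi/=.
Qed.

End levy_continuity.

(** * Roots of infinitely divisible laws *)

Section complex_norm1.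
Context {R : realType}.
Implicit Types (z w : R[i]).

(* The library norm on [R[i]] takes its values in [R[i]]. *)
Definition cnorm1 z : R := `|complex.Re z| + `|complex.Im z|.

Lemma cnorm1_ge0 z : 0 <= cnorm1 z. Proof. by rewrite addr_ge0. Qed.

Lemma cnorm1D z w : cnorm1 (z + w) <= cnorm1 z + cnorm1 w.
Proof. by rewrite /cnorm1 ReD ImD addrACA lerD// ler_normD. Qed.

Lemma cnorm1M z w : cnorm1 (z * w) <= cnorm1 z * cnorm1 w.
Proof.
rewrite /cnorm1 ReM ImM; set a := complex.Re z; set b := complex.Im z.
set c := complex.Re w; set e := complex.Im w.
have h1 : `|a * c - b * e| <= `|a| * `|c| + `|b| * `|e|.
  by rewrite (le_trans (ler_normB _ _))// !normrM.
have h2 : `|a * e + b * c| <= `|a| * `|e| + `|b| * `|c|.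
  by rewrite (le_trans (ler_normD _ _))// !normrM.
by rewrite (le_trans (lerD h1 h2))//; lra.
Qed.

(** Telescoping. The power [K ^+ n] in place of [n - 1] is affordable because [1 <= K], and it
    avoids a special case for [n = 0]. *)
Lemma cnorm1_exprB z w (K : R) n : 1 <= K -> cnorm1 z <= K -> cnorm1 w <= K ->
  cnorm1 (z ^+ n - w ^+ n) <= n%:R * K ^+ n * cnorm1 (z - w).
Proof.
move=> K1 zK wK; have K0 : 0 <= K by rewrite (le_trans _ K1).
have zn k : cnorm1 (z ^+ k) <= K ^+ k.
  elim: k => [|k IH]; first by rewrite !expr0 /cnorm1/= normr1 normr0 addr0.
  by rewrite !exprS (le_trans (cnorm1M _ _))// ler_pM// cnorm1_ge0.
elim: n => [|n IH]; first by rewrite !expr0 subrr mul0r mul0r /cnorm1/= normr0 addr0.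
have -> : z ^+ n.+1 - w ^+ n.+1 = z ^+ n * (z - w) + (z ^+ n - w ^+ n) * w.
  by rewrite !exprSr; ring.
rewrite (le_trans (cnorm1D _ _))//.
have h1 : cnorm1 (z ^+ n * (z - w)) <= K ^+ n.+1 * cnorm1 (z - w).
  rewrite (le_trans (cnorm1M _ _))// ler_wpM2r ?cnorm1_ge0// (le_trans (zn n))//.
  by rewrite exprS ler_peMl// exprn_ge0.
have h2 : cnorm1 ((z ^+ n - w ^+ n) * w) <= n%:R * K ^+ n.+1 * cnorm1 (z - w).
  rewrite (le_trans (cnorm1M _ _))// exprSr mulrA mulrAC ler_pM// ?cnorm1_ge0//.
by rewrite (le_trans (lerD h1 h2))// -natr1; lra.
Qed.

Lemma cnorm1_cexp_sub z : cnorm1 z <= 2^-1 ->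
  cnorm1 (1 + z - cexp z) <= 4 * cnorm1 z ^+ 2.
Proof.
case: z => x y; rewrite /cnorm1/= => xy.
have [x0 y0] : 0 <= `|x| /\ 0 <= `|y| by [].
have x1 : `|x| <= 2^-1 by lra.
have ex : `|expR x| <= 2.
  have := expR_sub1_le x1; rewrite ler_norml => /andP[_ h].
  by rewrite gtr0_norm ?expR_gt0//; lra.
have hr : `|1 + x - expR x * cos y| <= 2 * y ^+ 2 + 2 * x ^+ 2.
  have -> : 1 + x - expR x * cos y = - (expR x * (cos y - 1) + (expR x - 1 - x)) by ring.
  rewrite normrN (le_trans (ler_normD _ _))// lerD ?expR_sub1_sub_le//.
  by rewrite normrM ler_pM// cos_sub1_le.
have hi : `|0 + y - expR x * sin y| <= 2 * y ^+ 2 + 2 * `|x| * `|y|.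
  have -> : 0 + y - expR x * sin y = - (expR x * (sin y - y) + (expR x - 1) * y) by ring.
  rewrite normrN (le_trans (ler_normD _ _))// lerD//.
    by rewrite normrM ler_pM// sin_sub_le.
  by rewrite normrM ler_wpM2r// expR_sub1_le.
rewrite (le_trans (lerD hr hi))//.
rewrite -(real_normK (num_real x)) -(real_normK (num_real y)); nra.
Qed.

Lemma cnorm1_cexp z : cnorm1 (cexp z) <= expR (cnorm1 z).
Proof.
case: z => x y; rewrite /cnorm1/= !normrM -mulrDr expRD.
rewrite ler_pM//; first by rewrite gtr0_norm ?expR_gt0// ler_expR ler_norm.
have := expR_ge1Dx `|y|; apply: le_trans; rewrite lerD ?cos_max ?norm_sin_le//.
Qed.

(** Both bases are bounded by [K = expR (r / N)], whose N-th power is [expR r]. Each of the N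
    factors contributes an error [4 * (r / N) ^+ 2], so one power of N survives in the
    denominator. *)
Lemma cexp_approx w (r : R) n : cnorm1 w <= r / n.+1%:R -> 2 * r <= n.+1%:R ->
  cnorm1 ((1 + w) ^+ n.+1 - cexp (w *+ n.+1)) <= 4 * r ^+ 2 * expR r / n.+1%:R.
Proof.
move=> wr rn; set N : R := n.+1%:R in wr rn *.
have N0 : 0 < N by rewrite /N.
have w2 : cnorm1 w <= 2^-1 by rewrite (le_trans wr)// ler_pdivrMr//; lra.
have w0 := cnorm1_ge0 w.
have K1 : 1 <= expR (r / N) by rewrite -expR0 ler_expR (le_trans w0).
have h1 : cnorm1 (1 + w) <= expR (r / N).
  rewrite (le_trans (cnorm1D _ _))// (le_trans _ (expR_ge1Dx _))// lerD//.
  by rewrite /cnorm1/= normr1 normr0 addr0.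
have h2 : cnorm1 (cexp w) <= expR (r / N).
  by rewrite (le_trans (cnorm1_cexp _))// ler_expR.
rewrite cexpMn (le_trans (cnorm1_exprB n.+1 K1 h1 h2))//.
rewrite -expRM_natr -/N divfK ?gt_eqF//.
have : cnorm1 (1 + w - cexp w) <= 4 * (r / N) ^+ 2.
  by rewrite (le_trans (cnorm1_cexp_sub w2))// ler_pM2l// lerXn2r ?nnegrE ?(le_trans w0).
move=> h; rewrite (le_trans (ler_wpM2l _ h))//; first by rewrite mulr_ge0// expR_ge0.
by rewrite le_eqVlt; apply/orP; left; apply/eqP; field; rewrite gt_eqF.
Qed.

End complex_norm1.

Section more_integrals.
Context d (T : measurableType d) (R : realType).

Lemma mbounded_integrable_lty (m : {measure set T -> \bar R}) (f : T -> R) :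
  (m setT < +oo)%E -> mbounded f -> m.-integrable setT (EFin \o f).
Proof.
move=> mT [mf [C fC]]; apply: measurable_bounded_integrable => //.
exists C; split; first exact: num_real.
by move=> M CM x _; rewrite /= (le_trans (fC x))// ltW.
Qed.

Lemma Rintegral_mscale (m : {measure set T -> \bar R}) (k : {nonneg R}) (f : T -> R) :
  m.-integrable setT (EFin \o f) ->
  mscale k m setT = (k%:num%:E * m setT)%E /\
  (\int[mscale k m]_x f x = k%:num * \int[m]_x f x)%R.
Proof.
move=> mf; split=> //; have mf' := measurable_int _ mf.
rewrite /Rintegral -[in RHS](fineK (integrable_fin_num measurableT mf)).
rewrite integralE ge0_integral_mscale//; last exact: measurable_funepos.
rewrite ge0_integral_mscale//; last exact: measurable_funeneg.
rewrite -muleBr//; last first.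
  by rewrite fin_num_adde_defl// fin_numN; exact: integrable_neg_fin_num.
rewrite -integralE fineM//; exact: integrable_fin_num.
Qed.

Lemma Rintegral_mrestr (m : {measure set T -> \bar R}) (D : set T) (mD : measurable D)
    (f : T -> R) : (m D < +oo)%E -> mbounded f ->
  (\int[mrestr m mD]_x f x = \int[m]_(x in D) f x)%R.
Proof.
move=> mDoo bf; have rT : (mrestr m mD setT < +oo)%E by rewrite /mrestr setTI.
have rD : mrestr m mD (~` D) = 0%E by rewrite /mrestr setICl measure0.
rewrite /Rintegral (negligible_integral (measurableC mD) measurableT (mbounded_integrable_lty rT bf) rD).
rewrite setTD setCK; congr fine; apply: eq_measure_integral => A mA AD.
by rewrite -[LHS]/(m (A `&` D)) setIidl.
Qed.

End more_integrals.

(** * Jump laws and their limits *)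

Section jump_law.
Context (R : realType) (n : nat).
Local Notation V := (borel 'rV[R]_n).
Context d (T : measurableType d) (nu : {measure set T -> \bar R}).
Variables (pr : T -> V) (mpr : measurable_fun setT pr).
Variables (D : set T) (mD : measurable D) (nuD : (nu D < +oo)%E).

(* A jump distributed as the image of [nu] restricted to [D], occurring with
   probability [q * nu D]. *)
Lemma jump_law (q : R) : 0 <= q -> q * fine (nu D) <= 1 ->
  exists B : probability V R, forall x,
    cf B x = 1 + ((q * \int[nu]_(u in D) (cos (dot (pr u) x) - 1)) +i*
                  (q * \int[nu]_(u in D) sin (dot (pr u) x)))%C%R.
Proof.
move=> q0 qM; set M := fine (nu D) in qM.
have nuDE : nu D = M%:E by rewrite fineK// ge0_fin_numE.
(* The remaining mass stays at the origin, where the characteristic exponential equals 1. *)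
pose z : V := (0 : 'rV[R]_n); pose p := 1 - q * M; have p0 : 0 <= p by rewrite subr_ge0.
have [lam lamE] := image_measure mpr (mrestr nu mD).
have lamT : lam setT = M%:E by rewrite lamE preimage_setT -nuDE /= /mrestr setTI.
pose m1 : {measure set V -> \bar R} := mscale (NngNum p0) (dirac z : {measure set V -> \bar R}).
pose m2 : {measure set V -> \bar R} := mscale (NngNum q0) lam.
have m1T : m1 setT = p%:E by rewrite /m1 /= /mscale/= diracT mule1.
have m2T : m2 setT = (q * M)%:E by rewrite /m2 /= /mscale/= lamT.
have sumT : measure_add m1 m2 setT = 1%E.
  by rewrite measure_addE m1T m2T -EFinD /p subrK.
have [B BE] := measure_probability sumT.
have BI (f : V -> R) : mbounded f ->
    (\int[B]_y f y = p * f z + q * \int[nu]_(u in D) f (pr u))%R.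
  move=> bf; have mf := (measurable_EFinP _ _).2 bf.1.
  have i1 : m1.-integrable setT (EFin \o f) by apply: mbounded_integrable_lty => //; rewrite m1T ltry.
  have i2 : m2.-integrable setT (EFin \o f) by apply: mbounded_integrable_lty => //; rewrite m2T ltry.
  have i3 : lam.-integrable setT (EFin \o f) by apply: mbounded_integrable_lty => //; rewrite lamT ltry.
  have i4 : (dirac z : {measure set V -> \bar R}).-integrable setT (EFin \o f).
    by apply: mbounded_integrable_lty => //; rewrite /= diracT ltry.
  have -> : (\int[B]_y f y = \int[measure_add m1 m2]_y f y)%R.
    by congr fine; apply: eq_set_function_integral => A _; exact: BE.
  rewrite /Rintegral integral_measure_add// fineD; [|exact: integrable_fin_num..].
  have [_] := Rintegral_mscale (NngNum p0) i4; rewrite {1}/Rintegral => ->.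
  have [_] := Rintegral_mscale (NngNum q0) i3; rewrite {1}/Rintegral => -> /=.
  congr (_ * _ + _ * _).
    by rewrite /Rintegral integral_dirac// diracT mul1e.
  rewrite /Rintegral (image_integral mpr (m := mrestr nu mD))//; last first.
  apply: (Rintegral_mrestr mD (f := f \o pr) nuD); have [_ [C fC]] := bf.
  split; last by exists C => u; exact: fC.
  exact: (measurableT_comp bf.1 mpr).
exists B => x.
have mx : measurable_fun setT (fun u => dot (pr u) x).
  exact: (measurableT_comp (measurable_dot x) mpr).
have iD (f : T -> R) : mbounded f -> nu.-integrable D (EFin \o f).
  move=> [mf [C fC]]; apply: measurable_bounded_integrable => //; first exact: measurable_funS mf.
  exists C; split; first exact: num_real.
  by move=> K CK y _; rewrite /= (le_trans (fC y))// ltW.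
have z0 : dot z x = 0 := dot0l x.
rewrite /cf cintegral_expi; apply: complex_eq => /=.
- rewrite (BI _ (mbounded_cos (measurable_dot x))) /= z0 cos0 mulr1.
  rewrite RintegralB//; last 2 first.
  + exact: (iD _ (mbounded_cos mx)).
  + by apply: iD; split=> //; exists `|1|.
  by rewrite Rintegral_cst// -/M /p mul1r; ring.
- by rewrite (BI _ (mbounded_sin (measurable_dot x))) /= z0 sin0 mulr0.
Qed.

End jump_law.

Lemma Rintegral_dominated_cvg d (T : measurableType d) (R : realType)
    (m : {measure set T -> \bar R}) (u : nat -> T -> R) (f g : T -> R) :
  (forall n, measurable_fun setT (u n)) -> measurable_fun setT f ->
  m.-integrable setT (EFin \o g) ->
  (forall n x, `|u n x| <= g x) -> (forall x, u ^~ x @ \oo --> f x) ->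
  m.-integrable setT (EFin \o f) /\
  (\int[m]_x u n x @[n --> \oo] --> \int[m]_x f x)%R.
Proof.
move=> mu mf ig ug uf.
have [|||||itf _ h] := @dominated_convergence _ _ _ m setT measurableT
  (fun n => EFin \o u n) (EFin \o f) (EFin \o g).
- by move=> n; exact/measurable_EFinP.
- exact/measurable_EFinP.
- by apply: aeW => x _; apply: cvg_EFin; [exact: nearW|exact: uf].
- exact: ig.
- by apply: aeW => x n _; rewrite /= lee_fin.
split=> //; apply: fine_cvg; rewrite fineK//.
exact: integrable_fin_num.
Qed.

Lemma Rintegral_exhaustion_cvg d (T : measurableType d) (R : realType)
    (m : {measure set T -> \bar R}) (S : nat -> set T) (f : T -> R) :
  (forall n, measurable (S n)) -> nondecreasing_seq S -> \bigcup_n S n = setT ->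
  m.-integrable setT (EFin \o f) ->
  (\int[m]_(x in S n) f x @[n --> \oo] --> \int[m]_x f x)%R.
Proof.
move=> mS nS US fi; have mf : measurable_fun setT f by apply/measurable_EFinP; exact: measurable_int fi.
under eq_fun do rewrite Rintegral_mkcond.
apply: (@Rintegral_dominated_cvg _ _ _ _ _ _ (fun x => `|f x|) _ mf _ _ _).2 => [n||n x|x].
- apply/(measurable_restrictT _ (mS n)); exact: measurable_funS mf.
- exact: integrable_norm.
- by rewrite /patch; case: ifPn => // _; rewrite normr0.
- have [n _ Snx] : (\bigcup_n S n) x by rewrite US.
  apply: cvg_near_cst; exists n => // k /= nk; rewrite /patch mem_set//.
  by have /subsetPset := nS _ _ nk; exact.
Qed.

Lemma Rintegral_lincomb d (T : measurableType d) (R : realType) (m : {measure set T -> \bar R})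
    (D : set T) (I : finType) (f : I -> T -> R) (x : I -> R) : measurable D ->
  (forall i, m.-integrable D (EFin \o f i)) ->
  m.-integrable D (EFin \o (fun u => \sum_i f i u * x i)) /\
  (\int[m]_(u in D) (\sum_i f i u * x i) = \sum_i (\int[m]_(u in D) f i u) * x i)%R.
Proof.
move=> mD fi; have fxi i : m.-integrable D (EFin \o (fun u => f i u * x i)).
  exact: (integrableZr mD (x i) (fi i)).
elim: (index_enum I) => [|i s [IH1 IH2]].
  split; last by rewrite big_nil; under eq_Rintegral do rewrite big_nil; rewrite Rintegral_cst// mul0r.
  rewrite (_ : _ \o _ = cst 0%E); first exact: integrable0.
  by apply/funext => u; rewrite /= big_nil.
rewrite (_ : (fun u => \sum_(l <- i :: s) f l u * x l) =
    (fun u => f i u * x i + \sum_(l <- s) f l u * x l)); last first.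
  by apply/funext => u; rewrite big_cons.
split; first exact: (integrableD mD (fxi i) IH1).
by rewrite RintegralD// IH2 big_cons RintegralZr.
Qed.

Section levy_root.
Context (R : realType) (n : nat).
Local Notation V := (borel 'rV[R]_n).
Context d (T : measurableType d) (nu : {measure set T -> \bar R}).
Variables (pr co : T -> V).
Hypotheses (mpr : measurable_fun setT pr) (mco : measurable_fun setT co).
Hypothesis (bco : forall x, exists C, forall u, `|dot (co u) x| <= C).
Variable S : nat -> set T.
Hypotheses (mS : forall j, measurable (S j)) (nS : nondecreasing_seq S)
  (US : \bigcup_j S j = setT) (nuS : forall j, (nu (S j) < +oo)%E).

Let fR x u : R := cos (dot (pr u) x) - 1.
Let fI x u : R := sin (dot (pr u) x) - dot (co u) x.

Hypothesis iR : forall x, nu.-integrable setT (EFin \o fR x).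
Hypothesis iI : forall x, nu.-integrable setT (EFin \o fI x).

(** The integrals are kept on [T] and not pushed to R^n because the compensator [co] involves the
    unit ball of U, which the projection [pr] does not see. The real factor [k] is later the
    reciprocal of the convolution power. *)
Let Psi x : R[i] := ((\int[nu]_u fR x u) +i* (\int[nu]_u fI x u))%C%R.

Variable k : R.
Hypothesis k0 : 0 < k.
Hypothesis cont : forall i,
  complex.Re (cexp (k%:C%C * Psi (t *: delta_mx ord0 i))) @[t --> (0 : R)] --> (1 : R).

Let PsiJ j x : R[i] := ((\int[nu]_(u in S j) fR x u) +i* (\int[nu]_(u in S j) fI x u))%C%R.

Let integrable_bounded j (f : T -> R) : mbounded f -> nu.-integrable (S j) (EFin \o f).
Proof.
move=> [mf [C fC]]; apply: measurable_bounded_integrable => //; first exact: measurable_funS mf.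
exists C; split; first exact: num_real.
by move=> K CK y _; rewrite /= (le_trans (fC y))// ltW.
Qed.

Let mdpr x : measurable_fun setT (fun u => dot (pr u) x).
Proof. exact: (measurableT_comp (measurable_dot x) mpr). Qed.

Let bdco x : mbounded (fun u => dot (co u) x).
Proof. by split=> //; exact: (measurableT_comp (measurable_dot x) mco). Qed.

Let integral_dot j x : (\int[nu]_(u in S j) dot (co u) x =
  \sum_i (\int[nu]_(u in S j) (co u : 'rV[R]_n) ord0 i) * x ord0 i)%R.
Proof.
have ic i : nu.-integrable (S j) (EFin \o (fun u => (co u : 'rV[R]_n) ord0 i)).
  apply: integrable_bounded; have [m [C h]] := bdco (delta_mx ord0 i).
  have E : (fun u => dot (co u) (delta_mx ord0 i)) = (fun u => (co u : 'rV[R]_n) ord0 i).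
    by apply/funext => u; rewrite dot_delta.
  by rewrite -E; split=> //; exists C.
exact: (Rintegral_lincomb (fun i => x ord0 i) (mS j) ic).2.
Qed.

Let integral_le j (f : T -> R) C : mbounded f -> (forall u, `|f u| <= C) ->
  `|\int[nu]_(u in S j) f u|%R <= C * fine (nu (S j)).
Proof.
move=> bf fC; have fi := integrable_bounded j bf.
rewrite (le_trans (le_normr_Rintegral _ fi))// -Rintegral_cst//.
apply: le_Rintegral => //; first exact: integrable_norm.
by apply: integrable_bounded; split=> //; exists `|C|.
Qed.

Let ReMn (z : R[i]) m : complex.Re (z *+ m) = complex.Re z *+ m.
Proof. by elim: m => //= m IH; rewrite !mulrS ReD IH. Qed.

Let ImMn (z : R[i]) m : complex.Im (z *+ m) = complex.Im z *+ m.
Proof. by elim: m => //= m IH; rewrite !mulrS ImD IH. Qed.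

(* The law of N+1 independent jumps of intensity [k nu / (N+1)] on [S j],
   translated by [- b]. *)
Let approximant j : exists Q : probability V R, forall x,
  cnorm1 (cf Q x - cexp (k%:C%C * PsiJ j x)) <= 2 / j.+1%:R.
Proof.
pose M := fine (nu (S j)); have M0 : 0 <= M by exact: fine_ge0.
(* The integrands [cos - 1] and [sin] are bounded by 2 and 1, hence [3 * M] in [cnorm1]. *)
pose r := 3 * (k * M).
(* The first bound makes the jump probability at most 1, the second admits [cexp_approx], and the
   third brings its error below [1 / j.+1]. *)
have [N hN] : exists N : nat, [/\ k * M <= N.+1%:R, 2 * r <= N.+1%:R &
    4 * r ^+ 2 * expR r * j.+1%:R <= N.+1%:R].
  near (\oo : set_system nat) => N; exists N.
  have NN : N%:R <= N.+1%:R :> R by rewrite ler_nat.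
  by split; apply: ltW; apply: lt_le_trans NN; near: N; exact: nbhs_infty_gtr.
have [hN1 hN2 hN3] := hN; have N0 : 0 < N.+1%:R :> R by [].
pose q := k / N.+1%:R.
have q0 : 0 <= q by rewrite divr_ge0// ltW.
have [|B BE] := jump_law mpr (mS j) (nuS j) q0.
  by rewrite /q mulrAC ler_pdivrMr// mul1r.
have [Q1 [_ Q1E]] := convolution_pow_probability B (ltn0Sn N).
pose b : 'rV[R]_n := \row_i (k * \int[nu]_(u in S j) (co u : 'rV[R]_n) ord0 i)%R.
pose D : probability V R := dirac (- b : V).
have bE x : dot (- b) x = - (k * \int[nu]_(u in S j) dot (co u) x)%R.
  rewrite integral_dot dotC dotNr dotC; congr (- _); rewrite mulr_sumr.
  by apply: eq_bigr => i _; rewrite mxE mulrA.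
have DE x : cf D x = expi (- (k * \int[nu]_(u in S j) dot (co u) x))%R.
  have HD (f : V -> R) : measurable_fun setT f -> (\int[D]_y f y = f (- b))%R.
    move=> mf; rewrite /Rintegral integral_dirac//; last exact/measurable_EFinP.
    by rewrite diracT mul1e.
  have [mc ms] := (mbounded_cos (measurable_dot x), mbounded_sin (measurable_dot x)).
  by rewrite -bE /cf cintegral_expi expiE (HD _ mc.1) (HD _ ms.1).
have [Q [_ QE]] := convolution_probability Q1 D.
exists Q => x; rewrite QE Q1E BE DE.
set w := (X in 1 + X).
set s := (k * \int[nu]_(u in S j) dot (co u) x)%R.
have bc : mbounded (fun u => cos (dot (pr u) x) - 1).
  have [mc _] := mbounded_cos (mdpr x).
  split; first exact: measurable_funB.
  by exists (1 + 1) => u; rewrite (le_trans (ler_normB _ _))// normr1 lerD2r cos_max.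
have bs := mbounded_sin (mdpr x).
have qN : q * N.+1%:R = k by rewrite divfK.
have -> : cexp (k%:C%C * PsiJ j x) = cexp (w *+ N.+1) * expi (- s).
  rewrite /expi -cexpD; congr cexp; apply: complex_eq.
    rewrite ReD ReMn ReM/= /fR -[X in X *+ _]mulrC -mulrnAr -qN -mulr_natr; ring.
  rewrite ImD ImMn ImM/= /fI RintegralB//; last 2 first.
  - exact: integrable_bounded bs.
  - exact: integrable_bounded (bdco x).
  rewrite /s -qN -mulr_natr; ring.
have wr : cnorm1 w <= r / N.+1%:R.
  rewrite /cnorm1/= normrM [X in _ + X]normrM (ger0_norm q0).
  have h1 : `|\int[nu]_(u in S j) (cos (dot (pr u) x) - 1)|%R <= 2 * M.
    apply: integral_le => // u.
    by rewrite (le_trans (ler_normB _ _))// normr1; have := cos_max (dot (pr u) x); lra.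
  have h2 : `|\int[nu]_(u in S j) sin (dot (pr u) x)|%R <= 1 * M.
    by apply: integral_le => // u; exact: sin_max.
  rewrite (le_trans (lerD (ler_wpM2l q0 h1) (ler_wpM2l q0 h2)))//.
  by rewrite /q /r le_eqVlt; apply/orP; left; apply/eqP; field.
(* A unit complex number may exceed 1 in [cnorm1]; this is the origin of the 2 in the final
   bound. *)
have e2 : cnorm1 (expi (- s)) <= 2.
  by rewrite expiE /cnorm1/=; have := cos_max (- s); have := sin_max (- s); lra.
rewrite -mulrBl (le_trans (cnorm1M _ _))// mulrC ler_pM ?cnorm1_ge0//.
rewrite (le_trans (cexp_approx wr hN2))// ler_pdivrMr// [leRHS]mulrC.
by rewrite ler_pdivlMr.
Unshelve. all: by end_near.
Qed.

Let cvg_Re_Im (f : nat -> R) (A : R) (Z : nat -> R) :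
  Z j @[j --> \oo] --> A -> (forall j, `|f j - Z j| <= 2 / j.+1%:R) ->
  f j @[j --> \oo] --> A.
Proof.
move=> ZA fZ; rewrite -[A]add0r.
have -> : f = (fun j => (f j - Z j) + Z j) by apply/funext => j; rewrite subrK.
apply: cvgD => //; apply/cvgrPdist_le => e e0; near=> j.
rewrite sub0r normrN (le_trans (fZ j))// ler_pdivrMr// mulrC -ler_pdivrMr//.
rewrite (@le_trans _ _ j%:R) ?ler_nat//; apply: ltW; near: j; exact: nbhs_infty_gtr.
Unshelve. all: by end_near.
Qed.

Lemma levy_root : exists Q : probability V R, forall x, cf Q x = cexp (k%:C%C * Psi x).
Proof.
have [Q QE] := choice approximant.
have cR x : k * complex.Re (PsiJ j x) @[j --> \oo] --> k * complex.Re (Psi x).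
  by apply: cvgM; [exact: cvg_cst|exact: Rintegral_exhaustion_cvg].
have cI x : k * complex.Im (PsiJ j x) @[j --> \oo] --> k * complex.Im (Psi x).
  by apply: cvgM; [exact: cvg_cst|exact: Rintegral_exhaustion_cvg].
have cE z : cexp (k%:C%C * z) = ((expR (k * complex.Re z) * cos (k * complex.Im z)) +i*
    (expR (k * complex.Re z) * sin (k * complex.Im z)))%C.
  by case: z => a b; rewrite /cexp/= !mul0r subr0 addr0.
have ReB (z w : R[i]) : complex.Re (z - w) = complex.Re z - complex.Re w by case: z; case: w.
have ImB (z w : R[i]) : complex.Im (z - w) = complex.Im z - complex.Im w by case: z; case: w.
have cexpR x : expR (k * complex.Re (PsiJ j x)) @[j --> \oo] --> expR (k * complex.Re (Psi x)).
  exact: (continuous_cvg _ (@continuous_expR R _) (@cR x)).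
apply: (@levy_continuity _ _ Q) => // x.
- apply: (@cvg_Re_Im _ _ (fun j => complex.Re (cexp (k%:C%C * PsiJ j x)))).
    under eq_fun do rewrite cE; rewrite cE /=; apply: cvgM; first exact: cexpR.
    exact: (continuous_cvg _ (@continuous_cos R _) (@cI x)).
  by move=> j; rewrite -ReB (le_trans _ (QE j x))// lerDl.
- apply: (@cvg_Re_Im _ _ (fun j => complex.Im (cexp (k%:C%C * PsiJ j x)))).
    under eq_fun do rewrite cE; rewrite cE /=; apply: cvgM; first exact: cexpR.
    exact: (continuous_cvg _ (@continuous_sin R _) (@cI x)).
  by move=> j; rewrite -ImB (le_trans _ (QE j x))// lerDr.
Qed.

End levy_root.

(** * Cylindrical measures from characteristic functions *)

Section dual_combinations.
Context {R : realType} {U : normedModType R}.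

Lemma cdual_ext (a b : cdual U) : (forall u, a u = b u) -> a = b.
Proof. by move=> ab; apply: val_inj; apply/funext. Qed.

Definition comb n (a : 'I_n -> cdual U) (x : 'rV[R]_n) : cdual U :=
  \sum_i x ord0 i *: a i.

Lemma cdual_sumE n (f : 'I_n -> cdual U) u : (\sum_i f i) u = \sum_i f i u.
Proof.
have H : forall s : seq 'I_n, (\sum_(i <- s) f i) u = \sum_(i <- s) f i u.
  by elim=> [|i s IH]; rewrite ?big_nil// !big_cons -IH.
exact: H.
Qed.

Lemma combE n (a : 'I_n -> cdual U) x u : comb a x u = dot (cyl_proj a u) x.
Proof.
rewrite /comb cdual_sumE; apply: eq_bigr => i _.
by rewrite mxE mulrC.
Qed.

Lemma cdual0 (a : cdual U) : a 0 = 0.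
Proof.
by have := cdual_linear a (-1) 0 0; rewrite scaler0 addr0 scaleN1r addNr.
Qed.

Lemma cyl_proj_linear n (a : 'I_n -> cdual U) k u w :
  cyl_proj a (k *: u + w) = k *: cyl_proj a u + cyl_proj a w.
Proof. by apply/rowP => i; rewrite !mxE cdual_linear. Qed.

Lemma cyl_proj0 n (a : 'I_n -> cdual U) : cyl_proj a 0 = 0.
Proof. by apply/rowP => i; rewrite !mxE cdual0. Qed.

(** Among the matrices with rows in the range, one of maximal rank has the range as its row space,
    since adjoining a vector of the range cannot raise the rank. Its cokernel matrix is [W]. The
    range thereby becomes the preimage of 0 under a linear map, hence measurable. *)
Lemma cyl_proj_range n (a : 'I_n -> cdual U) :
  exists W : 'M[R]_n, forall v, v *m W = 0 <-> exists u, cyl_proj a u = v.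
Proof.
pose inR (v : 'rV[R]_n) := exists u, cyl_proj a u = v.
have inRZD k v w : inR v -> inR w -> inR (k *: v + w).
  by move=> [u <-] [u' <-]; exists (k *: u + u'); rewrite cyl_proj_linear.
have inR0 : inR 0 by exists 0; exact: cyl_proj0.
have inRmul m (A : 'M[R]_(m, n)) (w : 'rV_m) : (forall i, inR (row i A)) -> inR (w *m A).
  move=> hA; rewrite mulmx_sum_row.
  elim: (index_enum _) => [|i s IH]; first by rewrite big_nil.
  by rewrite big_cons; exact: inRZD.
pose P r := `[< exists A : 'M[R]_n, (forall i, inR (row i A)) /\ \rank A = r >].
have P0 : exists r, P r.
  exists 0%N; apply/asboolP; exists 0; split; last exact: mxrank0.
  by move=> i; rewrite row0.
have Pn r : P r -> (r <= n)%N by move=> /asboolP[A [_ <-]]; exact: rank_leq_row.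
have [r /asboolP[A [Ar rA]] rmax] := ex_maxnP P0 Pn.
have subA v : inR v -> (v <= A)%MS.
  move=> hv; have hAv i : inR (row i (A + v)%MS).
    have /sub_addsmxP[[w1 w2] ->] : (row i (A + v)%MS <= A + v)%MS by exact: row_sub.
    rewrite addrC -[_ *m v]scale1r; apply: inRZD; last exact: inRmul.
    by apply: inRmul => j; rewrite (ord1 j) row_id.
  have := rmax (\rank (A + v)%MS); rewrite -rA => /(_ _)/wrap[].
    by apply/asboolP; exists (A + v)%MS.
  move=> h; have : (A + v <= A)%MS.
    by rewrite -(geq_leqif (mxrank_leqif_sup (addsmxSl A v))).
  exact: submx_trans (addsmxSr A v).
exists (cokermx A) => v; split=> [/eqP|[u <-]].
  by rewrite -submxE => /submxP[w ->]; exact: inRmul.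
by apply/eqP; rewrite -submxE; apply: subA; exists u.
Qed.

Lemma measurable_cyl_proj n (a : 'I_n -> cdual U) :
  measurable_fun setT (cyl_proj a : borel U -> borel 'rV[R]_n).
Proof.
apply: measurable_rV => i; under eq_fun do rewrite mxE.
exact: measurable_cdual.
Qed.

End dual_combinations.

Lemma probability_setI1 d (T : measurableType d) (R : realType) (P : probability T R) A B :
  measurable A -> measurable B -> P A = 1%E -> P (A `&` B) = P B.
Proof.
move=> mA mB PA.
have A0 : P (~` A) = 0%E.
  by rewrite probability_setC// PA subee.
have mCA := measurableC mA; have mBA := measurableI _ _ mB mCA.
have BA0 : P (B `&` ~` A) = 0%E by exact: (subset_measure0 mBA mCA (@subIsetr _ B (~` A)) A0).
have -> : P B = (P (B `&` A) + P (B `&` ~` A))%E.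
  rewrite -measureU//; first by rewrite -setIUr setUv setIT.
    exact: measurableI.
  by rewrite setIACA setICr setI0.
by rewrite BA0 adde0 setIC.
Qed.

Lemma measurable_mulmx (R : realType) m n (L : 'M[R]_(m, n)) :
  measurable_fun setT ((fun v => v *m L) : borel 'rV[R]_m -> borel 'rV[R]_n).
Proof.
apply: measurable_rV => i; under eq_fun do rewrite mxE.
by apply: measurable_sum => j; apply: measurable_funM => //; exact: measurable_coord.
Qed.

Lemma measurable_rV0 (R : realType) n : measurable ([set (0 : 'rV[R]_n)] : set (borel 'rV[R]_n)).
Proof.
rewrite -[X in measurable X]setCK; apply: measurableC; apply: sub_sigma_algebra.
apply: closed_openC; apply: accessible_closed_set1; apply: hausdorff_accessible.
exact: norm_hausdorff.
Qed.

(** Preimages under one fixed map form a sigma-algebra, and each generator is such a preimage: its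
    functionals are selected from [s] by a 0-1 matrix. *)
Lemma cyl_type_measurable (R : realType) (U : normedModType R) (s : seq (cdual U)) G
    (A : set (cyl_type G)) : (forall a, G a -> a \in s) -> measurable A ->
  exists2 B : set (borel 'rV[R]_(size s)), measurable B &
    A = cyl_proj (fun i : 'I_(size s) => nth 0 s i) @^-1` B.
Proof.
move=> Gs mA; pose g (i : 'I_(size s)) : cdual U := nth 0 s i; rewrite -/g.
have cylE C : cyl_sets G C -> exists2 B : set (borel 'rV[R]_(size s)), measurable B & C = cyl_proj g @^-1` B.
  move=> [n [a [B [Ga mB ->]]]].
  have /choice[t ht] : forall i, exists j : 'I_(size s), a i = g j.
    move=> i; have ais := Gs _ (Ga i).
    have ij : (index (a i) s < size s)%N by rewrite index_mem.
    by exists (Ordinal ij); rewrite /g/= nth_index.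
  pose L : 'M[R]_(size s, n) := \matrix_(j, i) (j == t i)%:R.
  have gL u : cyl_proj a u = cyl_proj g u *m L.
    apply/rowP => i; rewrite !mxE (bigD1 (t i))//= !mxE eqxx mulr1 big1 ?addr0 ?ht// => j ji.
    by rewrite !mxE (negbTE ji) mulr0.
  exists [set v | B (v *m L)].
    by have := measurable_mulmx L measurableT mB; rewrite setTI.
  by apply/seteqP; split=> u /=; rewrite gL.
have [B mB AB] : preimage_set_system setT (cyl_proj g) (measurable : set (set (borel 'rV[R]_(size s)))) A.
  move: A mA; apply: smallest_sub.
    exact/sigma_algebra_preimage/sigma_algebra_measurable.
  by move=> A /cylE[B mB ->]; exists B => //; rewrite setTI.
by exists B => //; rewrite -AB setTI.
Qed.

(** * Gluing consistent finite-dimensional laws *)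

Section gluing.
Context {R : realType} {U : normedModType R}.
Variables (chi : cdual U -> R[i]) (chi0 : chi 0 = 1).
Hypothesis chiP : forall n (a : 'I_n -> cdual U),
  exists Q : probability (borel 'rV[R]_n) R, forall x, cf Q x = chi (comb a x).

Let Q n a := sval (cid (@chiP n a)).

Let QE n a x : cf (@Q n a) x = chi (comb a x).
Proof. exact: svalP (cid (@chiP n a)) x. Qed.

(** On characteristic functions, applying [L] to the law amounts to applying its transpose to the
    argument, and both arguments represent the same functional on U. *)
Let Q_linear m n (c : 'I_m -> cdual U) (a : 'I_n -> cdual U) (L : 'M[R]_(m, n)) :
  (forall u, cyl_proj a u = cyl_proj c u *m L) ->
  forall B, measurable B -> Q a B = Q c [set v | B (v *m L)].
Proof.
move=> acL B mB; have [P PE] := image_probability (measurable_mulmx L) (Q c).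
rewrite -[RHS](PE B); apply: cf_unique => // x; rewrite QE.
rewrite /cf (image_expi (measurable_mulmx L) (m := Q c)); [|by move=> B' _; rewrite PE|exact: measurable_dot].
have dotL v : dot (v *m L) x = dot v (x *m L^T).
  rewrite /dot; under eq_bigr do rewrite mxE mulr_suml.
  rewrite exchange_big/=; apply: eq_bigr => i _; rewrite mxE mulr_sumr.
  by apply: eq_bigr => j _; rewrite !mxE mulrA mulrAC.
under eq_fun do rewrite dotL.
rewrite -/(cf (Q c) (x *m L^T)) QE; congr chi; apply: cdual_ext => u.
by rewrite !combE acL dotL.
Qed.

(* The image law under a matrix [W] with kernel the range of the projection is
   the law for zero functionals, a Dirac mass. *)
Let Q_range n (a : 'I_n -> cdual U) : exists2 V : set (borel 'rV[R]_n),
  measurable V /\ Q a V = 1%E & forall v, V v <-> exists u, cyl_proj a u = v.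
Proof.
have [W hW] := cyl_proj_range a.
exists [set v : borel 'rV[R]_n | v *m W = 0]; last exact: hW.
pose z (i : 'I_n) : cdual U := 0.
have zE u : cyl_proj z u = cyl_proj a u *m W.
  have -> : cyl_proj a u *m W = 0 by apply/hW; exists u.
  by apply/rowP => i; rewrite !mxE.
split.
  have := measurable_mulmx W measurableT (@measurable_rV0 R n).
  by rewrite setTI.
have <- := Q_linear zE (@measurable_rV0 R n).
pose o : borel 'rV[R]_n := (0 : 'rV[R]_n).
have -> : Q z [set o] = dirac o [set o].
  apply: (cf_unique (P1 := Q z) (P2 := dirac o)) => [x|]; last exact: measurable_rV0.
  rewrite QE (_ : comb z x = 0); last first.
    by apply: cdual_ext => u; rewrite combE (_ : cyl_proj z u = 0) ?dot0l//; apply/rowP => i; rewrite !mxE.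
  have HD (f : borel 'rV[R]_n -> R) : measurable_fun setT f ->
      (\int[dirac o]_y f y = f o)%R.
    move=> mf; rewrite /Rintegral integral_dirac//; last exact/measurable_EFinP.
    by rewrite diracT mul1e.
  have [mc ms] := (mbounded_cos (measurable_dot x), mbounded_sin (measurable_dot x)).
  by rewrite chi0 /cf cintegral_expi (HD _ mc.1) (HD _ ms.1)/= dot0l cos0 sin0.
by rewrite diracE mem_set.
Qed.

(** Both bases are pulled back to the joint projection along [a] and [b]. There they need to agree
    only on the range of that projection, which carries the full mass of the joint law. *)
Let Q_consistent n m (a : 'I_n -> cdual U) (b : 'I_m -> cdual U)
    (A : set (borel 'rV[R]_n)) (B : set (borel 'rV[R]_m)) :
  measurable A -> measurable B -> cyl_proj a @^-1` A = cyl_proj b @^-1` B -> Q a A = Q b B.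
Proof.
move=> mA mB AB.
pose c (i : 'I_(n + m)) := match fintype.split i with inl j => a j | inr j => b j end.
have cE u : cyl_proj c u = row_mx (cyl_proj a u) (cyl_proj b u).
  by apply/rowP => i; rewrite !mxE /c; case: fintype.split => j; rewrite mxE.
have cA u : cyl_proj a u = cyl_proj c u *m col_mx 1%:M 0.
  by rewrite cE mul_row_col mulmx1 mulmx0 addr0.
have cB u : cyl_proj b u = cyl_proj c u *m col_mx 0 1%:M.
  by rewrite cE mul_row_col mulmx1 mulmx0 add0r.
have [V [mV QV] hV] := Q_range c.
rewrite (Q_linear cA mA) (Q_linear cB mB).
have mA' : measurable [set v : borel 'rV[R]_(n + m) | A (v *m col_mx 1%:M 0)].
  rewrite -[X in measurable X]setTI; exact: (measurable_mulmx (col_mx 1%:M 0) measurableT mA).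
have mB' : measurable [set v : borel 'rV[R]_(n + m) | B (v *m col_mx 0 1%:M)].
  rewrite -[X in measurable X]setTI; exact: (measurable_mulmx (col_mx 0 1%:M) measurableT mB).
rewrite -(probability_setI1 mV mA' QV) -(probability_setI1 mV mB' QV).
congr (Q c _); apply/seteqP; split=> v [Vv] /=; have [u uv] := (hV v).1 Vv;
  rewrite -uv -cA -cB => h; (split; first by rewrite uv).
- by have : (cyl_proj a @^-1` A) u by []; rewrite AB.
- by have : (cyl_proj b @^-1` B) u by []; rewrite -AB.
Qed.

Let value (A : set U) : set (\bar R) :=
  [set r | exists n (a : 'I_n -> cdual U) (B : set (borel 'rV[R]_n)),
    [/\ measurable B, A = cyl_proj a @^-1` B & r = Q a B]].

(** On cylinders the chosen value is the only one, by consistency. Elsewhere the default 0 is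
    irrelevant. *)
Let mu (A : set U) : \bar R := xget 0%E (value A).

Let muE n (a : 'I_n -> cdual U) (B : set (borel 'rV[R]_n)) : measurable B -> mu (cyl_proj a @^-1` B) = Q a B.
Proof.
move=> mB; have [|m [b [C [mC E]]]] := @xgetPex _ 0%E (value (cyl_proj a @^-1` B)).
  by exists (Q a B), n, a, B.
by rewrite -/(mu _) => ->; exact: Q_consistent.
Qed.

Let mu_cyl_measure : cyl_measure mu.
Proof.
move=> G /finite_seqP[s GE].
have Gs a : G a -> a \in s by rewrite GE.
pose g (i : 'I_(size s)) : cdual U := nth 0 s i.
have [V [mV QV] hV] := Q_range g.
(* Bases inside the range [V] are chosen so that disjoint cylinders have disjoint bases;
   sigma-additivity is then that of the single law [Q g]. *)
have mE (A : set (cyl_type G)) : measurable A ->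
    exists B : set (borel 'rV[R]_(size s)), [/\ measurable B, B `<=` V & A = cyl_proj g @^-1` B].
  move=> mA.
  have [B mB ->] := @cyl_type_measurable _ _ s _ _ Gs mA.
  exists (B `&` V); split; [exact: measurableI|exact: subIsetr|].
  apply/seteqP; split=> u /=; last by case.
  by move=> Bu; split=> //; apply/hV; exists u.
split.
- rewrite /on_cyl -(preimage_set0 (cyl_proj g)) muE//.
- by move=> A /mE[B [mB _ ->]]; rewrite /on_cyl muE.
- move=> F mF tF mUF.
  have /choice[B hB] : forall i, exists B : set (borel 'rV[R]_(size s)),
    [/\ measurable B, B `<=` V & F i = cyl_proj g @^-1` B] by move=> i; exact: mE.
  have mB i : measurable (B i) by have [] := hB i.
  have tB : trivIset setT B.
    apply/trivIsetP => i j _ _ ij; apply/seteqP; split=> v // [Bi Bj].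
    have [_ BV _] := hB i; have [u uv] := (hV v).1 (BV _ Bi).
    have : (F i `&` F j) u.
      have [_ _ ->] := hB i; have [_ _ ->] := hB j.
      by split; rewrite /= uv.
    by move/trivIsetP : tF => ->.
  have -> : \bigcup_i F i = cyl_proj g @^-1` (\bigcup_i B i).
    by rewrite preimage_bigcup; apply: eq_bigcup => // i _; have [] := hB i.
  rewrite /on_cyl muE; last exact: bigcupT_measurable.
  have -> : (fun n => \sum_(0 <= i < n) mu (F i))%E = (fun n => \sum_(0 <= i < n) Q g (B i))%E.
    apply/funext => n; apply: eq_bigr => i _.
    by have [_ _ ->] := hB i; rewrite muE.
  by apply: measure_semi_sigma_additive => //; exact: bigcupT_measurable.
Qed.

Theorem cyl_probability_of_cf : exists2 mu : set U -> \bar R, cyl_probability mu &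
  forall n (a : 'I_n -> cdual U), exists2 P : probability (borel 'rV[R]_n) R,
    (forall B, measurable B -> cyl_image mu a B = P B) &
    forall x, cf P x = chi (comb a x).
Proof.
exists mu; last by move=> n a; exists (Q a) => [B mB|x]; [exact: muE|exact: QE].
split=> //.
pose a (i : 'I_0) : cdual U := 0.
rewrite -(preimage_setT (cyl_proj a)) muE//; exact: probability_setT.
Qed.

End gluing.

(** * Truncation functions and exponents *)

Section truncation_bounds.
Context {R : realType}.
Implicit Types s t : R.

Local Notation sqmin s := (Order.min (s ^+ 2) 1).

(** Away from 0 the minimum is at least [e ^+ 2], so division by [e ^+ 2] absorbs the uniform
    bound. *)
Lemma le_sqmin (f e C s : R) : 0 < e <= 1 -> (`|s| < e -> `|f| <= C * s ^+ 2) ->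
  `|f| <= C -> `|f| <= C / e ^+ 2 * sqmin s.
Proof.
move=> /andP[e0 e1] fs fC; have C0 : 0 <= C by exact: le_trans fC.
have e2 : 0 < e ^+ 2 by rewrite exprn_gt0.
have e21 : e ^+ 2 <= 1 by rewrite expr_le1// ltW.
have CC : C <= C / e ^+ 2 by rewrite ler_pdivlMr// ler_piMr.
rewrite -(real_normK (num_real s)) in fs *.
have [se|es] := ltP `|s| e.
  rewrite min_l; last by rewrite expr_le1// (le_trans (ltW se)).
  by rewrite (le_trans (fs se))// ler_wpM2r// sqr_ge0.
rewrite (le_trans fC)// -[leLHS](divfK (lt0r_neq0 e2)) ler_wpM2l//.
  by rewrite (le_trans C0).
by rewrite le_min e21 andbT lerXn2r ?nnegrE// ltW.
Qed.

Lemma cos_sqmin T s t : `|t| <= T -> `|cos (t * s) - 1| <= (2 + T ^+ 2) * sqmin s.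
Proof.
move=> tT; have T0 : 0 <= T by exact: le_trans tT.
have t2 : t ^+ 2 <= T ^+ 2 by rewrite -(real_normK (num_real t)) lerXn2r ?nnegrE.
have := @le_sqmin (cos (t * s) - 1) 1 (2 + T ^+ 2) s; rewrite expr1n divr1; apply.
- by rewrite ltr01 lexx.
- move=> _; rewrite (le_trans (cos_sub1_le _))// exprMn ler_wpM2r ?sqr_ge0//.
  by rewrite (le_trans t2)// lerDr.
- rewrite (le_trans (ler_normB _ _))// normr1.
  by have := cos_max (t * s); have := sqr_ge0 T; lra.
Qed.

(** Sine as a smooth truncation function, compatible with dilations up to an integrable error that
    is uniform for bounded [t]. The constant dominates both the quadratic bound [T + T ^+ 2] and the
    uniform bound [1 + T]. *)
Lemma sin_sqmin T s t : `|t| <= T ->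
  `|sin (t * s) - t * sin s| <= (1 + T + T ^+ 2) * sqmin s.
Proof.
move=> tT; have T0 : 0 <= T by exact: le_trans tT.
have t2 : t ^+ 2 <= T ^+ 2 by rewrite -(real_normK (num_real t)) lerXn2r ?nnegrE.
have := @le_sqmin (sin (t * s) - t * sin s) 1 (1 + T + T ^+ 2) s; rewrite expr1n divr1; apply.
- by rewrite ltr01 lexx.
- move=> _; have -> : sin (t * s) - t * sin s = sin (t * s) - t * s - t * (sin s - s) by ring.
  rewrite (le_trans (ler_normB _ _))// normrM.
  have h1 := sin_sub_le (t * s); have h2 := sin_sub_le s; rewrite exprMn in h1.
  have h3 : `|t| * `|sin s - s| <= T * s ^+ 2 by rewrite ler_pM.
  have h4 : t ^+ 2 * s ^+ 2 <= T ^+ 2 * s ^+ 2 by rewrite ler_wpM2r// sqr_ge0.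
  by have := sqr_ge0 s; rewrite !mulrDl mul1r; lra.
- rewrite (le_trans (ler_normB _ _))// normrM.
  have h3 : `|t| * `|sin s| <= T * 1 by rewrite ler_pM// sin_max.
  by have := sin_max (t * s); have := sqr_ge0 T; lra.
Qed.

Lemma truncation_sqmin (h : R -> R) : truncation h ->
  exists K, forall s, `|h s - sin s| <= K * sqmin s.
Proof.
move=> [_ [C hC] /nbhs_ballP[e /= e0 he]].
(* The radius is cut at 1 as [le_sqmin] requires, and [C + 1] bounds [h - sin]. *)
pose e' := Num.min e 1; pose C' := C + 1.
have C0 : 0 <= C by exact: le_trans (hC 0).
exists (C' / e' ^+ 2) => s; apply: le_sqmin.
- by rewrite lt_min e0 ltr01 ge_min lexx orbT.
- rewrite lt_min => /andP[se _]; rewrite he; last by rewrite /ball/= sub0r normrN.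
  rewrite distrC (le_trans (sin_sub_le _))// ler_peMl ?sqr_ge0//.
  by rewrite /C' lerDr.
- by rewrite (le_trans (ler_normB _ _))// lerD// sin_max.
Qed.

End truncation_bounds.

Lemma integral_mrestr_support d (T : measurableType d) (R : realType)
    (m : {measure set T -> \bar R}) (D : set T) (mD : measurable D) (g : T -> \bar R) :
  measurable_fun setT g -> (forall x, ~ D x -> g x = 0%E) ->
  (\int[mrestr m mD]_x g x = \int[m]_x g x)%E.
Proof.
have pos (f : T -> \bar R) : measurable_fun setT f -> (forall x, 0 <= f x)%E ->
    (forall x, ~ D x -> f x = 0%E) -> (\int[mrestr m mD]_x f x = \int[m]_x f x)%E.
  move=> mf f0 fD; have rD : mrestr m mD (~` D) = 0%E by rewrite /mrestr setICl measure0.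
  rewrite (ge0_negligible_integral (measurableC mD) measurableT mf _ rD)// setTD setCK.
  rewrite (eq_measure_integral m) => [|A mA AD]; last first.
    by rewrite -[LHS]/(m (A `&` D)) setIidl.
  rewrite [LHS]integral_mkcond; apply: eq_integral => x _; rewrite /patch.
  by case: ifPn => // /negP; rewrite inE => /fD.
move=> mg gD; rewrite [LHS]integralE [RHS]integralE.
congr (_ - _)%E; apply: pos => //; [exact: measurable_funepos| |exact: measurable_funeneg|].
- by move=> x /gD gx; rewrite funeposE gx maxxx.
- by move=> x /gD gx; rewrite funenegE gx oppe0 maxxx.
Qed.

Lemma continuous_Rintegral d (T : measurableType d) (R : realType)
    (m : {measure set T -> \bar R}) (f : R -> T -> R) :
  (forall t, measurable_fun setT (f t)) -> (forall x, continuous (f ^~ x)) ->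
  (forall b, exists2 g, m.-integrable setT (EFin \o g) &
     forall t x, `|t| <= b -> `|f t x| <= g x) ->
  continuous (fun t => \int[m]_x f t x)%R.
Proof.
move=> mf cf bf t; pose b := `|t| + 1.
have [g ig fg] := bf b.
have I t' : t' \in `]- b, b[ -> `|t'| <= b.
  by rewrite in_itv/= => /andP[h1 h2]; rewrite ler_norml !ltW.
apply: (@continuity_under_integral _ _ _ m f setT measurableT (- b) b _ _ g ig _ t).
- move=> t' /I t'b; apply: le_integrable ig => //; first exact/measurable_EFinP.
  by move=> x _; rewrite /= lee_fin (le_trans (fg _ x t'b))// ler_norm.
- by apply: aeW => x _ s _; exact: cf.
- by move=> t' /I t'b; apply: aeW => x _; exact: fg.
- rewrite inE/= in_itv/= -ltr_norml /b; lra.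
Qed.

(** * The Levy exponent on the dual space *)

Section banach.
Context {R : realType} {U : normedModType R}.
Implicit Types a : cdual U.

Lemma measurable_unit_ball : measurable (@unit_ball R U : set (borel U)).
Proof.
rewrite -[X in measurable X]setCK; apply: measurableC; apply: sub_sigma_algebra.
apply: closed_openC.
exact: (closed_comp (fun u _ => @norm_continuous _ _ u) (@closed_le _ 1)).
Qed.

Lemma cdual_bounded a : exists C, forall u, `|u| <= 1 -> `|a u| <= C.
Proof.
have aZ (c : R) u : a (c *: u) = c * a u.
  by rewrite -[c *: u]addr0 cdual_linear cdual0 addr0.
have /cvgrPdist_lt/(_ 1 ltr01)/nbhs_normP[e /= e0 ae] := @cdual_continuous _ _ a 0.
have e2 : 0 < e / 2 by rewrite divr_gt0.
exists (2 / e) => u u1; have := ae ((e / 2) *: u).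
rewrite /= sub0r normrN cdual0 sub0r normrN aZ normrZ (gtr0_norm e2) => h.
have : e / 2 * `|a u| < 1.
  rewrite -[e / 2](gtr0_norm e2) -normrM; apply: h.
  by rewrite (@le_lt_trans _ _ (e / 2))//; [rewrite ler_piMr// ltW|lra].
by rewrite ler_pdivlMr//; set x := `|a u|; lra.
Qed.

Lemma mbounded_cdual_ball a : mbounded (fun u : borel U => a u * \1_unit_ball u).
Proof.
split.
  apply: measurable_funM; first exact: measurable_cdual.
  exact: (measurable_indic (measurable_unit_ball)).
have [C aC] := cdual_bounded a; exists `|C| => u; rewrite indicE.
case: (boolP (u \in _)) => [|_]; last by rewrite mulr0 normr0.
by rewrite inE mulr1 => /aC h; rewrite (le_trans h)// ler_norm.
Qed.

Lemma levy_integrandE a u :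
  levy_integrand a u = ((cos (a u) - 1) +i* (sin (a u) - a u * \1_unit_ball u))%C.
Proof.
by rewrite /levy_integrand expiE; apply: complex_eq; rewrite /= ?mul0r ?mul1r; ring.
Qed.

Lemma psiE (h : R -> R) t : psi h t = ((cos t - 1) +i* (sin t - h t))%C.
Proof.
by rewrite /psi expiE; apply: complex_eq; rewrite /= ?mul0r ?mul1r; ring.
Qed.

Section levy_exponent.
Variable nu : {measure set (borel U) -> \bar R}.

Local Notation exponent a := (cintegral nu (levy_integrand a)).
Local Notation ball u := (\1_unit_ball u : R).

Lemma cintegrable_levy_integrand a : cintegrable nu (levy_integrand a) <->
  nu.-integrable setT (EFin \o (fun u => cos (a u) - 1)) /\
  nu.-integrable setT (EFin \o (fun u => sin (a u) - a u * ball u)).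
Proof.
rewrite /cintegrable; split=> -[h1 h2]; split.
- by move: h1; under eq_fun do rewrite levy_integrandE.
- by move: h2; under eq_fun do rewrite levy_integrandE.
- by under eq_fun do rewrite levy_integrandE.
- by under eq_fun do rewrite levy_integrandE.
Qed.

Lemma cintegral_levy_integrand a : exponent a =
  ((\int[nu]_u (cos (a u) - 1))%R +i* (\int[nu]_u (sin (a u) - a u * ball u))%R)%C.
Proof.
rewrite /cintegral /Rintegral.
by congr (fine _ +i* fine _)%C; apply: eq_integral => u _; rewrite levy_integrandE.
Qed.

Hypothesis minI : forall a, (\int[nu]_u (Order.min (a u ^+ 2) 1)%:E < +oo)%E.

Lemma integrable_sqmin a :
  nu.-integrable setT (EFin \o (fun u : borel U => Order.min (a u ^+ 2) 1)).
Proof.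
apply/integrableP; split.
  apply/measurable_EFinP; apply: measurable_minr => //.
  by apply: measurable_funX; exact: measurable_cdual.
rewrite (eq_integral (fun u : borel U => (Order.min (a u ^+ 2) 1)%:E))//.
by move=> u _; rewrite /= ger0_norm// le_min sqr_ge0 ler01.
Qed.

Lemma integrable_le_sqmin a (f : borel U -> R) K : measurable_fun setT f ->
  (forall u, `|f u| <= K * Order.min (a u ^+ 2) 1) -> nu.-integrable setT (EFin \o f).
Proof.
move=> mf fK; have ig := integrableZl measurableT K (integrable_sqmin a).
apply: le_integrable ig => //; first exact/measurable_EFinP.
by move=> u _; rewrite /= lee_fin (le_trans (fK u))// ler_norm.
Qed.

Let measurable_cos_cdual a : measurable_fun setT (fun u : borel U => cos (a u)).
Proof. exact: (mbounded_cos (measurable_cdual a)).1. Qed.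

Let measurable_sin_cdual a : measurable_fun setT (fun u : borel U => sin (a u)).
Proof. exact: (mbounded_sin (measurable_cdual a)).1. Qed.

Lemma continuous_cos_exponent a :
  continuous (fun t : R => \int[nu]_u (cos (t * a u) - 1))%R.
Proof.
apply: continuous_Rintegral => [t|u t|b].
- exact: (measurable_funB (measurable_cos_cdual (t *: a))).
- apply: cvgB; last exact: cvg_cst.
  apply: (continuous_cvg _ (@continuous_cos R _)); apply: cvgMr_tmp; exact: cvg_id.
- exists (fun u => (2 + b ^+ 2) * Order.min (a u ^+ 2) 1).
    exact: (integrableZl measurableT _ (integrable_sqmin a)).
  by move=> t u tb; exact: cos_sqmin.
Qed.

(** The integrand is not of order [min((a u)^2, 1)] off the unit ball. Splitting off
    [t * (sin (a u) - a u 1_B(u))] leaves a part of this order plus a term linear in [t]. *)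
Lemma continuous_sin_exponent a :
  nu.-integrable setT (EFin \o (fun u => sin (a u) - a u * ball u)) ->
  continuous (fun t : R => \int[nu]_u (sin (t * a u) - t * a u * ball u))%R.
Proof.
move=> ia; have msin (t : R) : measurable_fun setT (fun u : borel U => sin (t * a u) - t * sin (a u)).
  apply: measurable_funB; first exact: (measurable_sin_cdual (t *: a)).
  by apply: measurable_funM.
have cS : continuous (fun t : R => \int[nu]_u (sin (t * a u) - t * sin (a u)))%R.
  apply: continuous_Rintegral => [//|u s|b].
    apply: cvgB; last by apply: cvgMr_tmp; exact: cvg_id.
    by apply: (continuous_cvg _ (@continuous_sin R _)); apply: cvgMr_tmp; exact: cvg_id.
  exists (fun u => (1 + b + b ^+ 2) * Order.min (a u ^+ 2) 1).
    exact: (integrableZl measurableT _ (integrable_sqmin a)).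
  by move=> s u sb; exact: sin_sqmin.
rewrite (_ : (fun t => _) = fun t : R => (\int[nu]_u (sin (t * a u) - t * sin (a u)))%R +
    t * (\int[nu]_u (sin (a u) - a u * ball u))%R).
  by move=> t; apply: cvgD; [exact: cS|apply: cvgMr_tmp; exact: cvg_id].
apply/funext => t; rewrite -RintegralZl// -RintegralD//.
- by apply: eq_Rintegral => u _; ring.
- apply: (@integrable_le_sqmin a _ (1 + `|t| + `|t| ^+ 2)) => // u.
  exact: sin_sqmin.
- exact: (integrableZl measurableT _ ia).
Qed.

Hypothesis levyI : forall a, cintegrable nu (levy_integrand a).

Let iR a : nu.-integrable setT (EFin \o (fun u => cos (a u) - 1)).
Proof. exact: ((cintegrable_levy_integrand a).1 (levyI a)).1. Qed.

Let iI a : nu.-integrable setT (EFin \o (fun u => sin (a u) - a u * ball u)).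
Proof. exact: ((cintegrable_levy_integrand a).1 (levyI a)).2. Qed.

Lemma continuous_levy_exponent a :
  continuous (fun t : R => complex.Re (exponent (t *: a))) /\
  continuous (fun t : R => complex.Im (exponent (t *: a))).
Proof.
split; under eq_fun do rewrite cintegral_levy_integrand/=.
- exact: continuous_cos_exponent.
- exact: continuous_sin_exponent.
Qed.

Lemma levy_exponent0 : exponent 0 = 0.
Proof.
have I0 (f : borel U -> R) : (forall u, f u = 0) -> (\int[nu]_u f u = 0)%R.
  by move=> f0; rewrite /Rintegral integral0_eq// => u _; rewrite f0.
rewrite cintegral_levy_integrand; apply: complex_eq; apply: I0 => u.
  by rewrite cos0 subrr.
by rewrite sin0 mul0r subrr.
Qed.

End levy_exponent.

End banach.

(** * Restriction of Borel measures to cylindrical sigma-algebras *)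

Section restriction.
Context {R : realType} {U : normedModType R}.
Implicit Types a : cdual U.

Lemma cyl_type_borel G (A : set (cyl_type G)) : measurable A ->
  measurable (A : set (borel U)).
Proof.
move: A; apply: smallest_sub; first exact: (@sigma_algebra_measurable _ (borel U)).
move=> _ [n [a [B [_ mB ->]]]]; rewrite -[X in measurable X]setTI.
exact: measurable_cyl_proj.
Qed.

Lemma measurable_cyl_id G : measurable_fun setT (id : borel U -> cyl_type G).
Proof. by move=> _ A mA; rewrite setTI; exact: (@cyl_type_borel G A mA). Qed.

Lemma measurable_cyl_cdual a : measurable_fun setT (a : cyl_type [set a] -> R).
Proof.
move=> _ Y mY; rewrite setTI; apply: sub_sigma_algebra.
exists 1%N, (fun=> a), [set v : borel 'rV[R]_1 | Y ((v : 'rV[R]_1) ord0 ord0)]; split=> //.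
  by rewrite -[X in measurable X]setTI; exact: measurable_coord.
by apply/seteqP; split=> u /=; rewrite mxE.
Qed.

Variable M : {measure set (borel U) -> \bar R}.

Lemma cyl_measure_restriction : cyl_measure M.
Proof.
move=> G _; split=> [|A _|F mF tF mUF]; [exact: measure0|exact: measure_ge0|].
apply: (@measure_semi_sigma_additive _ _ _ M F) => // [i|].
  exact: (@cyl_type_borel G (F i) (mF i)).
exact: (@cyl_type_borel G _ mUF).
Qed.

Variables (m : set U -> \bar R) (a : cdual U).
Hypothesis mM : forall A : set (cyl_type [set a]), measurable A -> m A = M A.

Lemma on_cyl_charfun : cyl_charfun m a = charfun M a.
Proof.
exact: (image_expi (@measurable_cyl_id [set a]) mM (measurable_cyl_cdual (a := a))).
Qed.

Let measurable_psi h : measurable_fun setT h ->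
  measurable_fun setT (fun u : cyl_type [set a] => complex.Re (psi h (a u))) /\
  measurable_fun setT (fun u : cyl_type [set a] => complex.Im (psi h (a u))).
Proof.
move=> mh; have ma := @measurable_cyl_cdual a.
split; under eq_fun do rewrite psiE/=; apply: measurable_funB => //.
- exact: (mbounded_cos ma).1.
- exact: (mbounded_sin ma).1.
- exact: (measurableT_comp mh ma).
Qed.

Lemma on_cyl_cintegrable_psi h : measurable_fun setT h ->
  cintegrable (on_cyl m (G := [set a])) (fun u => psi h (a u)) <->
  cintegrable M (fun u => psi h (a u)).
Proof.
move=> /measurable_psi[mr mi]; apply: iff_sym.
exact: (image_cintegrable (@measurable_cyl_id [set a]) mM mr mi).
Qed.

Lemma on_cyl_cintegral_psi h : measurable_fun setT h ->
  cintegral (on_cyl m (G := [set a])) (fun u => psi h (a u)) =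
  cintegral M (fun u => psi h (a u)).
Proof.
move=> /measurable_psi[mr mi].
exact: (image_cintegral (@measurable_cyl_id [set a]) mM mr mi).
Qed.

End restriction.

Section exponents.
Context {R : realType} {U : normedModType R} (nu : {measure set (borel U) -> \bar R}).
Variables (h : R -> R) (a : cdual U).

Lemma cintegrable_psi : cintegrable nu (fun u => psi h (a u)) <->
  nu.-integrable setT (EFin \o (fun u => cos (a u) - 1)) /\
  nu.-integrable setT (EFin \o (fun u => sin (a u) - h (a u))).
Proof.
rewrite /cintegrable; split=> -[h1 h2]; split.
- by move: h1; under eq_fun do rewrite psiE.
- by move: h2; under eq_fun do rewrite psiE.
- by under eq_fun do rewrite psiE.
- by under eq_fun do rewrite psiE.
Qed.

Hypothesis driftI : nu.-integrable setT (fun u => (drift_integrand h a u)%:E).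

Lemma cintegrable_levy_psi : cintegrable nu (levy_integrand a) <->
  cintegrable nu (fun u => psi h (a u)).
Proof.
rewrite cintegrable_psi cintegrable_levy_integrand; split=> -[h1 h2]; split=> //.
- apply: eq_integrable (integrableB measurableT h2 driftI) => // u _.
  by rewrite /= -EFinB /drift_integrand; congr EFin; ring.
- apply: eq_integrable (integrableD measurableT h2 driftI) => // u _.
  by rewrite /= -EFinD /drift_integrand; congr EFin; ring.
Qed.

Lemma drift_exponent : cintegrable nu (fun u => psi h (a u)) ->
  'i%C * (drift nu h a)%:C%C - (0 / 2)%:C%C + cintegral nu (fun u => psi h (a u)) =
  cintegral nu (levy_integrand a).
Proof.
move=> /cintegrable_psi[h1 h2].
have -> : cintegral nu (fun u => psi h (a u)) =
    ((\int[nu]_u (cos (a u) - 1))%R +i* (\int[nu]_u (sin (a u) - h (a u)))%R)%C.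
  rewrite /cintegral /Rintegral.
  by congr (fine _ +i* fine _)%C; apply: eq_integral => u _; rewrite psiE.
rewrite cintegral_levy_integrand; apply: complex_eq => /=; first by ring.
rewrite -/(\int[nu]_u drift_integrand h a u)%R.
transitivity ((\int[nu]_u drift_integrand h a u)%R + (\int[nu]_u (sin (a u) - h (a u)))%R).
  by rewrite /drift /Rintegral; ring.
rewrite -RintegralD//; apply: eq_Rintegral => u _.
by rewrite /drift_integrand; ring.
Qed.

End exponents.

(** The drift integrand is the sum of [h (a u) - sin (a u)], controlled by [min((a u)^2, 1)], and
    the imaginary part of the Levy integrand. *)
Lemma drift_exists_levy (R : realType) (U : normedModType R)
    (nu : {measure set (borel U) -> \bar R}) (h : R -> R) : truncation h ->
  (forall a : cdual U, (\int[nu]_u (Order.min (a u ^+ 2) 1)%:E < +oo)%E) ->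
  (forall a : cdual U, cintegrable nu (levy_integrand a)) -> drift_exists nu h.
Proof.
move=> hh minI levyI a; have [K hK] := truncation_sqmin hh; have [mh _ _] := hh.
have [_ iI] := (cintegrable_levy_integrand nu a).1 (levyI a).
have ih : nu.-integrable setT (EFin \o (fun u : borel U => h (a u) - sin (a u))).
  apply: (integrable_le_sqmin minI (a := a) (K := K)) => //.
  apply: measurable_funB; last exact: (mbounded_sin (measurable_cdual a)).1.
  exact: (measurableT_comp mh (measurable_cdual a)).
apply: eq_integrable (integrableD measurableT ih iI) => // u _.
by rewrite /= -EFinD /drift_integrand; congr EFin; ring.
Qed.

(** * Levy measures and cylindrical characteristics *)

(** Subadditivity of the minimum with 1. It bounds the Euclidean integrability condition on R^n by
    the one-dimensional ones. *)
Lemma min_sum_le (R : realType) n (f : 'I_n -> R) : (forall i, 0 <= f i) ->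
  Order.min (\sum_i f i) 1 <= \sum_i Order.min (f i) 1.
Proof.
move=> f0; suff [] : Order.min (\sum_i f i) 1 <= \sum_i Order.min (f i) 1 /\ 0 <= \sum_i f i by [].
apply: (@big_ind2 _ _ (fun s t : R => Order.min s 1 <= t /\ 0 <= s)).
- by rewrite min_l.
- move=> s t s' t' [st s0] [st' s0']; split; last exact: addr_ge0.
  rewrite (le_trans _ (lerD st st'))//.
  by case: (leP (s + s') 1) => h1; case: (leP s 1) => h2; case: (leP s' 1) => h3; lra.
- by move=> i _; rewrite lexx.
Qed.

Section levy_law.
Context {R : realType} {U : normedModType R} (nu : {measure set (borel U) -> \bar R}).
Implicit Types a : cdual U.

Local Notation ball u := (\1_unit_ball u : R).
Local Notation exponent a := (cintegral nu (levy_integrand a)).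

(** Deleting the origin after projecting is the same as restricting [nu] to the points with nonzero
    projection. Functions vanishing at the origin do not notice the restriction. *)
Lemma image_off0 n (a : 'I_n -> cdual U) :
  exists2 lam : {measure set (borel 'rV[R]_n) -> \bar R},
    (fun B => cyl_image nu a (B `\` [set 0])) = lam &
    forall g : borel 'rV[R]_n -> R, measurable_fun setT g -> g (0 : 'rV[R]_n) = 0 ->
      (\int[lam]_y (g y)%:E = \int[nu]_u (g (cyl_proj a u))%:E)%E.
Proof.
have mpr := measurable_cyl_proj a.
pose D : set (borel U) := cyl_proj a @^-1` (~` [set 0]).
have mD : measurable D.
  rewrite -[X in measurable X]setTI.
  exact: (mpr measurableT _ (measurableC (@measurable_rV0 R n))).
have [lam lamE] := image_measure mpr (mrestr nu mD).
exists lam => [|g mg g0].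
  by apply/funext => B; rewrite lamE.
rewrite (image_integral mpr (m := mrestr nu mD) (fun B _ => lamE B)); last exact/measurable_EFinP.
apply: integral_mrestr_support => [|u Du].
  by apply/measurable_EFinP; exact: (measurableT_comp mg mpr).
have -> : cyl_proj a u = 0 by apply: contrapT => /Du.
by rewrite g0.
Qed.

(** The passage from cylindrical characteristics back to the weak integrability condition on [nu]:
    it is the one-dimensional case of their projections. *)
Lemma sqmin_levy_measure_of m a : levy_measure_of m
    (fun B => cyl_image nu (fun _ : 'I_1 => a) (B `\` [set 0])) ->
  (\int[nu]_u (Order.min (a u ^+ 2) 1)%:E < +oo)%E.
Proof.
have [lam -> lamI] := image_off0 (fun _ : 'I_1 => a).
move=> [_ _ + _]; rewrite lamI.
- rewrite (eq_integral (fun u : borel U => (Order.min (a u ^+ 2) 1)%:E))// => u _.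
  by rewrite /dot big_ord1 !mxE expr2.
- apply: measurable_minr => //; rewrite /dot; apply: measurable_sum => i.
  by apply: measurable_funM; exact: measurable_coord.
- by rewrite dot0l min_l.
Qed.

Hypothesis minI : forall a, (\int[nu]_u (Order.min (a u ^+ 2) 1)%:E < +oo)%E.
Hypothesis levyI : forall a, cintegrable nu (levy_integrand a).

Let iR a : nu.-integrable setT (EFin \o (fun u => cos (a u) - 1)).
Proof. exact: ((cintegrable_levy_integrand nu a).1 (levyI a)).1. Qed.

Let iI a : nu.-integrable setT (EFin \o (fun u => sin (a u) - a u * ball u)).
Proof. exact: ((cintegrable_levy_integrand nu a).1 (levyI a)).2. Qed.

Variable P : probability (borel U) R.
Hypothesis PE : forall a, charfun P a = cexp (exponent a).

Lemma cf_cyl_image n (a : 'I_n -> cdual U) x :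
  cf (cyl_image P a) x = cexp (exponent (comb a x)).
Proof.
rewrite -PE /cf (image_expi (measurable_cyl_proj a) (m := P)) => [|//|]; last exact: measurable_dot.
by under eq_fun do rewrite -combE.
Qed.

Lemma levy_infinitely_divisible : sigma_finite setT nu -> infinitely_divisible P.
Proof.
move=> /sigma_finiteP[S [ST nS mS]] k k0.
pose r : R := k%:R^-1; have r0 : 0 < r by rewrite invr_gt0 ltr0n.
pose chi a := cexp (r%:C%C * exponent a).
have chi0 : chi 0 = 1 by rewrite /chi levy_exponent0 mulr0 cexp0.
have chik a : chi a ^+ k = cexp (exponent a).
  rewrite -cexpMn -mulr_natl mulrA; congr cexp.
  suff -> : k%:R * r%:C%C = 1 :> R[i] by rewrite mul1r.
  rewrite /r -(rmorph_nat (real_complex R)) -rmorphM/= divff ?rmorph1//.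
  by rewrite pnatr_eq0 -lt0n.
have chiP n (a : 'I_n -> cdual U) :
    exists Q : probability (borel 'rV[R]_n) R, forall x, cf Q x = chi (comb a x).
  (* The compensator uses the unit ball of U, on which functionals are bounded. *)
  pose co (u : borel U) : borel 'rV[R]_n := \row_i (a i u * ball u).
  have dco u x : dot (co u) x = comb a x u * ball u.
    rewrite combE /dot mulr_suml; apply: eq_bigr => i _; rewrite !mxE; ring.
  have mco : measurable_fun setT co.
    apply: measurable_rV => i; under eq_fun do rewrite mxE.
    exact: (mbounded_cdual_ball (a i)).1.
  have bco x : exists C, forall u, `|dot (co u) x| <= C.
    by have [_ [C aC]] := mbounded_cdual_ball (comb a x); exists C => u; rewrite dco.
  have PsiE x : exponent (comb a x) = ((\int[nu]_u (cos (dot (cyl_proj a u) x) - 1)) +i*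
      (\int[nu]_u (sin (dot (cyl_proj a u) x) - dot (co u) x)))%C%R.
    rewrite cintegral_levy_integrand.
    by congr (_ +i* _)%C; apply: eq_Rintegral => u _; rewrite ?dco combE.
  have [] := @levy_root R n _ _ nu (cyl_proj a) co (measurable_cyl_proj a) mco bco S
    (fun j => (mS j).1) nS (esym ST) (fun j => (mS j).2) _ _ r r0 _.
  - by move=> x; apply: eq_integrable (iR (comb a x)) => // u _; rewrite /= combE.
  - by move=> x; apply: eq_integrable (iI (comb a x)) => // u _; rewrite /= dco combE.
  - move=> i; have [cR cI] := continuous_levy_exponent minI levyI (a i).
    have combd t : comb a (t *: delta_mx ord0 i) = t *: a i.
      by apply: cdual_ext => u; rewrite combE dotC dotZl dotC dot_delta mxE.
    have cE z : complex.Re (cexp (r%:C%C * z)) =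
        expR (r * complex.Re z) * cos (r * complex.Im z) :> R.
      by case: z => x y; rewrite /= !mul0r subr0 addr0.
    under eq_fun do rewrite -PsiE combd cE.
    (* Here 1 is rewritten as the value at [t = 0], so the required limit becomes continuity of the
       exponent along the line through [a i]. *)
    have -> : (1 : R) = expR (r * complex.Re (exponent ((0 : R) *: a i))) *
        cos (r * complex.Im (exponent ((0 : R) *: a i))).
      by rewrite scale0r levy_exponent0 !mulr0 expR0 cos0 mulr1.
    apply: cvgM.
      apply: (continuous_cvg _ (@continuous_expR R _)); apply: cvgM; [exact: cvg_cst|exact: cR].
    apply: (continuous_cvg _ (@continuous_cos R _)); apply: cvgM; [exact: cvg_cst|exact: cI].
  - by move=> Q QE; exists Q => x; rewrite QE /chi PsiE.
have [m mP mcf] := cyl_probability_of_cf chi0 chiP; exists m => // n a B mB.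
have [Q QE cQ] := mcf n a.
have [Qk [QkE cQk]] := convolution_pow_probability Q k0.
have [P' PE'] := image_probability (measurable_cyl_proj a) P.
have cP' x : cf P' x = cexp (exponent (comb a x)).
  rewrite -cf_cyl_image; congr (cintegral _ _); apply/funext => C; exact: PE'.
transitivity (P' B); first by rewrite PE'.
rewrite (cf_unique (P2 := Qk))// => [|x]; last by rewrite cP' cQk cQ chik.
by rewrite QkE//; apply: eq_convolution_pow => // C mC; rewrite QE.
Qed.

(** The exponent on R^n truncates by the Euclidean ball, that of [nu] by the ball of U. The
    difference is linear in the argument and becomes the location vector; the Gaussian part is 0. *)
Lemma levy_law_projections n (a : 'I_n -> cdual U) :
  levy_measure_of (cyl_image P a) (fun B => cyl_image nu a (B `\` [set 0])).
Proof.
have [lam lamE lamI] := image_off0 a.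
have lamR (g : borel 'rV[R]_n -> R) : measurable_fun setT g -> g (0 : 'rV[R]_n) = 0 ->
    fine (\int[lam]_y (g y)%:E)%E = (\int[nu]_u g (cyl_proj a u))%R.
  by move=> mg g0; rewrite lamI.
have mdd : measurable_fun setT (fun y : borel 'rV[R]_n => dot y y).
  by apply: measurable_sum => i; apply: measurable_funM; exact: measurable_coord.
pose small (y : 'rV[R]_n) : R := (dot y y <= 1)%R%:R.
have msmall : measurable_fun setT (small : borel 'rV[R]_n -> R).
  rewrite (_ : small = \1_[set y | dot y y <= 1]).
    apply: measurable_indic.
    have := mdd measurableT _ (measurable_itv `]-oo, 1%R]).
    by rewrite setTI; congr measurable; apply/seteqP; split=> y /=; rewrite in_itv.
  apply/funext => y; rewrite indicE; congr (_%:R).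
  by case: (boolP (_ <= _)) => h; [rewrite mem_set|rewrite memNset//; apply/negP].
(* The integral of [c i] is the i-th coordinate of the location vector. Its integrability again
   passes through [sin (a i u)]. *)
pose c i (u : borel U) := a i u * (small (cyl_proj a u) - ball u).
have msq i : measurable_fun setT (fun u : borel U => Order.min (a i u ^+ 2) 1).
  apply: measurable_minr => //; apply: measurable_funX; exact: measurable_cdual.
have min0 i u : 0 <= Order.min (a i u ^+ 2) 1 by rewrite le_min sqr_ge0 ler01.
have sumI (g : borel U -> R) : measurable_fun setT g ->
    (forall u, `|g u| <= \sum_i Order.min (a i u ^+ 2) 1) -> nu.-integrable setT (EFin \o g).
  move=> mg gS; have iS : nu.-integrable setT (fun u => \sum_(i < n) (Order.min (a i u ^+ 2) 1)%:E)%E.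
    apply: integrable_sum => // i _; exact: (integrable_sqmin minI (a i)).
  apply: le_integrable iS => //; first exact/measurable_EFinP.
  by move=> u _; rewrite sumEFin /= lee_fin (le_trans (gS u))// ler_norm.
have dotE u : dot (cyl_proj a u) (cyl_proj a u) = \sum_i a i u ^+ 2.
  by apply: eq_bigr => i _; rewrite mxE expr2.
have dotS u : Order.min (dot (cyl_proj a u) (cyl_proj a u)) 1 <= \sum_i Order.min (a i u ^+ 2) 1.
  rewrite dotE; apply: min_sum_le => i; exact: sqr_ge0.
have ic i : nu.-integrable setT (EFin \o c i).
  have ih : nu.-integrable setT (EFin \o (fun u : borel U => a i u * small (cyl_proj a u) - sin (a i u))).
    apply: sumI => [|u].
      apply: measurable_funB; last exact: (mbounded_sin (measurable_cdual (a i))).1.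
      apply: measurable_funM; first exact: measurable_cdual.
      exact: (measurableT_comp msmall (measurable_cyl_proj a)).
    (* Inside the ball each coordinate is at most 1, so its square is the minimum and bounds the
       error of the sine. Outside, the sum of minima is at least 1 and bounds the sine itself. *)
    rewrite /small; have := dotS u; have [d1|d1] := leP (dot (cyl_proj a u) (cyl_proj a u)) 1.
      move=> _; rewrite mulr1 distrC (le_trans (sin_sub_le _))//.
      have ai : a i u ^+ 2 <= 1.
        rewrite (le_trans _ d1)// dotE (bigD1 i)//= lerDl sumr_ge0// => j _; exact: sqr_ge0.
      by rewrite (bigD1 i)//= min_l// lerDl sumr_ge0.
    by rewrite mulr0 sub0r normrN => h; rewrite (le_trans (sin_max _)).
  apply: eq_integrable (integrableD measurableT ih (iI (a i))) => // u _.
  by rewrite /= -EFinD /c; congr EFin; ring.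
rewrite lamE; split.
- exact: measure_is_measure.
- by rewrite -lamE setDv /cyl_image preimage_set0 measure0.
- rewrite lamI; last by rewrite dot0l min_l.
    have min_ge0 u : 0 <= Order.min (dot (cyl_proj a u) (cyl_proj a u)) 1.
      by rewrite le_min ler01 dotE sumr_ge0// => i _; exact: sqr_ge0.
    have /integrableP[_] : nu.-integrable setT
        (EFin \o (fun u : borel U => Order.min (dot (cyl_proj a u) (cyl_proj a u)) 1)).
      apply: sumI => [|u]; last by rewrite ger0_norm.
      by apply: measurable_minr => //; exact: (measurableT_comp mdd (measurable_cyl_proj a)).
    by under eq_integral do rewrite /= ger0_norm//.
  exact: measurable_minr.
- exists (\row_i (\int[nu]_u c i u)%R), 0; split=> [|x|x].
  + by rewrite trmx0.
  + by rewrite mulmx0 dot0l.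
  rewrite -/(cf _ x) cf_cyl_image; congr cexp.
  have -> : cintegral lam (fun y => expi (dot y x) - 1 - 'i%C * (dot y x * (dot y y <= 1)%R%:R)%:C%C) =
      ((\int[nu]_u (cos (comb a x u) - 1))%R +i*
       (\int[nu]_u (sin (comb a x u) - comb a x u * small (cyl_proj a u)))%R)%C.
    have fE y : expi (dot y x) - 1 - 'i%C * (dot y x * (dot y y <= 1)%R%:R)%:C%C =
        ((cos (dot y x) - 1) +i* (sin (dot y x) - dot y x * small y))%C.
      by rewrite expiE; apply: complex_eq; rewrite /= ?mul0r ?mul1r; ring.
    under eq_fun do rewrite fE.
    have mx := @measurable_dot R n x.
    rewrite /cintegral/= (lamR (fun y => cos (dot y x) - 1)).
    - rewrite (lamR (fun y => sin (dot y x) - dot y x * small y)).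
      + by congr (_ +i* _)%C; apply: eq_Rintegral => u _; rewrite combE.
      + apply: measurable_funB; first exact: (mbounded_sin mx).1.
        exact: measurable_funM.
      + by rewrite dot0l sin0 mul0r subrr.
    - by apply: measurable_funB => //; exact: (mbounded_cos mx).1.
    - by rewrite dot0l cos0 subrr.
  rewrite cintegral_levy_integrand mulmx0 dot0l mul0r; apply: complex_eq => /=; first by ring.
  have combcE : (fun u => comb a x u * (small (cyl_proj a u) - ball u)) =
      (fun u => \sum_i c i u * x ord0 i).
    apply/funext => u; rewrite combE /dot mulr_suml; apply: eq_bigr => i _.
    by rewrite mxE /c mulrAC.
  have [isum dotI] := Rintegral_lincomb (fun i => x ord0 i) measurableT ic.
  rewrite -combcE in isum dotI.
  have -> : dot (\row_i (\int[nu]_u c i u)%R) x =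
      (\int[nu]_u (comb a x u * (small (cyl_proj a u) - ball u)))%R.
    by rewrite dotI; apply: eq_bigr => i _; rewrite mxE.
  transitivity ((\int[nu]_u (comb a x u * (small (cyl_proj a u) - ball u)))%R +
     (\int[nu]_u (sin (comb a x u) - comb a x u * small (cyl_proj a u)))%R); last by ring.
  rewrite -RintegralD//.
  + by apply: eq_Rintegral => u _; ring.
  + apply: eq_integrable (integrableB measurableT (iI (comb a x)) isum) => // u _.
    by rewrite /= -EFinB; congr EFin; ring.
Qed.

End levy_law.

Section extension.
Context {R : realType} {U : normedModType R}.

Lemma cyl_sets1 (a : cdual U) (A : set (cyl_type [set a])) : measurable A -> cyl_sets setT A.
Proof.
move=> /(@cyl_type_measurable _ _ [:: a])[|B mB ->]; first by move=> _ ->; rewrite mem_head.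
by exists 1%N, (fun i : 'I_1 => nth 0 [:: a] i), B.
Qed.

Lemma cyl_setsT : cyl_sets setT (setT : set U).
Proof. by exists 0%N, (fun=> 0), setT; split. Qed.

Variables (nu : {measure set (borel U) -> \bar R}) (h : R -> R) (mu : set U -> \bar R).
Variable M : {measure set (borel U) -> \bar R}.
Hypotheses (hh : truncation h) (driftI : drift_exists nu h).
Hypotheses (muP : cyl_probability mu) (chars : cyl_characteristics h mu (drift nu h) (fun=> 0) nu).
Hypothesis extM : radon_extension mu M.

Lemma extension_charfun (a : cdual U) : cintegrable nu (levy_integrand a) /\
  charfun M a = cexp (cintegral nu (levy_integrand a)).
Proof.
have [mh _ _] := hh; have [_ _ _ psiI [logE _ _]] := chars.
have ipsi : cintegrable nu (fun u => psi h (a u)).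
  exact: (on_cyl_cintegrable_psi (M := nu) (fun A _ => erefl) mh).1 (psiI a).
split; first exact/(cintegrable_levy_psi (driftI a)).
rewrite -(on_cyl_charfun (m := mu)) => [|A mA]; last exact/esym/extM.2/cyl_sets1.
rewrite -logE (on_cyl_cintegral_psi (M := nu) (fun A _ => erefl) mh); congr cexp.
exact: drift_exponent.
Qed.

Lemma extension_probability : exists P : probability (borel U) R, forall A, P A = M A.
Proof.
by apply: measure_probability; rewrite extM.2; [exact: muP.2|exact: cyl_setsT].
Qed.

End extension.

Lemma radon_eq (R : realType) (T : ptopologicalType) (M M' : {measure set (borel T) -> \bar R}) :
  (forall A, M A = M' A) -> radon M -> radon M'.
Proof. by move=> /funext MM' [h1 h2]; rewrite /radon -MM'. Qed.

Lemma eq_charfun (R : realType) (U : normedModType R)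
    (M M' : {measure set (borel U) -> \bar R}) (a : cdual U) :
  (forall A, M A = M' A) -> charfun M a = charfun M' a.
Proof.
by move=> MM'; congr (fine _ +i* fine _)%C; apply: eq_set_function_integral => A _.
Qed.

(** The coincidence holds for any choice of [mu], [M] and [P]: both laws are Radon, and both
    characteristic functions are the exponential of the Levy exponent. *)
Lemma levy_measure_cylindrical (R : realType) (U : completeNormedModType R)
    (nu : {measure set (borel U) -> \bar R})
    (h : R -> R) (hh : truncation h) : sigma_finite setT nu ->
  (levy_measure nu <->
   drift_exists nu h /\
   exists mu : set U -> \bar R,
     [/\ cyl_probability mu,
         infinitely_divisible mu,
         cyl_characteristics h mu (drift nu h) (fun=> 0) nu &
         exists M : {measure set (borel U) -> \bar R}, radon_extension mu M])
  /\
  (levy_measure nu ->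
   forall mu : set U -> \bar R,
     cyl_probability mu ->
     infinitely_divisible mu ->
     cyl_characteristics h mu (drift nu h) (fun=> 0) nu ->
     forall M : {measure set (borel U) -> \bar R}, radon_extension mu M ->
     forall P : probability (borel U) R, radon_levy_law nu P ->
     forall B : set (borel U), measurable B -> P B = M B).
Proof.
move=> sfnu; have levyE : levy_measure nu -> forall a, cintegrable nu (levy_integrand a).
  by move=> [_ [P [_ PE]]] a; exact: (PE a).1.
split; [split|].
- move=> lnu; have [minI [P [radP PE]]] := lnu; have levyI := levyE lnu.
  have driftI := drift_exists_levy hh minI levyI; have [mh _ _] := hh.
  have psiI (a : cdual U) : cintegrable nu (fun u => psi h (a u)).
    exact: (cintegrable_levy_psi (driftI a)).1 (levyI a).
  (* The Levy law itself, read on cylinders, is the cylindrical measure, and it is its own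
     extension. *)
  split=> //; exists P; split.
  + by split; [exact: cyl_measure_restriction|exact: probability_setT].
  + by apply: (levy_infinitely_divisible minI levyI (fun a => (PE a).2)); exact: sfnu.
  + have expE (a : cdual U) : 'i%C * (drift nu h a)%:C%C - (0 / 2)%:C%C +
        cintegral (on_cyl nu (G := [set a])) (fun u => psi h (a u)) =
        cintegral nu (levy_integrand a).
      rewrite (on_cyl_cintegral_psi (M := nu) (fun A _ => erefl) mh).
      exact: drift_exponent.
    split.
    * split=> //; exists (fun _ _ => 0); split=> // *; by rewrite mulr0 addr0.
    * exact: cyl_measure_restriction.
    * move=> n a; exact: (levy_law_projections minI levyI (fun a => (PE a).2)).
    * move=> a; exact: (on_cyl_cintegrable_psi (M := nu) (fun A _ => erefl) mh).2 (psiI a).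
    * split=> [a||a].
      - rewrite expE (on_cyl_charfun (M := P))//; exact/esym/(PE a).2.
      - by rewrite expE levy_exponent0.
      - have [cR cI] := continuous_levy_exponent minI levyI a.
        by split; under eq_fun do rewrite expE.
  + by exists P; split.
- move=> [driftI [mu [muP _ chars [M extM]]]].
  have [P PM] := extension_probability muP extM.
  split.
    move=> a; have [_ _ /(_ 1%N (fun=> a)) lm _ _] := chars.
    exact: sqmin_levy_measure_of lm.
  exists P; split; first by apply: (radon_eq (fun A => esym (PM A))); exact: extM.1.
  by move=> a; rewrite (eq_charfun a PM); exact: (extension_charfun hh driftI chars extM a).
- move=> lnu mu muP _ chars M extM P [radP PE] B mB.
  have [minI _] := lnu; have driftI := drift_exists_levy hh minI (levyE lnu).
  (* [M] is only known to be a measure; its total mass is that of the cylinder [setT], which makes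
     it a probability and hence finite, as uniqueness requires. *)
  have [Q QM] := extension_probability muP extM.
  rewrite -QM; apply: (radon_unique (m1 := P) (m2 := Q)) => // [a c|]; last first.
    by apply: (radon_eq (fun A => esym (QM A))); exact: extM.1.
  rewrite !Rintegral_cosD; try exact: measurable_cdual.
  rewrite -!/(charfun _ a) (PE a).2.
  by rewrite -/(charfun Q a) (eq_charfun a QM) (extension_charfun hh driftI chars extM a).2.
Qed.

Theorem corollary5p2 (R : realType) (U : completeNormedModType R)
    (nu : {sigma_finite_measure set (borel U) -> \bar R})
    (h : R -> R) (hh : truncation h) :
  (levy_measure nu <->
   drift_exists nu h /\
   exists mu : set U -> \bar R,
     [/\ cyl_probability mu,
         infinitely_divisible mu,
         cyl_characteristics h mu (drift nu h) (fun=> 0) nu &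
         exists M : {measure set (borel U) -> \bar R}, radon_extension mu M])
  /\
  (levy_measure nu ->
   forall mu : set U -> \bar R,
     cyl_probability mu ->
     infinitely_divisible mu ->
     cyl_characteristics h mu (drift nu h) (fun=> 0) nu ->
     forall M : {measure set (borel U) -> \bar R}, radon_extension mu M ->
     forall P : probability (borel U) R, radon_levy_law nu P ->
     forall B : set (borel U), measurable B -> P B = M B).
Proof. exact: levy_measure_cylindrical hh (sigma_finiteT nu). Qed.
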